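(* Consider the shock interaction problem described in the context, and let $(\alpha,\beta,t,r)$ be a $C^2$ solution of it on some $T_{\bar\varepsilon}$, $\bar\varepsilon>0$. Then for sufficiently small $\varepsilon\in(0,\bar\varepsilon]$, the functions $\alpha,\beta,t,r$ are infinitely differentiable with respect to $(u,v)$ on $T_\varepsilon$.
   Context: **Fluid.** Let $p=p(\rho)$ be a given smooth function of $\rho>0$ with $\frac{dp}{d\rho}>0$, and $\eta(\rho)=\sqrt{dp/d\rho}$. The equations of motion (spherically symmetric barotropic Euler equations) for the density $\rho(t,r)>0$ and radial velocity $w(t,r)$, $r>0$, are $\partial_t\rho+\partial_r(\rho w)+\frac2r\rho w=0$ and $\partial_t w+w\partial_r w+\frac1\rho\partial_r p=0$. Riemann invariants: $\alpha=\int^\rho\frac{\eta(\rho')}{\rho'}d\rho'+w$, $\beta=\int^\rho\frac{\eta(\rho')}{\rho'}d\rho'-w$ (with a fixed lower limit $>0$); the map $(\rho,w)\mapsto(\alpha,\beta)$ is a diffeomorphism onto its image, and $\rho(\alpha,\beta)$, $w(\alpha,\beta)$ denote the components of its (smooth) inverse; so $w=\frac{\alpha-\beta}2$. Via these, $c_{out}=w+\eta$, $c_{in}=w-\eta$ are smooth functions of $(\alpha,\beta)$. Put $A(\alpha,\beta,r)=-\frac{2\eta w}{r}$. For states $\pm$ write $[f]=f_+-f_-$ and $$J(\alpha_+,\beta_+,\alpha_-,\beta_-)=[\rho w]^2-[\rho w^2+p]\,[\rho],$$ where $\rho_\pm=\rho(\alpha_\pm,\beta_\pm)$, $w_\pm=w(\alpha_\pm,\beta_\pm)$,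 $p_\pm=p(\rho_\pm)$. **States ahead.** Fix $r_0>0$. Index $1$ refers to the left moving shock, index $2$ to the right moving shock. Given are smooth solutions $(\rho_i^*,w_i^* )$, $i=1,2$, of the equations of motion (the future developments of smooth data at $t=0$ given on $r\le r_0$ for $i=1$ and on $r\ge r_0$ for $i=2$), smooth up to the boundary of their domains: $(\rho_1^*,w_1^* )$ on $D_1=\{0\le t\le T_1,\ 0<r\le b_1(t)\}$, where $b_1$ is the left moving characteristic $b_1'(t)=(w_1^*-\eta(\rho_1^* ))(t,b_1(t))$, $b_1(0)=r_0$; and $(\rho_2^*,w_2^* )$ on $D_2=\{0\le t\le T_2,\ r\ge b_2(t)\}$, where $b_2'(t)=(w_2^*+\eta(\rho_2^* ))(t,b_2(t))$, $b_2(0)=r_0$ (with $T_1,T_2>0$, $b_1>0$). Let $\alpha_i^*(t,r),\beta_i^*(t,r)$ be the corresponding Riemann invariants, and $\rho_{i,-0},w_{i,-0},\alpha_{i,-0},\beta_{i,-0}$ the values of $\rho_i^*,w_i^*,\alpha_i^*,\beta_i^*$ at $(t,r)=(0,r_0)$. **Interaction point.** Given are $\rho_0>0$, $w_0=0$ (common state behind at the interaction point) and shock speeds $V_{1,0},V_{2,0}$ satisfying, for $i=1,2$, the jump conditions $[\rho]V_{i,0}=[\rho w]$, $[\rho w]V_{i,0}=[\rho w^2+p]$ with state $+$ equal to $(\rho_0,0)$ and state $-$ equal to $(\rho_{i,-0},w_{i,-0})$, and the determinism condition, with $\eta_0=\eta(\rho_0)$: $$-\eta_0<V_{1,0}<w_{1,-0}-\eta(\rho_{1,-0})<0,\qquad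 0<w_{2,-0}+\eta(\rho_{2,-0})<V_{2,0}<\eta_0.$$ Let $\beta_0$ be the common value of $\alpha$ and $\beta$ at the state $(\rho_0,0)$. Define $$\Gamma_0=-\frac{\eta_0+V_{1,0}}{\eta_0-V_{1,0}}<0,\qquad a=\frac{\eta_0+V_{1,0}}{\eta_0-V_{1,0}}\cdot\frac{\eta_0-V_{2,0}}{\eta_0+V_{2,0}}\in(0,1).$$ By the implicit function theorem there are smooth functions $H_1$ near $(\beta_0,\alpha_{1,-0},\beta_{1,-0})$ and $H_2$ near $(\beta_0,\alpha_{2,-0},\beta_{2,-0})$, equal to $\beta_0$ at those points, with $J(H_1(\beta_+,\alpha_-,\beta_-),\beta_+,\alpha_-,\beta_-)=0$ and $J(\alpha_+,H_2(\alpha_+,\alpha_-,\beta_-),\alpha_-,\beta_-)=0$. Let $F_{i,0},M_{i1,0},M_{i2,0}$ be the partial derivatives of $H_i$ in its first, second and third argument at $(\beta_0,\alpha_{i,-0},\beta_{i,-0})$; one has $F_{1,0}F_{2,0}=a^2$. With $a_1=1$, $a_2=a$, put, for $f=\alpha,\beta$, $$f_{i,-}'(0)=\partial_t f_i^*(0,r_0)\,\tfrac1{\eta_0}\Big(1-\tfrac{a_i}{\Gamma_0}\Big)+\partial_r f_i^*(0,r_0)\Big(1+\tfrac{a_i}{\Gamma_0}\Big).$$ The constants $\alpha_0',\beta_0'$ are defined as the unique solution of $$\alpha_0'=F_{1,0}\beta_0'+M_{11,0}\alpha_{1,-}'(0)+M_{12,0}\beta_{1,-}'(0),\qquad \beta_0'=aF_{2,0}\alpha_0'+M_{21,0}\alpha_{2,-}'(0)+M_{22,0}\beta_{2,-}'(0).$$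 **Domain.** For $\varepsilon>0$, $T_\varepsilon=\{(u,v)\in\mathbb R^2: 0\le u\le v\le \frac ua\le\varepsilon\}$. $C^k(T_\varepsilon)$ means $k$ times continuously differentiable up to the boundary. **Shock interaction problem on $T_\varepsilon$.** Find functions $\alpha,\beta,t,r$ of $(u,v)\in T_\varepsilon$ such that the following hold. (i) In $T_\varepsilon$: $\frac{\partial r}{\partial u}=c_{in}\frac{\partial t}{\partial u}$, $\frac{\partial r}{\partial v}=c_{out}\frac{\partial t}{\partial v}$, $\frac{\partial\alpha}{\partial v}=A\frac{\partial t}{\partial v}$, $\frac{\partial\beta}{\partial u}=A\frac{\partial t}{\partial u}$, with $c_{in},c_{out}$ evaluated at $(\alpha,\beta)$ and $A$ at $(\alpha,\beta,r)$. (ii) For any function $f$ on $T_\varepsilon$ put $f_{1,+}(u)=f(u,u)$ for $u\in[0,a\varepsilon]$ and $f_{2,+}(v)=f(av,v)$ for $v\in[0,\varepsilon]$. The curves $(t_{i,+},r_{i,+})$ lie in $D_i$, and $\alpha_{i,-}=\alpha_i^*(t_{i,+},r_{i,+})$, $\beta_{i,-}=\beta_i^*(t_{i,+},r_{i,+})$. With $\rho_{i,\pm}=\rho(\alpha_{i,\pm},\beta_{i,\pm})$, $w_{i,\pm}=w(\alpha_{i,\pm},\beta_{i,\pm})$ and $V_i=\frac{\rho_{i,+}w_{i,+}-\rho_{i,-}w_{i,-}}{\rho_{i,+}-\rho_{i,-}}$, one has the boundary conditions $\frac{dr_{1,+}}{du}=V_1\frac{dt_{1,+}}{du}$ on $[0,a\varepsilon]$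 and $\frac{dr_{2,+}}{dv}=V_2\frac{dt_{2,+}}{dv}$ on $[0,\varepsilon]$. (iii) Jump conditions: $J(\alpha_{i,+},\beta_{i,+},\alpha_{i,-},\beta_{i,-})=0$, $i=1,2$. (iv) At the origin: $t(0,0)=0$, $r(0,0)=r_0$, $\frac{\partial r}{\partial v}(0,0)=1$, $\alpha(0,0)=\beta(0,0)=\beta_0$, $\frac{\partial\alpha}{\partial u}(0,0)=\alpha_0'$, $\frac{\partial\beta}{\partial v}(0,0)=\beta_0'$, $V_i(0)=V_{i,0}$, $i=1,2$. (v) Determinism: with $c_{in,1,\pm}=c_{in}(\alpha_{1,\pm},\beta_{1,\pm})$ and $c_{out,2,\pm}=c_{out}(\alpha_{2,\pm},\beta_{2,\pm})$, one has $c_{in,1,+}(u)<V_1(u)<c_{in,1,-}(u)$ for $u\in[0,a\varepsilon]$ and $c_{out,2,-}(v)<V_2(v)<c_{out,2,+}(v)$ for $v\in[0,\varepsilon]$. *)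

(* Defs.v *)
From Stdlib Require Import Reals ClassicalEpsilon.
From Coquelicot Require Import Coquelicot.
Open Scope R_scope.

(** Derivatives on a set [D] are Fréchet derivatives relative to [D]: increments
    are taken inside [D] only.  They are unique on the sets used below (triangles,
    closed intervals, regions bounded by a C^1 curve), including at corner points
    through which a coordinate line meets [D] in that point alone. *)

Definition is_grad (D : R * R -> Prop) (f : R * R -> R) (q : R * R) (fx fy : R)
  : Prop :=
  filterdiff f (within D (locally q)) (fun h : R * R => fx * fst h + fy * snd h).

Definition is_derive_on (I : R -> Prop) (f : R -> R) (x l : R) : Prop :=
  filterdiff f (within I (locally x)) (fun h : R => h * l).

(** The derivative [df] has values in the linear forms on [E]; as [E] is only
    [R], [R * R] or [R * R * R], it is C^n as soon as [fun x => df x h] is C^n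
    for every fixed vector [h]. *)
Fixpoint Ck_on {E : NormedModule R_AbsRing} (n : nat) (D : E -> Prop) (f : E -> R)
  : Prop :=
  match n with
  | O => continuous_on D f
  | S m => exists df : E -> E -> R,
      (forall x, D x -> filterdiff f (within D (locally x)) (df x)) /\
      (forall h, Ck_on m D (fun x => df x h))
  end.

Definition smooth_on {E : NormedModule R_AbsRing} (D : E -> Prop) (f : E -> R)
  : Prop :=
  forall n, Ck_on n D f.

Record fluid := {
  pressure : R -> R;
  rho_ref : R; (* lower limit of the integral in the Riemann invariants *)
  pressure_smooth : smooth_on (fun s : R => 0 < s) pressure;
  pressure_incr : forall s, 0 < s -> 0 < Derive pressure s;
  rho_ref_pos : 0 < rho_ref }.

Definition eta (F : fluid) (rho : R) : R := sqrt (Derive (pressure F) rho).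

Definition enthalpy_int (F : fluid) (rho : R) : R :=
  RInt (fun s => eta F s / s) (rho_ref F) rho.

Definition riem_alpha (F : fluid) (rho w : R) : R := enthalpy_int F rho + w.
Definition riem_beta (F : fluid) (rho w : R) : R := enthalpy_int F rho - w.

Definition is_state (F : fluid) (al be : R) (s : R * R) : Prop :=
  0 < fst s /\ riem_alpha F (fst s) (snd s) = al /\ riem_beta F (fst s) (snd s) = be.

Definition in_image (F : fluid) (al be : R) : Prop := exists s, is_state F al be s.

(** Inverse of [(rho, w) |-> (alpha, beta)]; unspecified outside the image. *)
Definition state_of (F : fluid) (al be : R) : R * R :=
  epsilon (inhabits (1, 0)) (is_state F al be).

Definition rho_of (F : fluid) (al be : R) : R := fst (state_of F al be).
Definition w_of (F : fluid) (al be : R) : R := snd (state_of F al be).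

Definition c_out (F : fluid) (al be : R) : R :=
  w_of F al be + eta F (rho_of F al be).
Definition c_in (F : fluid) (al be : R) : R :=
  w_of F al be - eta F (rho_of F al be).

Definition A_coef (F : fluid) (al be r : R) : R :=
  - (2 * eta F (rho_of F al be) * w_of F al be / r).

Definition euler_at (F : fluid) (D : R * R -> Prop) (rho w : R * R -> R) (q : R * R)
  : Prop :=
  exists rho_t rho_r m_t m_r w_t w_r p_t p_r : R,
    is_grad D rho q rho_t rho_r /\
    is_grad D (fun x => rho x * w x) q m_t m_r /\
    is_grad D w q w_t w_r /\
    is_grad D (fun x => pressure F (rho x)) q p_t p_r /\
    rho_t + m_r + 2 / snd q * rho q * w q = 0 /\
    w_t + w q * w_r + / rho q * p_r = 0.

Definition rankine_hugoniot (F : fluid) (rhop wp rhom wm V : R) : Prop :=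
  (rhop - rhom) * V = rhop * wp - rhom * wm /\
  (rhop * wp - rhom * wm) * V =
    (rhop * wp ^ 2 + pressure F rhop) - (rhom * wm ^ 2 + pressure F rhom).

Definition J (F : fluid) (alp bep alm bem : R) : R :=
  let rhop := rho_of F alp bep in let wp := w_of F alp bep in
  let rhom := rho_of F alm bem in let wm := w_of F alm bem in
  (rhop * wp - rhom * wm) ^ 2 -
  ((rhop * wp ^ 2 + pressure F rhop) - (rhom * wm ^ 2 + pressure F rhom)) *
  (rhop - rhom).

(** Along a solution [rhop = rhom] is excluded by the jump and determinism
    conditions, so the quotient is never by zero. *)
Definition shock_speed (F : fluid) (alp bep alm bem : R) : R :=
  let rhop := rho_of F alp bep in let wp := w_of F alp bep in
  let rhom := rho_of F alm bem in let wm := w_of F alm bem in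
  (rhop * wp - rhom * wm) / (rhop - rhom).

(** State ahead of a shock, with the bounding characteristic [r = b_a t],
    [0 <= t <= T_a].  Points of space-time are pairs [(t, r)]. *)

Record ahead := {
  rho_a : R * R -> R;
  w_a : R * R -> R;
  T_a : R;
  b_a : R -> R }.

Definition alpha_a (F : fluid) (S : ahead) (q : R * R) : R :=
  riem_alpha F (rho_a S q) (w_a S q).
Definition beta_a (F : fluid) (S : ahead) (q : R * R) : R :=
  riem_beta F (rho_a S q) (w_a S q).

Definition D_left (S : ahead) (q : R * R) : Prop :=
  0 <= fst q <= T_a S /\ 0 < snd q <= b_a S (fst q).
(** [r] is a radius, hence [0 < r]; automatic when [b_a] is positive. *)
Definition D_right (S : ahead) (q : R * R) : Prop :=
  0 <= fst q <= T_a S /\ 0 < snd q /\ b_a S (fst q) <= snd q.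

Definition smooth_flow (F : fluid) (D : R * R -> Prop) (S : ahead) : Prop :=
  smooth_on D (rho_a S) /\ smooth_on D (w_a S) /\
  forall q, D q -> 0 < rho_a S q /\ euler_at F D (rho_a S) (w_a S) q.

Definition left_ahead (F : fluid) (r0 : R) (S : ahead) : Prop :=
  0 < T_a S /\
  b_a S 0 = r0 /\
  (forall t, 0 <= t <= T_a S ->
    0 < b_a S t /\
    is_derive_on (fun x => 0 <= x <= T_a S) (b_a S) t
      (w_a S (t, b_a S t) - eta F (rho_a S (t, b_a S t)))) /\
  smooth_flow F (D_left S) S.

Definition right_ahead (F : fluid) (r0 : R) (S : ahead) : Prop :=
  0 < T_a S /\
  b_a S 0 = r0 /\
  (forall t, 0 <= t <= T_a S ->
    is_derive_on (fun x => 0 <= x <= T_a S) (b_a S) t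
      (w_a S (t, b_a S t) + eta F (rho_a S (t, b_a S t)))) /\
  smooth_flow F (D_right S) S.

Definition interaction_point (F : fluid) (r0 : R) (S1 S2 : ahead)
    (rho0 V10 V20 : R) : Prop :=
  0 < rho0 /\
  rankine_hugoniot F rho0 0 (rho_a S1 (0, r0)) (w_a S1 (0, r0)) V10 /\
  rankine_hugoniot F rho0 0 (rho_a S2 (0, r0)) (w_a S2 (0, r0)) V20 /\
  - eta F rho0 < V10 < w_a S1 (0, r0) - eta F (rho_a S1 (0, r0)) /\
  w_a S1 (0, r0) - eta F (rho_a S1 (0, r0)) < 0 /\
  0 < w_a S2 (0, r0) + eta F (rho_a S2 (0, r0)) < V20 /\
  V20 < eta F rho0.

Definition beta0 (F : fluid) (rho0 : R) : R := riem_beta F rho0 0.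

Definition Gamma0 (eta0 V10 : R) : R := - ((eta0 + V10) / (eta0 - V10)).

Definition a_of (eta0 V10 V20 : R) : R :=
  (eta0 + V10) / (eta0 - V10) * ((eta0 - V20) / (eta0 + V20)).

Definition origin_ahead (F : fluid) (r0 rho0 : R) (S : ahead) : R * R * R :=
  (beta0 F rho0, alpha_a F S (0, r0), beta_a F S (0, r0)).

Definition is_H1 (F : fluid) (r0 rho0 : R) (S1 : ahead) (H1 : R * R * R -> R)
  : Prop :=
  H1 (origin_ahead F r0 rho0 S1) = beta0 F rho0 /\
  exists U : R * R * R -> Prop,
    open U /\ U (origin_ahead F r0 rho0 S1) /\ smooth_on U H1 /\
    forall bep alm bem, U (bep, alm, bem) ->
      J F (H1 (bep, alm, bem)) bep alm bem = 0.

Definition is_H2 (F : fluid) (r0 rho0 : R) (S2 : ahead) (H2 : R * R * R -> R)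
  : Prop :=
  H2 (origin_ahead F r0 rho0 S2) = beta0 F rho0 /\
  exists U : R * R * R -> Prop,
    open U /\ U (origin_ahead F r0 rho0 S2) /\ smooth_on U H2 /\
    forall alp alm bem, U (alp, alm, bem) ->
      J F alp (H2 (alp, alm, bem)) alm bem = 0.

Definition partial1 (H : R * R * R -> R) (q : R * R * R) : R :=
  let '(x, y, z) := q in Derive (fun s => H (s, y, z)) x.
Definition partial2 (H : R * R * R -> R) (q : R * R * R) : R :=
  let '(x, y, z) := q in Derive (fun s => H (x, s, z)) y.
Definition partial3 (H : R * R * R -> R) (q : R * R * R) : R :=
  let '(x, y, z) := q in Derive (fun s => H (x, y, s)) z.

(** [l] is the derivative of [f] along the tangent
    [(t', r') = ((1 - ai / G0) / eta0, 1 + ai / G0)] at [(0, r0)] of the boundary curve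
    [u |-> (t, r)(u, u)] (for [ai = 1]) or [v |-> (t, r)(a v, v)] (for [ai = a]). *)
Definition is_slope_ahead (D : R * R -> Prop) (f : R * R -> R)
    (r0 eta0 G0 ai l : R) : Prop :=
  exists f_t f_r : R,
    is_grad D f (0, r0) f_t f_r /\
    l = f_t * (1 / eta0) * (1 - ai / G0) + f_r * (1 + ai / G0).

Definition origin_slopes (F : fluid) (r0 : R) (S1 S2 : ahead)
    (rho0 V10 V20 : R) (H1 H2 : R * R * R -> R) (dal0 dbe0 : R) : Prop :=
  let eta0 := eta F rho0 in
  let G0 := Gamma0 eta0 V10 in
  let a := a_of eta0 V10 V20 in
  let q1 := origin_ahead F r0 rho0 S1 in
  let q2 := origin_ahead F r0 rho0 S2 in
  exists dal1 dbe1 dal2 dbe2 : R,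
    is_slope_ahead (D_left S1) (alpha_a F S1) r0 eta0 G0 1 dal1 /\
    is_slope_ahead (D_left S1) (beta_a F S1) r0 eta0 G0 1 dbe1 /\
    is_slope_ahead (D_right S2) (alpha_a F S2) r0 eta0 G0 a dal2 /\
    is_slope_ahead (D_right S2) (beta_a F S2) r0 eta0 G0 a dbe2 /\
    dal0 = partial1 H1 q1 * dbe0 + partial2 H1 q1 * dal1 + partial3 H1 q1 * dbe1 /\
    dbe0 = a * partial1 H2 q2 * dal0 + partial2 H2 q2 * dal2 + partial3 H2 q2 * dbe2.

Definition T_dom (a eps : R) (q : R * R) : Prop :=
  0 <= fst q /\ fst q <= snd q /\ snd q <= fst q / a /\ fst q / a <= eps.

(** Speed of the shock with state [S] ahead at a boundary point [q] of [T_dom]. *)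
Definition speed_at (F : fluid) (S : ahead) (alpha beta t r : R * R -> R)
    (q : R * R) : R :=
  shock_speed F (alpha q) (beta q) (alpha_a F S (t q, r q)) (beta_a F S (t q, r q)).

Record shock_solution (F : fluid) (r0 : R) (S1 S2 : ahead)
    (rho0 V10 V20 dal0 dbe0 a eps : R) (alpha beta t r : R * R -> R) : Prop := {
  (* implicit in evaluating [c_in], [c_out] and [A_coef] *)
  sol_range : forall q, T_dom a eps q -> in_image F (alpha q) (beta q) /\ 0 < r q;

  sol_pde : forall q, T_dom a eps q ->
    exists r_u r_v t_u t_v al_u al_v be_u be_v : R,
      is_grad (T_dom a eps) r q r_u r_v /\
      is_grad (T_dom a eps) t q t_u t_v /\
      is_grad (T_dom a eps) alpha q al_u al_v /\
      is_grad (T_dom a eps) beta q be_u be_v /\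
      r_u = c_in F (alpha q) (beta q) * t_u /\
      r_v = c_out F (alpha q) (beta q) * t_v /\
      al_v = A_coef F (alpha q) (beta q) (r q) * t_v /\
      be_u = A_coef F (alpha q) (beta q) (r q) * t_u;

  sol_bdry1 : forall u, 0 <= u <= a * eps ->
    D_left S1 (t (u, u), r (u, u)) /\
    exists dr dt : R,
      is_derive_on (fun x => 0 <= x <= a * eps) (fun x => r (x, x)) u dr /\
      is_derive_on (fun x => 0 <= x <= a * eps) (fun x => t (x, x)) u dt /\
      dr = speed_at F S1 alpha beta t r (u, u) * dt;
  sol_bdry2 : forall v, 0 <= v <= eps ->
    D_right S2 (t (a * v, v), r (a * v, v)) /\
    exists dr dt : R,
      is_derive_on (fun x => 0 <= x <= eps) (fun x => r (a * x, x)) v dr /\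
      is_derive_on (fun x => 0 <= x <= eps) (fun x => t (a * x, x)) v dt /\
      dr = speed_at F S2 alpha beta t r (a * v, v) * dt;

  sol_jump1 : forall u, 0 <= u <= a * eps ->
    let x := (t (u, u), r (u, u)) in
    J F (alpha (u, u)) (beta (u, u)) (alpha_a F S1 x) (beta_a F S1 x) = 0;
  sol_jump2 : forall v, 0 <= v <= eps ->
    let x := (t (a * v, v), r (a * v, v)) in
    J F (alpha (a * v, v)) (beta (a * v, v)) (alpha_a F S2 x) (beta_a F S2 x) = 0;

  sol_origin :
    t (0, 0) = 0 /\ r (0, 0) = r0 /\
    alpha (0, 0) = beta0 F rho0 /\ beta (0, 0) = beta0 F rho0;
  sol_origin_deriv :
    exists r_u al_v be_u : R,
      is_grad (T_dom a eps) r (0, 0) r_u 1 /\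
      is_grad (T_dom a eps) alpha (0, 0) dal0 al_v /\
      is_grad (T_dom a eps) beta (0, 0) be_u dbe0;
  sol_origin_speed :
    speed_at F S1 alpha beta t r (0, 0) = V10 /\
    speed_at F S2 alpha beta t r (0, 0) = V20;

  sol_determinism1 : forall u, 0 <= u <= a * eps ->
    let x := (t (u, u), r (u, u)) in
    c_in F (alpha (u, u)) (beta (u, u)) < speed_at F S1 alpha beta t r (u, u)
      < c_in F (alpha_a F S1 x) (beta_a F S1 x);
  sol_determinism2 : forall v, 0 <= v <= eps ->
    let x := (t (a * v, v), r (a * v, v)) in
    c_out F (alpha_a F S2 x) (beta_a F S2 x)
      < speed_at F S2 alpha beta t r (a * v, v)
      < c_out F (alpha (a * v, v)) (beta (a * v, v)) }.

(* Main.v *)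
Require Import Defs.
From Stdlib Require Import Reals Lra Lia Psatz ClassicalEpsilon.
From Coquelicot Require Import Coquelicot.
Open Scope R_scope.

(** Put [x = t_u], [y = t_v], [m = alpha_u / x], [n = beta_v / y].  Equality of mixed partial
    derivatives turns the equations into [x_v = y_u = x y K], [m_v = y N], [n_u = x N'], with
    [K], [N], [N'] polynomials in [m], [n] whose coefficients depend on [alpha], [beta], [r]
    only.  With [V] the shock speed and [g = (V - c_in) / (c_out - V)], the shock condition on
    the edge [(b s, s)] is [y = b g x], and differentiating [J = 0] along it gives
    [m + g^3 n = psi], where [g] and [psi] depend on the boundary values of
    [alpha], [beta], [t], [r] only.

    If [x, y, m, n] are C^k, then [alpha], [beta], [t], [r] are C^(k+1), and the transversal
    derivatives [(m_u, n_v)], then [(x_u, y_v)], solve linear transport equations along the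
    characteristics with C^k data, reflected at both edges with C^k coefficients.  Solving along
    the characteristics, the trace [z] of [m_u] or [x_u] on the diagonal satisfies a functional
    equation [z u = kap u * z (a * u) + sig u] with [kap], [sig] of class C^k, where [kap 0] is
    [a^4] for [m_u] and [a] for [x_u].  Where [|kap| <= th < 1], every continuous solution is
    C^k: iteration from [0] converges together with its derivatives.  Hence [x, y, m, n] are
    C^(k+1), on a triangle that does not depend on [k]. *)

(** Dividing [alpha_u] by [t_u] and [beta_v] by [t_v] makes the differentiated jump relation
    homogeneous: the derivative of [t] along the shock cancels, and one combination of [m], [n] is
    expressed by boundary values that have one derivative more than [m], [n] themselves. This
    surplus pays for differentiating the relation once more along the edge. The pair [(m_u, n_v)]
    has to come first because [K] contains [m] and [n], so the source in the equation for [x_u]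
    contains [m_u]. One triangle serves all orders since differentiating the functional equation
    replaces [kap] by [a * kap], which obeys the same bound. At the origin the ratios on the two
    edges satisfy [g1 = a * g2], by the definition of [a]; a round trip multiplies [m_u] by
    [a * g1^3 / g2^3] and [x_u] by [a^2 * g2 / g1], whence [a^4] and [a]. The obstacle is that a C^2
    solution makes [m] and [x] only C^1: the transport equations of [m_u] and [x_u] cannot be
    obtained from second derivatives, and are read off from integrals along the characteristics. *)

Local Notation R1 := R_NormedModule.
Local Notation R2 := (prod_NormedModule R_AbsRing R1 R1).
Local Notation CkR := (Ck_on (E := R1)).
Local Notation CkR2 := (Ck_on (E := R2)).

(** * Calculus of [Ck_on] *)

Lemma within_filter_lim {E : NormedModule R_AbsRing} (D : E -> Prop) (x : E) :
  is_filter_lim (within D (locally x)) x.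
Proof. intros P HP. unfold within. now apply filter_imp with (2 := HP). Qed.

Lemma within_proper {E : NormedModule R_AbsRing} (D : E -> Prop) (x : E) :
  D x -> ProperFilter (within D (locally x)).
Proof.
intros Hx; split.
- intros P HP. exists x. exact (locally_singleton _ _ HP Hx).
- apply within_filter, locally_filter.
Qed.

Section Calculus.
Context {E : NormedModule R_AbsRing}.
Implicit Types (D : E -> Prop) (f g : E -> R).

(** [filterdiff] quantifies over all limit points of its filter. Since [G] is proper, [x] is the
    only one, and the estimate at [x] passes to the finer filter. *)
Lemma filterdiff_filter_le {U V : NormedModule R_AbsRing} (F G : (U -> Prop) -> Prop)
    (f : U -> V) (l : U -> V) (x : U) :
  ProperFilter G -> is_filter_lim G x -> (forall P, F P -> G P) -> is_filter_lim F x ->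
  filterdiff f F l -> filterdiff f G l.
Proof.
intros PG HG HFG HF [Hl H]; split; [exact Hl|].
intros y Hy.
assert (y = x) by exact (is_filter_lim_unique _ _ Hy HG). subst y.
intros eps. apply HFG. exact (H x HF eps).
Qed.

Lemma fderiv_ext D f g (x : E) l :
  D x -> (forall y, D y -> f y = g y) ->
  filterdiff f (within D (locally x)) l -> filterdiff g (within D (locally x)) l.
Proof.
intros Hx H. apply (filterdiff_ext_loc (F := within D (locally x))).
- unfold within. apply filter_forall. exact H.
- intros y Hy. pose proof (within_proper D x Hx) as PF.
  rewrite (is_filter_lim_unique y x Hy (within_filter_lim D x)). now apply H.
Qed.

Lemma fderiv_ext_lin D f (x : E) (l l' : E -> R) :
  (forall y, l y = l' y) ->
  filterdiff f (within D (locally x)) l -> filterdiff f (within D (locally x)) l'.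
Proof. intros H Hf. now apply filterdiff_ext_lin with l. Qed.

Lemma fderiv_subset D D' f (x : E) l :
  D' x -> (forall y, D' y -> D y) ->
  filterdiff f (within D (locally x)) l -> filterdiff f (within D' (locally x)) l.
Proof.
intros Hx H. apply filterdiff_filter_le with x.
- now apply within_proper.
- apply within_filter_lim.
- intros P. unfold within. apply filter_imp. auto.
- apply within_filter_lim.
Qed.

Lemma fderiv_continuous D f (x : E) l :
  filterdiff f (within D (locally x)) l ->
  filterlim f (within D (locally x)) (locally (f x)).
Proof.
intros H. assert (FF : Filter (within D (locally x))) by (apply within_filter, locally_filter).
exact (filterdiff_continuous_aux (F := within D (locally x)) (V := R1) f
  (ex_intro _ l H) x (within_filter_lim D x)).
Qed.

Lemma fderiv_plus D f g (x : E) lf lg :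
  filterdiff f (within D (locally x)) lf -> filterdiff g (within D (locally x)) lg ->
  filterdiff (fun y => f y + g y) (within D (locally x)) (fun h => lf h + lg h).
Proof.
exact (filterdiff_plus_fct (V := R1) (F := within D (locally x)) f g lf lg).
Qed.

Lemma fderiv_const D (c : R) (x : E) :
  filterdiff (fun _ : E => c) (within D (locally x)) (fun _ : E => 0).
Proof. exact (filterdiff_const (V := R1) (F := within D (locally x)) c). Qed.

Lemma fderiv_linear D (l : E -> R) (x : E) :
  is_linear l -> filterdiff l (within D (locally x)) l.
Proof. apply filterdiff_linear. Qed.

(** As [f] is continuous and maps [D] to [D2], it carries the relative filter at [x] to one finer
    than the relative filter at [f x]; the chain rule for filters then applies. *)
Lemma fderiv_comp {U : NormedModule R_AbsRing} D (D2 : U -> Prop) (f : E -> U) (g : U -> R)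
    (x : E) lf lg :
  D x -> (forall y, D y -> D2 (f y)) ->
  filterdiff f (within D (locally x)) lf ->
  filterdiff g (within D2 (locally (f x))) lg ->
  filterdiff (fun y => g (f y)) (within D (locally x)) (fun h => lg (lf h)).
Proof.
intros Hx HD Hf Hg.
pose proof (within_proper D x Hx) as PF.
assert (Hc : filterlim f (within D (locally x)) (locally (f x))).
{ exact (filterdiff_continuous_aux (F := within D (locally x)) f
    (ex_intro _ lf Hf) x (within_filter_lim D x)). }
apply (filterdiff_comp (F := within D (locally x)) f g lf lg Hf).
apply filterdiff_filter_le with (4 := within_filter_lim D2 (f x)) (5 := Hg).
- now apply filtermap_proper_filter.
- intros P HP. exact (Hc P HP).
- intros P HP. unfold within in HP. unfold filtermap.
  generalize (Hc _ HP). unfold filtermap, within.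
  apply filter_imp. intros y Hy Dy. exact (Hy Dy (HD y Dy)).
Qed.

Lemma fderiv_pair D (f g : E -> R) (x : E) lf lg :
  D x ->
  filterdiff f (within D (locally x)) lf -> filterdiff g (within D (locally x)) lg ->
  filterdiff (fun y => (f y, g y) : R2)
    (within D (locally x)) (fun h => (lf h, lg h)).
Proof.
intros Hx Hf Hg. pose proof (within_proper D x Hx) as PF.
apply (filterdiff_comp_2 (F := within D (locally x)) f g
  (fun a b => (a, b) : R2)
  lf lg (fun a b => (a, b)) Hf Hg).
apply filterdiff_ext with (fun t => t); [now intros []|].
apply filterdiff_ext_lin with (fun t => t); [|now intros []].
apply filterdiff_id.
Qed.

Lemma fderiv_comp2 D (D2 : R * R -> Prop) f g (G : R * R -> R)
    (x : E) lf lg (p q : R) :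
  D x -> (forall y, D y -> D2 (f y, g y)) ->
  filterdiff f (within D (locally x)) lf -> filterdiff g (within D (locally x)) lg ->
  is_grad D2 G (f x, g x) p q ->
  filterdiff (fun y => G (f y, g y)) (within D (locally x)) (fun h => p * lf h + q * lg h).
Proof.
intros Hx HD Hf Hg HG.
exact (fderiv_comp D D2
  (fun y => (f y, g y) : R2) G x _ _
  Hx HD (fderiv_pair D f g x lf lg Hx Hf Hg) HG).
Qed.

Lemma fderiv_comp1 D (I : R -> Prop) f (g : R -> R) (x : E) lf (l : R) :
  D x -> (forall y, D y -> I (f y)) ->
  filterdiff f (within D (locally x)) lf -> is_derive_on I g (f x) l ->
  filterdiff (fun y => g (f y)) (within D (locally x)) (fun h => l * lf h).
Proof.
intros Hx HD Hf Hg.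
apply fderiv_ext_lin with (fun h => lf h * l); [intros y; apply Rmult_comm|].
exact (fderiv_comp (U := R1) D I f g x _ _ Hx HD Hf Hg).
Qed.

Lemma is_grad_mult_R2 (D2 : R * R -> Prop) (q : R * R) :
  D2 q -> is_grad D2 (fun t => fst t * snd t) q (snd q) (fst q).
Proof.
intros Hq. unfold is_grad.
pose proof (within_proper (E := R2) D2 q Hq)
  as PF.
assert (HF : is_filter_lim (T := prod_UniformSpace R_UniformSpace R_UniformSpace)
   (within D2 (locally q)) q).
{ intros P HP. unfold within. now apply filter_imp with (2 := HP). }
refine (filterdiff_ext_lin (U := R2)
  (V := R1) _ _ _
  (filterdiff_mult (K := R_AbsRing) (F := within D2 (locally q)) q HF Rmult_comm) _).
intros [a b]; simpl. unfold plus, mult; simpl. ring.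
Qed.

Lemma fderiv_mult D f g (x : E) lf lg :
  D x ->
  filterdiff f (within D (locally x)) lf -> filterdiff g (within D (locally x)) lg ->
  filterdiff (fun y => f y * g y) (within D (locally x)) (fun h => g x * lf h + f x * lg h).
Proof.
intros Hx Hf Hg.
exact (fderiv_comp2 D (fun _ => True) f g (fun t => fst t * snd t) x lf lg _ _ Hx
  (fun _ _ => Logic.I) Hf Hg (is_grad_mult_R2 (fun _ => True) (f x, g x) Logic.I)).
Qed.

Lemma Ck_on_ext n D f g :
  (forall x, D x -> f x = g x) -> Ck_on n D f -> Ck_on n D g.
Proof.
intros H. destruct n as [|n]; simpl.
- intros Hf x Hx. rewrite <- (H x Hx).
  apply filterlim_within_ext with f; auto.
- intros [df [H1 H2]]. exists df. split; [|exact H2].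
  intros x Hx. apply fderiv_ext with f; auto.
Qed.

Lemma Ck_on_subset n D D' f :
  (forall x, D' x -> D x) -> Ck_on n D f -> Ck_on n D' f.
Proof.
intros H. revert f; induction n as [|n IH]; intros f; simpl.
- intros Hf x Hx. apply filterlim_filter_le_1 with (2 := Hf x (H x Hx)).
  intros P. unfold within. apply filter_imp. auto.
- intros [df [H1 H2]]. exists df. split; [|auto].
  intros x Hx. apply fderiv_subset with D; auto.
Qed.

Lemma Ck_on_S n D f : Ck_on (S n) D f -> Ck_on n D f.
Proof.
revert f; induction n as [|n IH]; intros f [df [H1 H2]].
- intros x Hx. exact (fderiv_continuous D f x (df x) (H1 x Hx)).
- exists df. split; [exact H1|]. intros h. apply IH, H2.
Qed.

Lemma Ck_on_le n m D f : (n <= m)%nat -> Ck_on m D f -> Ck_on n D f.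
Proof. induction 1 as [|m _ IH]; auto. intros H. apply IH, Ck_on_S, H. Qed.

Lemma Ck_on_const n D (c : R) : Ck_on n D (fun _ => c).
Proof.
revert c; induction n as [|n IH]; intros c.
- intros x Hx. apply filterlim_const.
- exists (fun _ _ => 0). split; [intros; apply fderiv_const | intros; apply IH].
Qed.

Lemma Ck_on_linear n D (l : E -> R) : is_linear l -> Ck_on n D l.
Proof.
intros Hl. apply Ck_on_S. exists (fun _ => l). split.
- intros; now apply fderiv_linear.
- intros h. apply Ck_on_const.
Qed.

Lemma Ck_on_plus n D f g :
  Ck_on n D f -> Ck_on n D g -> Ck_on n D (fun x => f x + g x).
Proof.
revert f g; induction n as [|n IH]; intros f g.
- intros Hf Hg x Hx.
  apply (filterlim_comp_2 _ _ _ (Hf x Hx) (Hg x Hx)). apply (filterlim_plus (f x) (g x)).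
- intros [df [F1 F2]] [dg [G1 G2]]. exists (fun x h => df x h + dg x h). split.
  + intros x Hx. apply fderiv_plus; auto.
  + intros h. apply IH; auto.
Qed.

Lemma Ck_on_mult n D f g :
  Ck_on n D f -> Ck_on n D g -> Ck_on n D (fun x => f x * g x).
Proof.
revert f g; induction n as [|n IH]; intros f g.
- intros Hf Hg x Hx.
  apply (filterlim_comp_2 _ _ _ (Hf x Hx) (Hg x Hx)).
  apply (filterlim_mult (K := R_AbsRing) (f x) (g x)).
- intros Hf Hg. pose proof (Ck_on_S _ _ _ Hf). pose proof (Ck_on_S _ _ _ Hg).
  destruct Hf as [df [F1 F2]], Hg as [dg [G1 G2]].
  exists (fun x h => g x * df x h + f x * dg x h). split.
  + intros x Hx. apply fderiv_mult; auto.
  + intros h. apply Ck_on_plus; apply IH; auto.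
Qed.

Lemma Ck_on_opp n D f : Ck_on n D f -> Ck_on n D (fun x => - f x).
Proof.
intros H. apply Ck_on_ext with (fun x => (-1) * f x); [intros; ring|].
apply Ck_on_mult; [apply Ck_on_const | exact H].
Qed.

Lemma Ck_on_minus n D f g :
  Ck_on n D f -> Ck_on n D g -> Ck_on n D (fun x => f x - g x).
Proof. intros. apply Ck_on_plus; [|apply Ck_on_opp]; auto. Qed.

Lemma Ck_on_pow n D f k : Ck_on n D f -> Ck_on n D (fun x => f x ^ k).
Proof.
intros H. induction k as [|k IH]; simpl; [apply Ck_on_const | now apply Ck_on_mult].
Qed.

Lemma is_linear_decomp (l : R * R -> R) : is_linear l ->
  forall h, l h = l (1, 0) * fst h + l (0, 1) * snd h.
Proof.
intros Hl [a b]; simpl.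
replace (l (a, b)) with (l (plus (scal a (1, 0)) (scal b (0, 1)))).
- rewrite (linear_plus _ Hl), !(linear_scal _ Hl).
  unfold plus, scal; simpl; unfold mult; simpl. ring.
- f_equal. unfold plus, scal; simpl. unfold prod_plus, prod_scal; simpl.
  unfold plus, scal; simpl; unfold mult; simpl. f_equal; ring.
Qed.

End Calculus.

Lemma Ck_on_grad n (D : R * R -> Prop) f :
  Ck_on (S n) D f -> exists fu fv, (forall q, D q -> is_grad D f q (fu q) (fv q)) /\
    Ck_on n D fu /\ Ck_on n D fv.
Proof.
intros [df [H1 H2]]. exists (fun q => df q (1, 0)), (fun q => df q (0, 1)).
split; [|split; auto].
intros q Hq. refine (fderiv_ext_lin (E := R2) D f q _ _ _ (H1 q Hq)).
apply is_linear_decomp. exact (proj1 (H1 q Hq)).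
Qed.

Lemma Ck_on_of_grad n (D : R * R -> Prop) f fu fv :
  (forall q, D q -> is_grad D f q (fu q) (fv q)) -> Ck_on n D fu -> Ck_on n D fv ->
  Ck_on (S n) D f.
Proof.
intros H Hu Hv. exists (fun q h => fu q * fst h + fv q * snd h). split; [exact H|].
intros h. apply (Ck_on_plus (E := R2));
  apply (Ck_on_mult (E := R2)); auto;
  apply (Ck_on_const (E := R2)).
Qed.

Lemma Ck_on_derive n (D : R -> Prop) f :
  Ck_on (S n) D f -> exists f', (forall x, D x -> is_derive_on D f x (f' x)) /\ Ck_on n D f'.
Proof.
intros [df [H1 H2]]. exists (fun q => df q 1). split; [|auto].
intros q Hq. refine (fderiv_ext_lin (E := R1) D f q _ _ _ (H1 q Hq)).
intros y. rewrite <- (Rmult_1_r y) at 1.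
exact (linear_scal _ (proj1 (H1 q Hq)) y 1).
Qed.

Lemma Ck_on_of_derive n (D : R -> Prop) f f' :
  (forall x, D x -> is_derive_on D f x (f' x)) -> Ck_on n D f' -> Ck_on (S n) D f.
Proof.
intros H Hu. exists (fun q h => h * f' q). split; [exact H|].
intros h. apply (Ck_on_mult (E := R1)); auto.
apply (Ck_on_const (E := R1)).
Qed.

Section Composition.
Context {E : NormedModule R_AbsRing}.
Implicit Types (D : E -> Prop) (f g : E -> R).

Lemma Ck_on_comp1 n D (I : R -> Prop) f (G : R -> R) :
  (forall x, D x -> I (f x)) -> Ck_on n I G -> Ck_on n D f -> Ck_on n D (fun x => G (f x)).
Proof.
intros HD; revert f G HD; induction n as [|n IH]; intros f G HD.
- intros HG Hf x Hx.
  apply filterlim_comp with (within I (locally (f x))); [|exact (HG _ (HD x Hx))].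
  intros P HP. generalize (Hf x Hx _ HP). unfold filtermap, within.
  apply filter_imp. auto.
- intros HG Hf. pose proof (Ck_on_S _ _ _ Hf).
  destruct (Ck_on_derive _ _ _ HG) as [G' [G1 G2]].
  destruct Hf as [df [F1 F2]].
  exists (fun x h => G' (f x) * df x h). split.
  + intros x Hx. apply fderiv_comp1 with I; auto.
  + intros h. apply Ck_on_mult; auto.
Qed.

Lemma Ck_on_comp2 n D (D2 : R * R -> Prop) f g (G : R * R -> R) :
  (forall x, D x -> D2 (f x, g x)) -> Ck_on n D2 G -> Ck_on n D f -> Ck_on n D g ->
  Ck_on n D (fun x => G (f x, g x)).
Proof.
intros HD; revert f g G HD; induction n as [|n IH]; intros f g G HD.
- intros HG Hf Hg x Hx.
  apply filterlim_comp with (within D2 (locally (f x, g x))); [|exact (HG _ (HD x Hx))].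
  assert (Hp : filterlim (fun y => (f y, g y)) (within D (locally x)) (locally (f x, g x))).
  { assert (FF : Filter (within D (locally x))) by (apply within_filter, locally_filter).
    intros P [eps HP].
    assert (H1 := Hf x Hx _ (locally_ball (f x : R_UniformSpace) eps)).
    assert (H2 := Hg x Hx _ (locally_ball (g x : R_UniformSpace) eps)).
    refine (filter_imp (F := within D (locally x)) _ _ _
      (filter_and (F := within D (locally x)) (fun y => ball (f x : R_UniformSpace) eps (f y))
        (fun y => ball (g x : R_UniformSpace) eps (g y)) H1 H2)).
    intros y [Hy1 Hy2]. apply HP. now split. }
  intros P HP. generalize (Hp _ HP). unfold filtermap, within.
  apply filter_imp. auto.
- intros HG Hf Hg. pose proof (Ck_on_S _ _ _ Hf). pose proof (Ck_on_S _ _ _ Hg).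
  destruct (Ck_on_grad _ _ _ HG) as [Gu [Gv [G1 [G2 G3]]]].
  destruct Hf as [df [F1 F2]], Hg as [dg [F3 F4]].
  exists (fun x h => Gu (f x, g x) * df x h + Gv (f x, g x) * dg x h). split.
  + intros x Hx. apply fderiv_comp2 with D2; auto.
  + intros h. apply Ck_on_plus; apply Ck_on_mult; auto.
Qed.

End Composition.

Lemma is_derive_on_of (D : R -> Prop) f x l :
  D x -> is_derive f x l -> is_derive_on D f x l.
Proof.
intros Hx H. pose proof (within_proper (E := R1) D x Hx) as PF.
apply (filterdiff_locally (F := within D (locally x))) with x.
- apply (within_filter_lim (E := R1)).
- exact H.
Qed.

Lemma continuous_within {E : NormedModule R_AbsRing} (D : E -> Prop) (f : E -> R) (x : E) :
  continuous f x -> filterlim f (within D (locally x)) (locally (f x)).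
Proof.
intros H P HP. generalize (H P HP). unfold filtermap, within.
apply filter_imp. auto.
Qed.

Lemma Ck_on_inv_R n : Ck_on n (fun x : R => x <> 0) Rinv.
Proof.
induction n as [|n IH].
- intros x Hx. apply continuous_within, (continuous_Rinv x Hx).
- apply Ck_on_of_derive with (fun x => - (/ x * / x)).
  + intros x Hx. apply is_derive_on_of; auto.
    auto_derive; [exact Hx|]. field. exact Hx.
  + apply Ck_on_opp. now apply Ck_on_mult.
Qed.

Section Composition2.
Context {E : NormedModule R_AbsRing}.
Implicit Types (D : E -> Prop) (f g : E -> R).

Lemma Ck_on_inv n D f :
  (forall x, D x -> f x <> 0) -> Ck_on n D f -> Ck_on n D (fun x => / f x).
Proof. intros H. apply Ck_on_comp1 with (2 := Ck_on_inv_R n). exact H. Qed.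

Lemma Ck_on_div n D f g :
  (forall x, D x -> g x <> 0) -> Ck_on n D f -> Ck_on n D g -> Ck_on n D (fun x => f x / g x).
Proof. intros H Hf Hg. apply Ck_on_mult; [|apply Ck_on_inv]; auto. Qed.

End Composition2.

Lemma Ck_on_sqrt_R n : Ck_on n (fun x : R => 0 < x) sqrt.
Proof.
induction n as [|n IH].
- intros x Hx. apply continuous_within, (continuous_sqrt x).
- apply Ck_on_of_derive with (fun x => / 2 * / sqrt x).
  + intros x Hx. apply is_derive_on_of; auto.
    auto_derive; [exact Hx|]. field. apply Rgt_not_eq, sqrt_lt_R0, Hx.
  + apply Ck_on_mult; [apply Ck_on_const|]. apply Ck_on_inv; auto.
    intros x Hx. apply Rgt_not_eq, sqrt_lt_R0, Hx.
Qed.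

Lemma Ck_on_exp_R n : Ck_on n (fun _ : R => True) exp.
Proof.
induction n as [|n IH].
- intros x Hx. apply continuous_within, (continuous_exp x).
- apply Ck_on_of_derive with exp; [|exact IH].
  intros x Hx. apply is_derive_on_of; auto. apply is_derive_exp.
Qed.

(** * Derivatives on segments *)

Lemma is_derive_on_iff (I : R -> Prop) f x l : I x ->
  is_derive_on I f x l <->
  forall eps, 0 < eps -> exists d, 0 < d /\
    forall y, I y -> Rabs (y - x) < d -> Rabs (f y - f x - l * (y - x)) <= eps * Rabs (y - x).
Proof.
intros Hx. split.
- intros [_ H] eps He.
  destruct (H x (within_filter_lim (E := R1) I x) (mkposreal eps He)) as [d Hd].
  exists d. split; [apply cond_pos|].
  intros y Iy Hy. rewrite (Rmult_comm l). exact (Hd y Hy Iy).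
- intros H. split.
  + apply (is_linear_scal_l (K := R_AbsRing) (V := R1) l).
  + intros y Hy eps.
    pose proof (within_proper (E := R1) I x Hx) as PF.
    assert (y = x).
    { exact (is_filter_lim_unique (V := R1) (F := within I (locally x)) y x Hy
        (within_filter_lim (E := R1) I x)). }
    subst y.
    destruct (H eps (cond_pos eps)) as [d [Hd1 Hd2]].
    exists (mkposreal d Hd1). intros y Hy1 Iy.
    specialize (Hd2 y Iy Hy1). rewrite (Rmult_comm l) in Hd2. exact Hd2.
Qed.

Lemma continuous_on_iff (I : R -> Prop) (f : R -> R) :
  CkR 0 I f <->
  forall x, I x -> forall eps, 0 < eps -> exists d, 0 < d /\
    forall y, I y -> Rabs (y - x) < d -> Rabs (f y - f x) < eps.
Proof.
split.
- intros H x Hx eps He.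
  destruct (H x Hx (ball (f x : R_UniformSpace) eps)
    (locally_ball (f x : R_UniformSpace) (mkposreal eps He))) as [d Hd].
  exists d. split; [apply cond_pos|]. intros y Iy Hy. exact (Hd y Hy Iy).
- intros H x Hx P [eps HP].
  destruct (H x Hx eps (cond_pos eps)) as [d [Hd1 Hd2]].
  exists (mkposreal d Hd1). intros y Hy Iy. apply HP, Hd2; auto.
Qed.

(** Balls of the product are those of the maximum, its norm is only equivalent to the maximum; 2 is
    a convenient bound for the constant [sqrt 2]. *)
Lemma R2_ball_norm (p q : R2) :
  Rmax (Rabs (fst p - fst q)) (Rabs (snd p - snd q)) <= norm (minus p q)
    <= 2 * Rmax (Rabs (fst p - fst q)) (Rabs (snd p - snd q)).
Proof.
destruct p as [u v], q as [u' v']. simpl.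
destruct (norm_prod (K := R_AbsRing) (U := R1) (V := R1)
  (u - u') (v - v')) as [H1 H2].
split; [exact H1|]. eapply Rle_trans; [exact H2|].
apply Rmult_le_compat_r.
- eapply Rle_trans; [apply Rabs_pos | apply Rmax_l].
- rewrite <- (sqrt_Rsqr 2) at 2 by lra. apply sqrt_le_1_alt. unfold Rsqr; lra.
Qed.

Lemma is_linear_R2 (fu fv : R) : is_linear (U := R2) (fun h => fu * fst h + fv * snd h).
Proof.
apply (is_linear_comp (U := R2) (V := R2) (W := R1)
  (fun h => (fu * fst h, fv * snd h)) (fun h => plus (fst h) (snd h))).
2: apply (is_linear_plus (V := R1)).
apply (is_linear_prod (T := R2) (U := R1) (V := R1)
  (fun h => fu * fst h) (fun h => fv * snd h)).
- apply (is_linear_comp (U := R2) (V := R1) (W := R1) fst (fun x => fu * x)).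
  apply is_linear_fst.
  apply (is_linear_scal_r (K := R_AbsRing) (V := R1) fu Rmult_comm).
- apply (is_linear_comp (U := R2) (V := R1) (W := R1) snd (fun x => fv * x)).
  apply is_linear_snd.
  apply (is_linear_scal_r (K := R_AbsRing) (V := R1) fv Rmult_comm).
Qed.

Lemma is_grad_iff (D : R * R -> Prop) f q fu fv : D q ->
  is_grad D f q fu fv <->
  forall eps, 0 < eps -> exists d, 0 < d /\
    forall p, D p -> Rabs (fst p - fst q) < d -> Rabs (snd p - snd q) < d ->
    Rabs (f p - f q - (fu * (fst p - fst q) + fv * (snd p - snd q)))
      <= eps * Rmax (Rabs (fst p - fst q)) (Rabs (snd p - snd q)).
Proof.
intros Hq. split.
- intros [_ H] eps He. assert (He2 : 0 < eps / 2) by lra.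
  destruct (H q (within_filter_lim (E := R2) D q) (mkposreal _ He2)) as [d Hd].
  exists d. split; [apply cond_pos|].
  intros p Dp H1 H2. specialize (Hd p (conj H1 H2) Dp).
  eapply Rle_trans; [exact Hd|]. simpl pos.
  destruct (R2_ball_norm p q) as [_ H3].
  replace (eps * Rmax (Rabs (fst p - fst q)) (Rabs (snd p - snd q))) with
   (eps / 2 * (2 * Rmax (Rabs (fst p - fst q)) (Rabs (snd p - snd q)))) by field.
  apply Rmult_le_compat_l; [lra | exact H3].
- intros H. split; [apply is_linear_R2|].
  intros y Hy eps.
  pose proof (within_proper (E := R2) D q Hq) as PF.
  assert (y = q).
  { exact (is_filter_lim_unique (V := R2) (F := within D (locally q)) y q Hy
      (within_filter_lim (E := R2) D q)). }
  subst y.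
  destruct (H eps (cond_pos eps)) as [d [Hd1 Hd2]].
  exists (mkposreal d Hd1). intros p [Hp1 Hp2] Dp.
  specialize (Hd2 p Dp Hp1 Hp2). eapply Rle_trans; [exact Hd2|].
  apply Rmult_le_compat_l; [apply Rlt_le, cond_pos|]. apply R2_ball_norm.
Qed.

Lemma continuous_on2_iff (D : R * R -> Prop) (f : R * R -> R) :
  CkR2 0 D f <->
  forall q, D q -> forall eps, 0 < eps -> exists d, 0 < d /\
    forall p, D p -> Rabs (fst p - fst q) < d -> Rabs (snd p - snd q) < d ->
      Rabs (f p - f q) < eps.
Proof.
split.
- intros H x Hx eps He.
  destruct (H x Hx (ball (f x : R_UniformSpace) eps)
    (locally_ball (f x : R_UniformSpace) (mkposreal eps He))) as [d Hd].
  exists d. split; [apply cond_pos|]. intros y Iy H1 H2. exact (Hd y (conj H1 H2) Iy).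
- intros H x Hx P [eps HP].
  destruct (H x Hx eps (cond_pos eps)) as [d [Hd1 Hd2]].
  exists (mkposreal d Hd1). intros y [H1 H2] Iy. apply HP, Hd2; auto.
Qed.

(** A 1-Lipschitz retraction onto the segment: composition with it turns a function continuous on
    the segment into one continuous on the whole line. *)
Definition clamp (a b x : R) := Rmax a (Rmin x b).

Lemma clamp_in a b x : a <= b -> a <= clamp a b x <= b.
Proof.
intros H. unfold clamp. split; [apply Rmax_l|].
apply Rmax_lub; [exact H | apply Rmin_r].
Qed.

Lemma clamp_id a b x : a <= x <= b -> clamp a b x = x.
Proof. intros H. unfold clamp. rewrite Rmin_left by lra. apply Rmax_right; lra. Qed.

Lemma clamp_lip a b x y : Rabs (clamp a b x - clamp a b y) <= Rabs (x - y).
Proof.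
unfold clamp, Rmax, Rmin, Rabs.
repeat destruct Rle_dec; repeat destruct Rcase_abs; lra.
Qed.

Lemma continuous_clamp a b (f : R -> R) : a <= b ->
  CkR 0 (fun x => a <= x <= b) f ->
  forall x, continuous (fun x => f (clamp a b x)) x.
Proof.
intros Hab Hf x. rewrite continuous_on_iff in Hf.
intros P [eps HP].
destruct (Hf _ (clamp_in a b x Hab) eps (cond_pos eps)) as [d [Hd1 Hd2]].
exists (mkposreal d Hd1). intros y Hy. apply HP, Hd2; [now apply clamp_in|].
eapply Rle_lt_trans; [apply clamp_lip | exact Hy].
Qed.

Lemma MVT_on (a b : R) (f f' : R -> R) : a <= b ->
  (forall x, a <= x <= b -> is_derive_on (fun x => a <= x <= b) f x (f' x)) ->
  exists c, a <= c <= b /\ f b - f a = f' c * (b - a).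
Proof.
intros Hab H.
assert (Hc : CkR 0 (fun x => a <= x <= b) f).
{ intros x Hx. exact (fderiv_continuous (E := R1) _ f x _ (H x Hx)). }
destruct (MVT_gen (fun x => f (clamp a b x)) a b f') as [c [Hc1 Hc2]].
- rewrite Rmin_left, Rmax_right by lra. intros x Hx.
  assert (Hx' : a <= x <= b) by lra.
  pose proof (proj1 (is_derive_on_iff _ f x (f' x) Hx') (H x Hx')) as Hd.
  apply is_derive_Reals. intros eps He.
  destruct (Hd (eps / 2)) as [d [Hd1 Hd2]]; [lra|].
  assert (Hm : 0 < Rmin d (Rmin (x - a) (b - x))) by (repeat apply Rmin_pos; lra).
  exists (mkposreal _ Hm). simpl. intros h Hh0 Hh.
  assert (Rabs h < d) by (eapply Rlt_le_trans; [exact Hh | apply Rmin_l]).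
  assert (Hh2 : Rabs h < Rmin (x - a) (b - x)) by (eapply Rlt_le_trans; [exact Hh | apply Rmin_r]).
  assert (Rabs h < x - a) by (eapply Rlt_le_trans; [exact Hh2 | apply Rmin_l]).
  assert (Rabs h < b - x) by (eapply Rlt_le_trans; [exact Hh2 | apply Rmin_r]).
  assert (Hxh : a <= x + h <= b) by (destruct (Rabs_def2 h _ H1), (Rabs_def2 h _ H2); lra).
  rewrite !clamp_id by lra.
  specialize (Hd2 (x + h) Hxh). replace (x + h - x) with h in Hd2 by ring.
  specialize (Hd2 H0).
  replace ((f (x + h) - f x) / h - f' x) with ((f (x + h) - f x - f' x * h) / h)
    by (field; exact Hh0).
  unfold Rdiv. rewrite Rabs_mult, Rabs_inv.
  assert (Hp : 0 < Rabs h) by now apply Rabs_pos_lt.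
  apply Rmult_lt_reg_r with (Rabs h); [exact Hp|].
  rewrite Rmult_assoc, Rinv_l by lra. nra.
- intros x _. apply continuity_pt_filterlim. now apply continuous_clamp.
- rewrite Rmin_left, Rmax_right in Hc1 by lra.
  exists c. split; [exact Hc1|]. rewrite !clamp_id in Hc2 by lra. exact Hc2.
Qed.

Lemma is_derive_on_subset (I J : R -> Prop) f x l :
  J x -> (forall y, J y -> I y) -> is_derive_on I f x l -> is_derive_on J f x l.
Proof. apply (fderiv_subset (E := R1)). Qed.

Lemma is_derive_on_ext (I : R -> Prop) f g x l l' :
  I x -> (forall y, I y -> f y = g y) -> l = l' -> is_derive_on I f x l -> is_derive_on I g x l'.
Proof. intros Hx H <-. now apply (fderiv_ext (E := R1)). Qed.

Lemma zero_derive_const (a b : R) (f : R -> R) :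
  (forall x, a <= x <= b -> is_derive_on (fun x => a <= x <= b) f x 0) ->
  forall x, a <= x <= b -> f x = f a.
Proof.
intros H x Hx.
destruct (MVT_on a x f (fun _ => 0)) as [c [_ Hc]]; [lra | |lra].
intros y Hy. apply is_derive_on_subset with (fun x => a <= x <= b); [lra | intros; lra |].
apply H; lra.
Qed.

Lemma is_derive_on_unique (a b : R) f x l l' : a < b -> a <= x <= b ->
  is_derive_on (fun x => a <= x <= b) f x l -> is_derive_on (fun x => a <= x <= b) f x l' ->
  l = l'.
Proof.
intros Hab Hx H1 H2.
rewrite is_derive_on_iff in H1, H2 by exact Hx.
destruct (Req_dec l l') as [|Hn]; [assumption|exfalso].
assert (He : 0 < Rabs (l - l') / 4).
{ assert (0 < Rabs (l - l')) by (apply Rabs_pos_lt; lra). lra. }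
destruct (H1 _ He) as [d1 [D1 E1]], (H2 _ He) as [d2 [D2 E2]].
(* The step goes towards the farther end of the segment, where half of its length is available. *)
assert (Hy : exists y, a <= y <= b /\ 0 < Rabs (y - x) /\ Rabs (y - x) < d1 /\ Rabs (y - x) < d2).
{ set (d := Rmin d1 d2 / 2).
  assert (0 < Rmin d1 d2) by now apply Rmin_pos.
  pose proof (Rmin_l d1 d2). pose proof (Rmin_r d1 d2).
  destruct (Rle_dec x ((a + b) / 2)).
  - exists (x + Rmin d ((b - a) / 2)).
    assert (0 < Rmin d ((b - a) / 2)) by (apply Rmin_pos; unfold d; lra).
    pose proof (Rmin_l d ((b - a) / 2)). pose proof (Rmin_r d ((b - a) / 2)).
    replace (x + Rmin d ((b - a) / 2) - x) with (Rmin d ((b - a) / 2)) by ring.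
    rewrite Rabs_pos_eq by lra. unfold d in *. repeat split; lra.
  - exists (x - Rmin d ((b - a) / 2)).
    assert (0 < Rmin d ((b - a) / 2)) by (apply Rmin_pos; unfold d; lra).
    pose proof (Rmin_l d ((b - a) / 2)). pose proof (Rmin_r d ((b - a) / 2)).
    replace (x - Rmin d ((b - a) / 2) - x) with (- Rmin d ((b - a) / 2)) by ring.
    rewrite Rabs_Ropp, Rabs_pos_eq by lra. unfold d in *. repeat split; lra. }
destruct Hy as [y [Iy [Y0 [Y1 Y2]]]].
specialize (E1 y Iy Y1). specialize (E2 y Iy Y2).
assert (Rabs ((l - l') * (y - x)) <= Rabs (l - l') / 2 * Rabs (y - x)).
{ replace ((l - l') * (y - x)) with
    ((f y - f x - l' * (y - x)) - (f y - f x - l * (y - x))) by ring.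
  eapply Rle_trans; [apply Rabs_triang|]. rewrite Rabs_Ropp. lra. }
rewrite Rabs_mult in H.
assert (Rabs (l - l') <= Rabs (l - l') / 2) by (apply Rmult_le_reg_r with (Rabs (y - x)); lra).
lra.
Qed.

(** * The functional equation [z u = kap u * z (a * u) + sig u] *)

Lemma bounded_on_segment a b (f : R -> R) : a <= b ->
  CkR 0 (fun x => a <= x <= b) f ->
  exists M, 0 <= M /\ forall x, a <= x <= b -> Rabs (f x) <= M.
Proof.
intros Hab Hf.
destruct (continuity_ab_maj (fun x => Rabs (f (clamp a b x))) a b Hab) as [m [Hm _]].
- intros c _. apply continuity_pt_filterlim.
  apply (continuous_comp (fun x => f (clamp a b x)) Rabs).
  + now apply continuous_clamp.
  + apply continuous_Rabs.
- exists (Rabs (f (clamp a b m))). split; [apply Rabs_pos|].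
  intros x Hx. rewrite <- (clamp_id a b x Hx) at 1. now apply Hm.
Qed.

Lemma geometric_cauchy_limit (s : nat -> R) B th : 0 <= B -> 0 < th < 1 ->
  (forall k, Rabs (s (S k) - s k) <= B * th ^ k) ->
  forall k, Rabs (s k - real (Lim_seq s)) <= B / (1 - th) * th ^ k.
Proof.
intros HB Hth Hs.
(* The factor [1 - th ^ p] is the exact partial sum of the geometric series; it is what lets the
   induction on [p] close. *)
assert (Hp : forall k p, Rabs (s (k + p)%nat - s k) <= B / (1 - th) * (1 - th ^ p) * th ^ k).
{ intros k p. induction p as [|p IH].
  - rewrite Nat.add_0_r. simpl. rewrite Rminus_eq_0, Rabs_R0. lra.
  - rewrite Nat.add_succ_r.
    replace (s (S (k + p)) - s k) with ((s (S (k + p)) - s (k + p)%nat) + (s (k + p)%nat - s k))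
      by ring.
    eapply Rle_trans; [apply Rabs_triang|].
    specialize (Hs (k + p)%nat). rewrite pow_add in Hs.
    replace (B / (1 - th) * (1 - th ^ S p) * th ^ k) with
      (B * (th ^ k * th ^ p) + B / (1 - th) * (1 - th ^ p) * th ^ k)
      by (simpl; field; lra).
    lra. }
assert (Hp' : forall k p, Rabs (s (k + p)%nat - s k) <= B / (1 - th) * th ^ k).
{ intros k p. eapply Rle_trans; [apply Hp|].
  apply Rmult_le_compat_r; [apply pow_le; lra|].
  rewrite <- (Rmult_1_r (B / (1 - th))) at 2.
  apply Rmult_le_compat_l.
  - apply Rdiv_le_0_compat; lra.
  - assert (0 <= th ^ p) by (apply pow_le; lra). lra. }
assert (Hlim : is_lim_seq (fun k => B / (1 - th) * th ^ k) 0).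
{ replace 0 with (B / (1 - th) * 0) by ring.
  apply (is_lim_seq_scal_l _ (B / (1 - th)) 0), is_lim_seq_geom.
  rewrite Rabs_pos_eq; lra. }
assert (Hex : ex_finite_lim_seq s).
{ apply ex_lim_seq_cauchy_corr. intros eps.
  apply is_lim_seq_spec in Hlim.
  destruct (Hlim (mkposreal (eps / 2) (is_pos_div_2 eps))) as [N HN].
  exists N. intros n m Hn Hm. specialize (HN N (le_n N)). simpl in HN.
  rewrite Rminus_0_r in HN. apply Rabs_def2 in HN.
  pose proof (Hp' N (n - N)%nat) as H1. pose proof (Hp' N (m - N)%nat) as H2.
  replace (N + (n - N))%nat with n in H1 by lia.
  replace (N + (m - N))%nat with m in H2 by lia.
  replace (s n - s m) with ((s n - s N) - (s m - s N)) by ring.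
  eapply Rle_lt_trans; [apply Rabs_triang|]. rewrite Rabs_Ropp. lra. }
apply Lim_seq_correct' in Hex.
intros k.
assert (Hk : is_lim_seq (fun p => Rabs (s k - s (p + k)%nat)) (Rabs (s k - real (Lim_seq s)))).
{ apply (is_lim_seq_abs _ (s k - real (Lim_seq s))).
  apply is_lim_seq_minus'; [apply is_lim_seq_const|].
  apply (is_lim_seq_incr_n s k). exact Hex. }
refine (is_lim_seq_le (fun p => Rabs (s k - s (p + k)%nat)) (fun _ => B / (1 - th) * th ^ k)
  (Rabs (s k - real (Lim_seq s))) (B / (1 - th) * th ^ k) _ Hk (is_lim_seq_const _)).
intros p. rewrite Rabs_minus_sym, Nat.add_comm. apply Hp'.
Qed.

Lemma geometric_eventually C th eps : 0 < th < 1 -> 0 < eps ->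
  exists N, forall n, (N <= n)%nat -> C * th ^ n < eps.
Proof.
intros Hth He.
assert (Hlim : is_lim_seq (fun k => C * th ^ k) 0).
{ replace 0 with (C * 0) by ring.
  apply (is_lim_seq_scal_l _ C 0), is_lim_seq_geom. rewrite Rabs_pos_eq; lra. }
apply is_lim_seq_spec in Hlim. destruct (Hlim (mkposreal eps He)) as [N HN].
exists N. intros n Hn. specialize (HN n Hn). simpl in HN. apply Rabs_def2 in HN. lra.
Qed.

Lemma eq_of_Rabs_le (x y : R) : (forall eps, 0 < eps -> Rabs (x - y) <= eps) -> x = y.
Proof.
intros H. destruct (Req_dec x y) as [|Hn]; [assumption|exfalso].
assert (0 < Rabs (x - y)) by (apply Rabs_pos_lt; lra).
specialize (H (Rabs (x - y) / 2)). lra.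
Qed.

Section FunctionalEquation.
Variables a b th : R.
Hypothesis (Ha : 0 < a < 1) (Hb : 0 <= b) (Hth : 0 < th < 1).

Let I (x : R) := 0 <= x <= b.

Lemma scale_segment u : I u -> I (a * u).
Proof. unfold I. intros H. split; nra. Qed.

Lemma Ck_on_scale n f :
  CkR n I f -> CkR n I (fun u => f (a * u)).
Proof.
intros Hf. apply (Ck_on_comp1 (E := R1) n I I (fun u => a * u) f); [|exact Hf|].
- apply scale_segment.
- apply (Ck_on_linear (E := R1)).
  apply (is_linear_scal_r (K := R_AbsRing) (V := R1) a Rmult_comm).
Qed.

Lemma is_derive_on_scale f u l : I u ->
  is_derive_on I f (a * u) l -> is_derive_on I (fun u => f (a * u)) u (a * l).
Proof.
intros Hu H.
apply (fderiv_ext_lin (E := R1)) with (fun h : R => l * (a * h)); [intros; ring|].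
apply (fderiv_comp1 (E := R1) I I (fun u => a * u) f u (fun h => a * h) l);
  [exact Hu | apply scale_segment | | exact H].
apply (fderiv_linear (E := R1)).
apply (is_linear_scal_r (K := R_AbsRing) (V := R1) a Rmult_comm).
Qed.

Section Step.
Variables kap sig z kap' sig' : R -> R.
Hypothesis kap_der : forall u, I u -> is_derive_on I kap u (kap' u).
Hypothesis sig_der : forall u, I u -> is_derive_on I sig u (sig' u).
Hypothesis kap'_cont : CkR 0 I kap'.
Hypothesis sig'_cont : CkR 0 I sig'.
Hypothesis z_cont : CkR 0 I z.
Hypothesis kap_le : forall u, I u -> Rabs (kap u) <= th.
Hypothesis z_eq : forall u, I u -> z u = kap u * z (a * u) + sig u.

Fixpoint fe_iter (k : nat) (u : R) : R :=
  match k with O => 0 | S k => kap u * fe_iter k (a * u) + sig u end.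
(** This iteration contracts by [a * kap]; its inhomogeneous term still varies with [k], through
    [fe_iter k]. *)
Fixpoint fe_diter (k : nat) (u : R) : R :=
  match k with
  | O => 0
  | S k => a * kap u * fe_diter k (a * u) + (kap' u * fe_iter k (a * u) + sig' u)
  end.

Lemma fe_iter_derive k u : I u -> is_derive_on I (fe_iter k) u (fe_diter k u).
Proof.
revert u; induction k as [|k IH]; intros u Hu; simpl.
- apply (fderiv_ext_lin (E := R1)) with (fun h : R => 0); [intros; ring|].
  apply (fderiv_const (E := R1)).
- apply (fderiv_ext_lin (E := R1)) with
   (fun h : R => (fe_iter k (a * u) * (h * kap' u) +
     kap u * (h * (a * fe_diter k (a * u)))) + h * sig' u); [intros; ring|].
  apply (fderiv_plus (E := R1)); [|now apply sig_der].
  exact (fderiv_mult (E := R1) I kap (fun u => fe_iter k (a * u)) u _ _ Hu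
    (kap_der u Hu) (is_derive_on_scale (fe_iter k) u _ Hu (IH _ (scale_segment u Hu)))).
Qed.

(** Differentiability of [z] is a conclusion: [fe_iter k] tends to [z] uniformly at rate [th], the
    derivatives [fe_diter k] form a uniform Cauchy sequence, and the mean value theorem for the
    iterates makes their limit the derivative of [z]. *)
Lemma fe_derivative : exists zeta,
  (forall u, I u -> is_derive_on I z u (zeta u)) /\
  CkR 0 I zeta /\
  (forall u, I u -> zeta u = a * kap u * zeta (a * u) + (kap' u * z (a * u) + sig' u)).
Proof.
destruct (bounded_on_segment 0 b z Hb z_cont) as [Mz [Mz0 HMz]].
destruct (bounded_on_segment 0 b kap' Hb kap'_cont) as [Mk [Mk0 HMk]].
destruct (bounded_on_segment 0 b sig' Hb sig'_cont) as [Ms [Ms0 HMs]].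
(* The error of [fe_iter], of rate [th], drives a contraction of rate at most [th], which would
   produce [k * th ^ k]; a rate strictly between [th] and 1 absorbs the factor [k]. *)
set (th1 := (1 + th) / 2).
assert (Hth1 : th < th1 < 1) by (unfold th1; lra).
assert (Hf : forall k u, I u -> Rabs (fe_iter k u - z u) <= Mz * th ^ k).
{ induction k as [|k IH]; intros u Hu; simpl.
  - rewrite Rminus_0_l, Rabs_Ropp, Rmult_1_r. now apply HMz.
  - rewrite (z_eq u Hu).
    replace (kap u * fe_iter k (a * u) + sig u - (kap u * z (a * u) + sig u))
      with (kap u * (fe_iter k (a * u) - z (a * u))) by ring.
    rewrite Rabs_mult. replace (Mz * (th * th ^ k)) with (th * (Mz * th ^ k)) by ring.
    apply Rmult_le_compat; try apply Rabs_pos; [now apply kap_le|].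
    apply IH. now apply scale_segment. }
(* [Ms] covers the first increment; the second summand gives [th * B + 2 * Mk * Mz <= th1 * B],
   which is the induction step of [Hg]. *)
set (B := Ms + 2 * Mk * Mz / (th1 - th)).
assert (HB1 : 0 <= 2 * Mk * Mz / (th1 - th)).
{ apply Rdiv_le_0_compat; [|lra]. repeat apply Rmult_le_pos; lra. }
assert (HB0 : 0 <= B) by (unfold B; lra).
assert (Hpow : forall k, 0 <= th ^ k <= th1 ^ k).
{ intros k. split; [apply pow_le; lra | apply pow_incr; lra]. }
assert (Hg : forall k u, I u -> Rabs (fe_diter (S k) u - fe_diter k u) <= B * th1 ^ k).
{ induction k as [|k IH]; intros u Hu.
  - simpl. replace (_ - 0) with (sig' u) by ring. specialize (HMs u Hu). unfold B. lra.
  - change (fe_diter (S (S k)) u) with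
      (a * kap u * fe_diter (S k) (a * u) + (kap' u * fe_iter (S k) (a * u) + sig' u)).
    change (fe_diter (S k) u) with
      (a * kap u * fe_diter k (a * u) + (kap' u * fe_iter k (a * u) + sig' u)).
    pose proof (scale_segment u Hu) as Hau.
    replace (_ - _) with (a * kap u * (fe_diter (S k) (a * u) - fe_diter k (a * u))
      + kap' u * ((fe_iter (S k) (a * u) - z (a * u)) - (fe_iter k (a * u) - z (a * u)))) by ring.
    eapply Rle_trans; [apply Rabs_triang|]. rewrite !Rabs_mult.
    specialize (IH (a * u) Hau).
    assert (H1 : Rabs a * Rabs (kap u) * Rabs (fe_diter (S k) (a * u) - fe_diter k (a * u))
      <= th * (B * th1 ^ k)).
    { apply Rmult_le_compat; try apply Rabs_pos; [| |exact IH].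
      - apply Rmult_le_pos; apply Rabs_pos.
      - rewrite (Rabs_pos_eq a) by lra. specialize (kap_le u Hu).
        pose proof (Rabs_pos (kap u)). nra. }
    assert (H2 : Rabs (fe_iter (S k) (a * u) - z (a * u) - (fe_iter k (a * u) - z (a * u)))
      <= 2 * Mz * th1 ^ k).
    { eapply Rle_trans; [apply Rabs_triang|]. rewrite Rabs_Ropp.
      pose proof (Hf (S k) _ Hau). pose proof (Hf k _ Hau).
      assert (Mz * th ^ S k <= Mz * th1 ^ k).
      { apply Rmult_le_compat_l; [exact Mz0|]. specialize (Hpow k). simpl. nra. }
      assert (Mz * th ^ k <= Mz * th1 ^ k).
      { apply Rmult_le_compat_l; [exact Mz0|]. apply Hpow. }
      lra. }
    assert (H3 : Rabs (kap' u) *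
      Rabs (fe_iter (S k) (a * u) - z (a * u) - (fe_iter k (a * u) - z (a * u)))
      <= Mk * (2 * Mz * th1 ^ k)).
    { apply Rmult_le_compat; try apply Rabs_pos; [now apply HMk | exact H2]. }
    assert (H4 : Mk * (2 * Mz * th1 ^ k) + th * (B * th1 ^ k) <= B * th1 ^ S k).
    { replace (B * th1 ^ S k) with (th * (B * th1 ^ k) + (th1 - th) * B * th1 ^ k)
        by (simpl; ring).
      replace ((th1 - th) * B) with ((th1 - th) * Ms + 2 * Mk * Mz)
        by (unfold B; field; lra).
      assert (0 <= (th1 - th) * Ms * th1 ^ k).
      { apply Rmult_le_pos; [apply Rmult_le_pos; lra | specialize (Hpow k); lra]. }
      lra. }
    lra. }
set (zeta := fun u => real (Lim_seq (fun k => fe_diter k u))).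
assert (Hz : forall k u, I u -> Rabs (fe_diter k u - zeta u) <= B / (1 - th1) * th1 ^ k).
{ intros k u Hu.
  apply (geometric_cauchy_limit (fun k => fe_diter k u)); [exact HB0 | lra |].
  intros j. now apply Hg. }
set (C := B / (1 - th1)) in Hz.
assert (Hfc : forall k, CkR 0 I (fe_iter k)).
{ intros k u Hu.
  exact (fderiv_continuous (E := R1) _ _ _ _ (fe_iter_derive k u Hu)). }
assert (Hkc : CkR 0 I kap).
{ intros u Hu. exact (fderiv_continuous (E := R1) _ _ _ _ (kap_der u Hu)). }
assert (Hgc : forall k, CkR 0 I (fe_diter k)).
{ induction k as [|k IH]; simpl fe_diter; [apply (Ck_on_const (E := R1))|].
  apply (Ck_on_plus (E := R1)).
  - apply (Ck_on_mult (E := R1)); [|now apply Ck_on_scale].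
    apply (Ck_on_mult (E := R1)); [apply (Ck_on_const (E := R1))|].
    exact Hkc.
  - apply (Ck_on_plus (E := R1)); [|exact sig'_cont].
    apply (Ck_on_mult (E := R1)); [exact kap'_cont|].
    apply Ck_on_scale, Hfc. }
assert (Hzc : CkR 0 I zeta).
{ apply continuous_on_iff. intros x Hx eps He.
  destruct (geometric_eventually C th1 (eps / 4)) as [N HN]; [lra|lra|].
  specialize (HN N (le_n N)).
  destruct (proj1 (continuous_on_iff _ _) (Hgc N) x Hx (eps / 4)) as [d [Hd1 Hd2]]; [lra|].
  exists d. split; [exact Hd1|]. intros y Iy Hy. specialize (Hd2 y Iy Hy).
  pose proof (Hz N x Hx). pose proof (Hz N y Iy).
  replace (zeta y - zeta x) with ((fe_diter N y - fe_diter N x) - (fe_diter N y - zeta y)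
    + (fe_diter N x - zeta x)) by ring.
  eapply Rle_lt_trans; [apply Rabs_triang|].
  eapply Rle_lt_trans; [apply Rplus_le_compat_r, Rabs_triang|]. rewrite Rabs_Ropp. lra. }
exists zeta. split; [|split; [exact Hzc|]].
- intros u Hu. apply is_derive_on_iff; [exact Hu|]. intros eps He.
  destruct (proj1 (continuous_on_iff _ _) Hzc u Hu (eps / 2)) as [d [Hd1 Hd2]]; [lra|].
  exists d. split; [exact Hd1|]. intros y Iy Hy.
  (* [N] is chosen after [y]: the error in [z] only has to be below [e'], which is arbitrary, while
     the error in the derivative is multiplied by [Rabs (y - u)]. *)
  apply le_epsilon. intros e' He'.
  destruct (geometric_eventually C th1 (eps / 2)) as [N1 HN1]; [lra|lra|].
  destruct (geometric_eventually Mz th (e' / 2)) as [N2 HN2]; [lra|lra|].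
  set (N := max N1 N2).
  specialize (HN1 N (Nat.le_max_l _ _)). specialize (HN2 N (Nat.le_max_r _ _)).
  assert (Hmvt : exists c, I c /\ Rabs (c - u) <= Rabs (y - u) /\
     fe_iter N y - fe_iter N u = fe_diter N c * (y - u)).
  { destruct (Rle_dec u y) as [Huy|Huy].
    - destruct (MVT_on u y (fe_iter N) (fe_diter N) Huy) as [c [Hc1 Hc2]].
      + intros x Hx. apply is_derive_on_subset with I.
        * exact Hx. * unfold I in *; intros; lra.
        * apply fe_iter_derive. unfold I in *; lra.
      + exists c. split; [unfold I in *; lra|]. split; [|exact Hc2].
        rewrite !Rabs_pos_eq by lra. lra.
    - destruct (MVT_on y u (fe_iter N) (fe_diter N)) as [c [Hc1 Hc2]]; [lra| |].
      + intros x Hx. apply is_derive_on_subset with I.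
        * exact Hx. * unfold I in *; intros; lra.
        * apply fe_iter_derive. unfold I in *; lra.
      + exists c. split; [unfold I in *; lra|]. split.
        * rewrite (Rabs_minus_sym c), (Rabs_minus_sym y).
          rewrite !Rabs_pos_eq by lra. lra.
        * lra. }
  destruct Hmvt as [c [Ic [Hc1 Hc2]]].
  assert (Hcz : Rabs (zeta c - zeta u) < eps / 2) by (apply Hd2; [exact Ic | lra]).
  pose proof (Hz N c Ic) as Hzn.
  replace (z y - z u - zeta u * (y - u)) with
    ((fe_iter N u - z u) - (fe_iter N y - z y) +
     ((fe_diter N c - zeta c) + (zeta c - zeta u)) * (y - u)) by lra.
  eapply Rle_trans; [apply Rabs_triang|].
  assert (Rabs (fe_iter N u - z u - (fe_iter N y - z y)) <= e').
  { eapply Rle_trans; [apply Rabs_triang|]. rewrite Rabs_Ropp.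
    pose proof (Hf N u Hu). pose proof (Hf N y Iy). lra. }
  assert (Rabs ((fe_diter N c - zeta c + (zeta c - zeta u)) * (y - u)) <= eps * Rabs (y - u)).
  { rewrite Rabs_mult. apply Rmult_le_compat_r; [apply Rabs_pos|].
    eapply Rle_trans; [apply Rabs_triang|]. lra. }
  lra.
- intros u Hu. pose proof (scale_segment u Hu) as Hau.
  apply eq_of_Rabs_le. intros eps He.
  set (C' := C + C + Mk * Mz).
  destruct (geometric_eventually C th1 (eps / 3)) as [N1 HN1]; [lra|lra|].
  destruct (geometric_eventually (Mk * Mz) th1 (eps / 3)) as [N2 HN2]; [lra|lra|].
  set (N := max N1 N2).
  pose proof (HN1 N (Nat.le_max_l _ _)) as K1. specialize (HN2 N (Nat.le_max_r _ _)).
  (* The iteration relates step [S N] on the left to step [N] on the right, so both errors enter. *)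
  assert (K2 : C * th1 ^ S N < eps / 3) by (apply HN1; unfold N; lia).
  pose proof (Hz (S N) u Hu) as K3. pose proof (Hz N _ Hau) as K4. pose proof (Hf N _ Hau) as K5.
  replace (zeta u - (a * kap u * zeta (a * u) + (kap' u * z (a * u) + sig' u))) with
   (- (fe_diter (S N) u - zeta u) + a * kap u * (fe_diter N (a * u) - zeta (a * u))
     + kap' u * (fe_iter N (a * u) - z (a * u))) by (simpl; ring).
  eapply Rle_trans; [apply Rabs_triang|].
  eapply Rle_trans; [apply Rplus_le_compat_r, Rabs_triang|]. rewrite Rabs_Ropp, !Rabs_mult.
  assert (L1 : Rabs a * Rabs (kap u) * Rabs (fe_diter N (a * u) - zeta (a * u))
    <= 1 * Rabs (fe_diter N (a * u) - zeta (a * u))).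
  { apply Rmult_le_compat_r; [apply Rabs_pos|].
    rewrite (Rabs_pos_eq a) by lra. specialize (kap_le u Hu). pose proof (Rabs_pos (kap u)). nra. }
  assert (L2 : Rabs (kap' u) * Rabs (fe_iter N (a * u) - z (a * u)) <= Mk * (Mz * th1 ^ N)).
  { apply Rmult_le_compat; try apply Rabs_pos; [now apply HMk|].
    eapply Rle_trans; [exact K5|]. apply Rmult_le_compat_l; [exact Mz0|]. apply Hpow. }
  lra.
Qed.

End Step.

(** The derivative of [z] solves an equation of the same form, with [a * kap] for [kap] and
    [kap' u * z (a * u) + sig' u] for [sig]. The same [th] bounds [a * kap], so neither the constant
    nor the segment changes with the order. The induction hypothesis is used twice: for [z], to make
    the new inhomogeneity C^n, and then for the derivative. *)
Lemma functional_equation_Ck n kap sig z :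
  CkR n I kap -> CkR n I sig ->
  CkR 0 I z ->
  (forall u, I u -> Rabs (kap u) <= th) ->
  (forall u, I u -> z u = kap u * z (a * u) + sig u) ->
  CkR n I z.
Proof.
revert kap sig z; induction n as [|n IH]; intros kap sig z Hk Hs Hz Hle Heq; [exact Hz|].
assert (Hzn : CkR n I z).
{ apply IH with kap sig; auto; now apply Ck_on_S. }
pose proof (Ck_on_S _ _ _ Hk) as Hkn.
destruct (Ck_on_derive _ _ _ Hk) as [kap' [K1 K2]].
destruct (Ck_on_derive _ _ _ Hs) as [sig' [S1 S2]].
destruct (fe_derivative kap sig z kap' sig') as [zeta [Z1 [Z2 Z3]]]; auto.
- apply Ck_on_le with n; [lia|auto].
- apply Ck_on_le with n; [lia|auto].
- apply Ck_on_of_derive with zeta; [exact Z1|].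
  apply IH with (fun u => a * kap u) (fun u => kap' u * z (a * u) + sig' u).
  + apply (Ck_on_mult (E := R1)); [apply (Ck_on_const (E := R1))|exact Hkn].
  + apply (Ck_on_plus (E := R1)); [|exact S2].
    apply (Ck_on_mult (E := R1)); [exact K2|]. now apply Ck_on_scale.
  + exact Z2.
  + intros u Hu. rewrite Rabs_mult, (Rabs_pos_eq a) by lra.
    specialize (Hle u Hu). pose proof (Rabs_pos (kap u)). nra.
  + exact Z3.
Qed.

End FunctionalEquation.

(** * The triangle *)

Lemma is_grad_mult (D : R * R -> Prop) f g q fu fv gu gv : D q ->
  is_grad D f q fu fv -> is_grad D g q gu gv ->
  is_grad D (fun p => f p * g p) q (fu * g q + f q * gu) (fv * g q + f q * gv).
Proof.
intros Hq Hf Hg.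
refine (fderiv_ext_lin (E := R2) D _ q _ _ _ (fderiv_mult (E := R2) D f g q _ _ Hq Hf Hg)).
intros y. simpl. ring.
Qed.

Lemma is_grad_plus (D : R * R -> Prop) f g q fu fv gu gv :
  is_grad D f q fu fv -> is_grad D g q gu gv ->
  is_grad D (fun p => f p + g p) q (fu + gu) (fv + gv).
Proof.
intros Hf Hg.
refine (fderiv_ext_lin (E := R2) D _ q _ _ _ (fderiv_plus (E := R2) D f g q _ _ Hf Hg)).
intros y. simpl. ring.
Qed.

Lemma is_grad_linear (D : R * R -> Prop) q c1 c2 :
  is_grad D (fun p => c1 * fst p + c2 * snd p) q c1 c2.
Proof. apply (fderiv_linear (E := R2)), is_linear_R2. Qed.

Lemma is_grad_const (D : R * R -> Prop) q c : is_grad D (fun _ => c) q 0 0.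
Proof.
refine (fderiv_ext_lin (E := R2) D _ q _ _ _ (fderiv_const (E := R2) D c q)).
intros y. simpl. ring.
Qed.

Lemma is_grad_eq (D : R * R -> Prop) f q fu fv fu' fv' :
  is_grad D f q fu fv -> fu = fu' -> fv = fv' -> is_grad D f q fu' fv'.
Proof. now intros H <- <-. Qed.

Lemma is_grad_ext (D : R * R -> Prop) f g q fu fv : D q ->
  (forall p, D p -> f p = g p) -> is_grad D f q fu fv -> is_grad D g q fu fv.
Proof. apply (fderiv_ext (E := R2)). Qed.

Lemma is_grad_comp1 (D : R * R -> Prop) (I : R -> Prop) f (g : R -> R) q fu fv l : D q ->
  (forall p, D p -> I (f p)) ->
  is_grad D f q fu fv -> is_derive_on I g (f q) l ->
  is_grad D (fun p => g (f p)) q (l * fu) (l * fv).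
Proof.
intros Hq HI Hf Hg.
refine (fderiv_ext_lin (E := R2) D _ q _ _ _ (fderiv_comp1 (E := R2) D I f g q _ l Hq HI Hf Hg)).
intros y. simpl. ring.
Qed.

Lemma is_grad_comp_lin (D D2 : R * R -> Prop) f q p11 p12 p21 p22 fu fv : D q ->
  (forall p, D p -> D2 (p11 * fst p + p12 * snd p, p21 * fst p + p22 * snd p)) ->
  is_grad D2 f (p11 * fst q + p12 * snd q, p21 * fst q + p22 * snd q) fu fv ->
  is_grad D (fun p => f (p11 * fst p + p12 * snd p, p21 * fst p + p22 * snd p)) q
    (p11 * fu + p21 * fv) (p12 * fu + p22 * fv).
Proof.
intros Hq HD Hf.
refine (fderiv_ext_lin (E := R2) D _ q _ _ _ (fderiv_comp2 (E := R2) D D2 _ _ f q _ _ fu fv Hq HD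
 (is_grad_linear D q p11 p12) (is_grad_linear D q p21 p22) Hf)).
intros y. simpl. ring.
Qed.

Lemma is_derive_on_curve (I : R -> Prop) (D : R * R -> Prop) f c1 c2 x d1 d2 fu fv : I x ->
  (forall y, I y -> D (c1 y, c2 y)) ->
  is_derive_on I c1 x d1 -> is_derive_on I c2 x d2 ->
  is_grad D f (c1 x, c2 x) fu fv ->
  is_derive_on I (fun y => f (c1 y, c2 y)) x (fu * d1 + fv * d2).
Proof.
intros Hx HD H1 H2 Hf.
refine (fderiv_ext_lin (E := R1) I _ x _ _ _
  (fderiv_comp2 (E := R1) I D c1 c2 f x _ _ fu fv Hx HD H1 H2 Hf)).
intros y. simpl. ring.
Qed.

Lemma is_derive_on_affine (I : R -> Prop) x c0 c1 : I x ->
  is_derive_on I (fun y => c0 + c1 * y) x c1.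
Proof. intros Hx. apply is_derive_on_of; [exact Hx|]. auto_derive; [trivial|ring]. Qed.

Lemma is_derive_on_mult (I : R -> Prop) f g x f' g' : I x ->
  is_derive_on I f x f' -> is_derive_on I g x g' ->
  is_derive_on I (fun y => f y * g y) x (f' * g x + f x * g').
Proof.
intros Hx Hf Hg.
refine (fderiv_ext_lin (E := R1) I _ x _ _ _
  (fderiv_mult (E := R1) I f g x _ _ Hx Hf Hg)).
intros y. simpl. ring.
Qed.

Lemma is_derive_on_plus (I : R -> Prop) f g x f' g' :
  is_derive_on I f x f' -> is_derive_on I g x g' ->
  is_derive_on I (fun y => f y + g y) x (f' + g').
Proof.
intros Hf Hg.
refine (fderiv_ext_lin (E := R1) I _ x _ _ _
  (fderiv_plus (E := R1) I f g x _ _ Hf Hg)).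
intros y. simpl. ring.
Qed.

Lemma is_derive_on_comp (I J : R -> Prop) f g x f' g' : I x ->
  (forall y, I y -> J (f y)) ->
  is_derive_on I f x f' -> is_derive_on J g (f x) g' ->
  is_derive_on I (fun y => g (f y)) x (g' * f').
Proof.
intros Hx HJ Hf Hg.
refine (fderiv_ext_lin (E := R1) I _ x _ _ _
  (fderiv_comp1 (E := R1) I J f g x _ g' Hx HJ Hf Hg)).
intros y. simpl. ring.
Qed.

Lemma is_derive_on_const (I : R -> Prop) c x : is_derive_on I (fun _ => c) x 0.
Proof.
refine (fderiv_ext_lin (E := R1) I _ x _ _ _
  (fderiv_const (E := R1) I c x)).
intros y. simpl. ring.
Qed.

Lemma clamp_lip_bounds a b c d x : Rabs (clamp a b x - clamp c d x) <= Rmax (Rabs (a - c)) (Rabs (b - d)).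
Proof.
unfold clamp, Rmax, Rmin, Rabs.
repeat destruct Rle_dec; repeat destruct Rcase_abs; try lra.
Qed.

Section Triangle.
Variables a ep : R.
Hypothesis (Ha : 0 < a < 1) (Hep : 0 < ep).

Let T := T_dom a ep.

Lemma T_dom_iff u v : T (u, v) <-> 0 <= u <= a * ep /\ u <= v /\ a * v <= u.
Proof.
unfold T, T_dom; simpl. split.
- intros [H1 [H2 [H3 H4]]].
  assert (u / a * a = u) by (field; lra). nra.
- intros [[H1 H2] [H3 H4]].
  assert (E : u / a * a = u) by (field; lra).
  repeat split; try lra; apply Rmult_le_reg_r with a; lra.
Qed.

Lemma T_dom_convex p q s : T p -> T q -> 0 <= s <= 1 ->
  T (fst p + (fst q - fst p) * s, snd p + (snd q - snd p) * s).
Proof.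
destruct p as [u v], q as [u' v']. rewrite !T_dom_iff. simpl. intros Hp Hq Hs.
repeat split; nra.
Qed.

(** A Lipschitz retraction of the plane onto the triangle: [u] is clamped first, then [v] between
    the two edges at that [u]. Through [ext], integrands become continuous on a whole line and
    uniform continuity can be taken from a rectangle. *)
Definition retract (q : R * R) : R * R :=
  let u := clamp 0 (a * ep) (fst q) in (u, clamp u (u / a) (snd q)).

Lemma retract_in q : T (retract q).
Proof.
unfold retract. assert (H : 0 <= a * ep) by nra.
pose proof (clamp_in 0 (a * ep) (fst q) H) as H1.
set (u := clamp 0 (a * ep) (fst q)) in *.
assert (E : u / a * a = u) by (field; lra).
assert (H2 : u <= u / a) by nra.
pose proof (clamp_in u (u / a) (snd q) H2) as H3.
apply T_dom_iff. repeat split; nra.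
Qed.

Lemma retract_id q : T q -> retract q = q.
Proof.
destruct q as [u v]. rewrite T_dom_iff. intros H. unfold retract; simpl.
rewrite clamp_id by tauto.
assert (E : u / a * a = u) by (field; lra).
rewrite clamp_id; [reflexivity|]. nra.
Qed.

Definition ext (g : R * R -> R) (q : R * R) : R := g (retract q).

Lemma ext_T g q : T q -> ext g q = g q.
Proof. intros H. unfold ext. now rewrite retract_id. Qed.

(** The second coordinate moves by its own increment plus that of its bounds [u] and [u / a], whose
    slopes are at most [/ a]; hence the constant [1 + / a]. *)
Lemma retract_lip q q' d :
  Rabs (fst q - fst q') < d -> Rabs (snd q - snd q') < d ->
  Rabs (fst (retract q) - fst (retract q')) < d * (1 + / a) /\
  Rabs (snd (retract q) - snd (retract q')) < d * (1 + / a).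
Proof.
intros H1 H2. unfold retract; simpl.
pose proof (clamp_lip 0 (a * ep) (fst q) (fst q')) as H3.
set (u := clamp 0 (a * ep) (fst q)) in *. set (u' := clamp 0 (a * ep) (fst q')) in *.
assert (Hia : 1 < / a) by (rewrite <- Rinv_1; apply Rinv_lt_contravar; lra).
assert (Hd : 0 < d) by (pose proof (Rabs_pos (fst q - fst q')); lra).
split; [nra|].
replace (clamp u (u / a) (snd q) - clamp u' (u' / a) (snd q')) with
 ((clamp u (u / a) (snd q) - clamp u (u / a) (snd q')) +
  (clamp u (u / a) (snd q') - clamp u' (u' / a) (snd q'))) by ring.
eapply Rle_lt_trans; [apply Rabs_triang|].
pose proof (clamp_lip u (u / a) (snd q) (snd q')).
pose proof (clamp_lip_bounds u (u / a) u' (u' / a) (snd q')) as H4.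
assert (Rmax (Rabs (u - u')) (Rabs (u / a - u' / a)) <= / a * Rabs (u - u')).
{ replace (u / a - u' / a) with (/ a * (u - u')) by (field; lra).
  rewrite Rabs_mult, (Rabs_pos_eq (/ a)) by lra.
  apply Rmax_lub; [|lra]. pose proof (Rabs_pos (u - u')). nra. }
nra.
Qed.

Lemma ext_continuous g (q : R2) : CkR2 0 T g -> continuous (ext g) q.
Proof.
intros Hg P [eps HP]. rewrite continuous_on2_iff in Hg.
destruct (Hg _ (retract_in q) eps (cond_pos eps)) as [d [Hd1 Hd2]].
assert (Hia : 1 < / a) by (rewrite <- Rinv_1; apply Rinv_lt_contravar; lra).
assert (Hd : 0 < d / (1 + / a)) by (apply Rdiv_lt_0_compat; lra).
exists (mkposreal _ Hd). intros p [H1 H2]. apply HP.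
destruct (retract_lip p q _ H1 H2) as [H3 H4]. simpl pos in H3, H4.
replace (d / (1 + / a) * (1 + / a)) with d in H3, H4.
2:{ unfold Rdiv. rewrite Rmult_assoc, Rinv_l by lra. ring. }
apply Hd2; [apply retract_in | exact H3 | exact H4].
Qed.

Lemma T_dom_uniform_continuity g : CkR2 0 T g ->
  forall eps, 0 < eps -> exists d, 0 < d /\ forall p q, T p -> T q ->
    Rabs (fst p - fst q) < d -> Rabs (snd p - snd q) < d -> Rabs (g p - g q) < eps.
Proof.
intros Hg eps He.
destruct (uniform_continuity_2d (fun u v => ext g (u, v)) 0 (a * ep) 0 ep) with
  (eps := mkposreal eps He) as [d Hd].
- intros x y _ _. apply continuity_2d_pt_filterlim.
  apply filterlim_ext with (ext g); [now intros []|]. exact (ext_continuous g (x, y) Hg).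
- exists d. split; [apply cond_pos|]. intros [u v] [u' v'] Hp Hq H1 H2.
  rewrite <- (ext_T g (u, v) Hp), <- (ext_T g (u', v') Hq).
  rewrite T_dom_iff in Hp, Hq. simpl in *.
  assert (0 <= v <= ep) by nra. assert (0 <= v' <= ep) by nra.
  apply Hd; lra.
Qed.

Lemma T_dom_MVT g gu gv p q :
  (forall q, T q -> is_grad T g q (gu q) (gv q)) -> T p -> T q ->
  exists x, T x /\ Rabs (fst x - fst p) <= Rabs (fst q - fst p) /\
    Rabs (snd x - snd p) <= Rabs (snd q - snd p) /\
    g q - g p = gu x * (fst q - fst p) + gv x * (snd q - snd p).
Proof.
intros Hg Hp Hq.
set (c1 := fun s => fst p + (fst q - fst p) * s). set (c2 := fun s => snd p + (snd q - snd p) * s).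
destruct (MVT_on 0 1 (fun s => g (c1 s, c2 s)) (fun s => gu (c1 s, c2 s) * (fst q - fst p) +
  gv (c1 s, c2 s) * (snd q - snd p))) as [s [Hs Hs']]; [lra| |].
- intros s Hs. apply (is_derive_on_curve _ T); [exact Hs | | | |].
  + intros y Hy. now apply T_dom_convex.
  + now apply is_derive_on_affine. + now apply is_derive_on_affine.
  + apply Hg. now apply T_dom_convex.
- exists (c1 s, c2 s). split; [now apply T_dom_convex|].
  assert (L : forall x, Rabs (x * s) <= Rabs x).
  { intros x. rewrite Rabs_mult, (Rabs_pos_eq s) by lra. pose proof (Rabs_pos x). nra. }
  split; [|split].
  + simpl. replace (c1 s - fst p) with ((fst q - fst p) * s) by (unfold c1; ring). apply L.
  + simpl. replace (c2 s - snd p) with ((snd q - snd p) * s) by (unfold c2; ring). apply L.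
  + assert (E1 : (c1 1, c2 1) = q) by (unfold c1, c2; destruct q; simpl; f_equal; ring).
    assert (E0 : (c1 0, c2 0) = p) by (unfold c1, c2; destruct p; simpl; f_equal; ring).
    rewrite E1, E0 in Hs'. rewrite Hs'. ring.
Qed.

(** [q] can be joined to the three vertices of [T] by segments in [T]. *)
Lemma is_grad_unique f q fu fv fu' fv' : T q ->
  is_grad T f q fu fv -> is_grad T f q fu' fv' -> fu = fu' /\ fv = fv'.
Proof.
intros Hq H1 H2.
assert (L : forall p, T p ->
  (fu - fu') * (fst p - fst q) + (fv - fv') * (snd p - snd q) = 0).
{ intros p Hp.
  assert (C : forall gu gv, is_grad T f q gu gv ->
    is_derive_on (fun s => 0 <= s <= 1)
     (fun s => f (fst q + (fst p - fst q) * s, snd q + (snd p - snd q) * s)) 0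
     (gu * (fst p - fst q) + gv * (snd p - snd q))).
  { intros gu gv Hg. apply (is_derive_on_curve _ T); [lra| | | |].
    - intros y Hy. now apply T_dom_convex.
    - apply is_derive_on_affine; lra. - apply is_derive_on_affine; lra.
    - rewrite !Rmult_0_r, !Rplus_0_r, <- surjective_pairing. exact Hg. }
  pose proof (is_derive_on_unique 0 1 _ 0 _ _ ltac:(lra) ltac:(lra) (C _ _ H1) (C _ _ H2)).
  lra. }
pose proof (L (0, 0)) as L0. pose proof (L (a * ep, a * ep)) as L1. pose proof (L (a * ep, ep)) as L2.
rewrite T_dom_iff in L0, L1, L2. simpl in L0, L1, L2.
assert (He : 0 < a * ep) by nra.
specialize (L0 ltac:(repeat split; nra)). specialize (L1 ltac:(repeat split; nra)).
specialize (L2 ltac:(repeat split; nra)).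
assert (E : (fv - fv') * (ep - a * ep) = 0) by lra.
assert (fv - fv' = 0).
{ apply Rmult_integral in E. destruct E as [|E]; [assumption|]. nra. }
assert (E' : (fu - fu') * (a * ep) = 0) by (rewrite H in *; lra).
apply Rmult_integral in E'. destruct E' as [E'|E']; [split; lra | nra].
Qed.

End Triangle.

(** * Integrals depending on parameters *)

Section ParameterIntegral.
Variables a ep : R.
Hypothesis (Ha : 0 < a < 1) (Hep : 0 < ep).
Let T := T_dom a ep.
Let J (s : R) := 0 <= s <= 1.

Variables c11 c12 c21 c22 : R -> R.
Let M (s : R) (q : R * R) : R * R :=
  (c11 s * fst q + c12 s * snd q, c21 s * fst q + c22 s * snd q).
Hypothesis coef_cont : forall s, continuous c11 s /\ continuous c12 s /\
  continuous c21 s /\ continuous c22 s.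
Hypothesis c_le : forall s, J s -> Rabs (c11 s) <= 1 /\ Rabs (c12 s) <= 1 /\
  Rabs (c21 s) <= 1 /\ Rabs (c22 s) <= 1.
Hypothesis M_T : forall s q, J s -> T q -> T (M s q).

(** The weight [phi] is part of the definition because differentiation in [q] multiplies it by an
    entry of the matrix of [M s]. With weights and entries bounded by 1, the family is closed under
    taking gradients, and [Ck_on_pint] is an induction on the order. *)
Definition pint (phi : R -> R) (g : R * R -> R) (q : R * R) : R :=
  RInt (fun s => phi s * ext a ep g (M s q)) 0 1.

Let weight (phi : R -> R) :=
  (forall s, continuous phi s) /\ forall s, J s -> Rabs (phi s) <= 1.

Lemma pint_integrand_continuous phi g q s : weight phi -> CkR2 0 T g ->
  continuous (fun s => phi s * ext a ep g (M s q)) s.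
Proof.
intros [H1 _] Hg.
apply (continuous_mult (K := R_AbsRing)); [apply H1|].
destruct (coef_cont s) as [C1 [C2 [C3 C4]]].
apply (continuous_comp_2 (fun s => c11 s * fst q + c12 s * snd q)
  (fun s => c21 s * fst q + c22 s * snd q) (fun x y => ext a ep g (x, y))).
- apply (continuous_plus (V := R1));
  apply (continuous_mult (K := R_AbsRing)); auto; apply continuous_const.
- apply (continuous_plus (V := R1));
  apply (continuous_mult (K := R_AbsRing)); auto; apply continuous_const.
- apply continuous_ext with (ext a ep g); [now intros []|].
  apply (ext_continuous a ep Ha Hep g). exact Hg.
Qed.

Lemma pint_ex phi g q : weight phi -> CkR2 0 T g ->
  ex_RInt (fun s => phi s * ext a ep g (M s q)) 0 1.
Proof.
intros H1 Hg. apply (ex_RInt_continuous (V := R_CompleteNormedModule)).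
intros s _. now apply pint_integrand_continuous.
Qed.

Lemma pint_pt_lip s p q d : J s ->
  Rabs (fst p - fst q) <= d -> Rabs (snd p - snd q) <= d ->
  Rabs (fst (M s p) - fst (M s q)) <= 2 * d /\ Rabs (snd (M s p) - snd (M s q)) <= 2 * d.
Proof.
intros Hs H1 H2. destruct (c_le s Hs) as [C1 [C2 [C3 C4]]]. simpl.
assert (L : forall x y, Rabs x <= 1 -> Rabs y <= 1 ->
  Rabs (x * fst p + y * snd p - (x * fst q + y * snd q)) <= 2 * d).
{ intros x y Hx Hy.
  replace (x * fst p + y * snd p - (x * fst q + y * snd q)) with
    (x * (fst p - fst q) + y * (snd p - snd q)) by ring.
  eapply Rle_trans; [apply Rabs_triang|]. rewrite !Rabs_mult.
  pose proof (Rabs_pos x). pose proof (Rabs_pos y).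
  pose proof (Rabs_pos (fst p - fst q)). pose proof (Rabs_pos (snd p - snd q)). nra. }
split; now apply L.
Qed.

Lemma pint_continuous phi g : weight phi -> CkR2 0 T g ->
  CkR2 0 T (pint phi g).
Proof.
intros Hphi Hg. apply continuous_on2_iff. intros q Hq eps He.
destruct (T_dom_uniform_continuity a ep Ha Hep g Hg (eps / 2)) as [d [Hd1 Hd2]]; [lra|].
exists (d / 4). split; [lra|]. intros p Hp H1 H2. unfold pint.
assert (E : RInt (fun s => phi s * ext a ep g (M s p)) 0 1 -
   RInt (fun s => phi s * ext a ep g (M s q)) 0 1 =
   RInt (fun s => phi s * ext a ep g (M s p) - phi s * ext a ep g (M s q)) 0 1).
{ symmetry. apply (RInt_minus (V := R_CompleteNormedModule)); now apply pint_ex. }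
rewrite E.
apply Rle_lt_trans with ((1 - 0) * (eps / 2)); [|lra].
apply abs_RInt_le_const; [lra| |].
- apply (ex_RInt_minus (V := R_CompleteNormedModule)); now apply pint_ex.
- intros s Hs. rewrite !ext_T by (try assumption; now apply M_T).
  rewrite <- Rmult_minus_distr_l, Rabs_mult.
  destruct (pint_pt_lip s p q (d / 4) Hs) as [L1 L2]; [lra|lra|].
  assert (Rabs (g (M s p) - g (M s q)) < eps / 2).
  { apply Hd2; [now apply M_T | now apply M_T | lra | lra]. }
  pose proof (proj2 Hphi s Hs). pose proof (Rabs_pos (phi s)).
  pose proof (Rabs_pos (g (M s p) - g (M s q))). nra.
Qed.

Lemma weight_mult phi psi : weight phi -> weight psi -> weight (fun s => phi s * psi s).
Proof.
intros [H1 H2] [H3 H4]. split.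
- intros s. now apply (continuous_mult (K := R_AbsRing)).
- intros s Hs. rewrite Rabs_mult. specialize (H2 s Hs). specialize (H4 s Hs).
  pose proof (Rabs_pos (phi s)). pose proof (Rabs_pos (psi s)). nra.
Qed.

Lemma weight_c : weight c11 /\ weight c12 /\ weight c21 /\ weight c22.
Proof. repeat split; intros; try apply coef_cont; now apply c_le. Qed.

(** Uniformity in [p] is the point: under the integral the expansion is needed at all [M s q] with
    one and the same radius. It follows from the mean value theorem and the uniform continuity of
    the gradient. *)
Lemma T_dom_taylor g gu gv :
  (forall q, T q -> is_grad T g q (gu q) (gv q)) ->
  CkR2 0 T gu -> CkR2 0 T gv ->
  forall eps, 0 < eps -> exists d, 0 < d /\ forall p q h, T p -> T q -> h < d ->
    Rabs (fst q - fst p) <= h -> Rabs (snd q - snd p) <= h ->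
    Rabs (g q - g p - (gu p * (fst q - fst p) + gv p * (snd q - snd p))) <= eps * h.
Proof.
intros Hg Hu Hv eps He.
destruct (T_dom_uniform_continuity a ep Ha Hep gu Hu (eps / 2)) as [d1 [D1 D1']]; [lra|].
destruct (T_dom_uniform_continuity a ep Ha Hep gv Hv (eps / 2)) as [d2 [D2 D2']]; [lra|].
exists (Rmin d1 d2). split; [now apply Rmin_pos|].
intros p q h Hp Hq Hh H1 H2.
pose proof (Rmin_l d1 d2). pose proof (Rmin_r d1 d2).
destruct (T_dom_MVT a ep Ha g gu gv p q Hg Hp Hq) as [x [X0 [X1 [X2 X3]]]].
rewrite X3.
replace (_ - _) with ((gu x - gu p) * (fst q - fst p) + (gv x - gv p) * (snd q - snd p)) by ring.
assert (Rabs (gu x - gu p) < eps / 2) by (apply D1'; auto; lra).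
assert (Rabs (gv x - gv p) < eps / 2) by (apply D2'; auto; lra).
eapply Rle_trans; [apply Rabs_triang|]. rewrite !Rabs_mult.
pose proof (Rabs_pos (gu x - gu p)). pose proof (Rabs_pos (gv x - gv p)).
pose proof (Rabs_pos (fst q - fst p)). pose proof (Rabs_pos (snd q - snd p)).
nra.
Qed.

Lemma pint_grad phi g gu gv q : weight phi ->
  (forall q, T q -> is_grad T g q (gu q) (gv q)) ->
  CkR2 0 T gu -> CkR2 0 T gv -> T q ->
  is_grad T (pint phi g) q
    (pint (fun s => phi s * c11 s) gu q + pint (fun s => phi s * c21 s) gv q)
    (pint (fun s => phi s * c12 s) gu q + pint (fun s => phi s * c22 s) gv q).
Proof.
intros Hphi Hg Hu Hv Hq.
destruct weight_c as [W1 [W2 [W3 W4]]].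
assert (Hgc : CkR2 0 T g).
{ intros p Hp. exact (fderiv_continuous (E := R2) _ _ _ _ (Hg p Hp)). }
apply is_grad_iff; [exact Hq|]. intros eps He.
destruct (T_dom_taylor g gu gv Hg Hu Hv (eps / 2)) as [d [Hd1 Hd2]]; [lra|].
exists (d / 2). split; [lra|]. intros p Hp H1 H2.
set (h := Rmax (Rabs (fst p - fst q)) (Rabs (snd p - snd q))).
assert (Hh1 : Rabs (fst p - fst q) <= h) by apply Rmax_l.
assert (Hh2 : Rabs (snd p - snd q) <= h) by apply Rmax_r.
assert (Hh3 : h < d / 2) by (apply Rmax_lub_lt; assumption).
set (x := fst p - fst q) in *. set (y := snd p - snd q) in *.
assert (Hint : is_RInt (fun s => phi s * ext a ep g (M s p) - phi s * ext a ep g (M s q) -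
   ((x * (phi s * c11 s * ext a ep gu (M s q)) + x * (phi s * c21 s * ext a ep gv (M s q))) +
    (y * (phi s * c12 s * ext a ep gu (M s q)) + y * (phi s * c22 s * ext a ep gv (M s q))))) 0 1
   (pint phi g p - pint phi g q -
   ((x * pint (fun s => phi s * c11 s) gu q + x * pint (fun s => phi s * c21 s) gv q) +
    (y * pint (fun s => phi s * c12 s) gu q + y * pint (fun s => phi s * c22 s) gv q)))).
{ assert (Sc : forall k psi G, weight psi -> CkR2 0 T G ->
    is_RInt (fun s => k * (psi s * ext a ep G (M s q))) 0 1 (k * pint psi G q)).
  { intros k psi G Hpsi HG.
    apply (is_RInt_scal (V := R1)).
    apply (RInt_correct (V := R_CompleteNormedModule)). now apply pint_ex. }
  apply (is_RInt_minus (V := R1)).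
  - apply (is_RInt_minus (V := R1));
    apply (RInt_correct (V := R_CompleteNormedModule)); now apply pint_ex.
  - apply (is_RInt_plus (V := R1)); apply (is_RInt_plus (V := R1));
    apply Sc; auto using weight_mult. }
replace (_ - _) with (pint phi g p - pint phi g q -
   ((x * pint (fun s => phi s * c11 s) gu q + x * pint (fun s => phi s * c21 s) gv q) +
    (y * pint (fun s => phi s * c12 s) gu q + y * pint (fun s => phi s * c22 s) gv q))) by ring.
rewrite <- (is_RInt_unique _ _ _ _ Hint).
apply Rle_trans with ((1 - 0) * (eps * h)); [|lra].
apply abs_RInt_le_const; [lra | eexists; exact Hint |].
intros s Hs. rewrite !ext_T by (try assumption; now apply M_T).
destruct (pint_pt_lip s p q h Hs Hh1 Hh2) as [L1 L2].
(* Having entries bounded by 1, [M s] can at most double the distance in the maximum norm: the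
   expansion is used at radius [2 * h] with accuracy [eps / 2]. *)
specialize (Hd2 (M s q) (M s p) (2 * h) (M_T s q Hs Hq) (M_T s p Hs Hp) ltac:(lra) L1 L2).
match goal with |- Rabs ?e <= _ => replace e with
 (phi s * (g (M s p) - g (M s q) - (gu (M s q) * (fst (M s p) - fst (M s q)) +
   gv (M s q) * (snd (M s p) - snd (M s q))))) by (unfold M, x, y; simpl; ring) end.
rewrite Rabs_mult.
pose proof (proj2 Hphi s Hs). pose proof (Rabs_pos (phi s)).
match goal with |- _ * Rabs ?e <= _ => pose proof (Rabs_pos e) end.
nra.
Qed.

Lemma Ck_on_pint n phi g : weight phi -> CkR2 n T g ->
  CkR2 n T (pint phi g).
Proof.
destruct weight_c as [W1 [W2 [W3 W4]]].
revert phi g; induction n as [|n IH]; intros phi g Hphi Hg; [now apply pint_continuous|].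
destruct (Ck_on_grad _ _ _ Hg) as [gu [gv [G1 [G2 G3]]]].
apply Ck_on_of_grad with
   (fun q => pint (fun s => phi s * c11 s) gu q + pint (fun s => phi s * c21 s) gv q)
   (fun q => pint (fun s => phi s * c12 s) gu q + pint (fun s => phi s * c22 s) gv q).
- intros q Hq. apply pint_grad; auto; apply Ck_on_le with n; auto; lia.
- apply (Ck_on_plus (E := R2)); apply IH; auto using weight_mult.
- apply (Ck_on_plus (E := R2)); apply IH; auto using weight_mult.
Qed.

End ParameterIntegral.

(** * Integration along characteristics *)

Lemma is_derive_RInt_of_continuous (h : R -> R) x s : (forall y, continuous h y) ->
  is_derive (fun s => RInt h x s) s (h s).
Proof.
intros Hh. apply (is_derive_RInt (V := R1) h _ x); [|apply Hh].
apply filter_forall. intros y. apply (RInt_correct (V := R_CompleteNormedModule)).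
apply (ex_RInt_continuous (V := R_CompleteNormedModule)). auto.
Qed.

(** [q = P q + len q * (d1, d2)] where [P q] is the starting point on the boundary of the
    characteristic through [q], and [M s q] runs along it from [P q] to [q]. *)
Section Characteristics.
Variables a ep : R.
Hypothesis (Ha : 0 < a < 1) (Hep : 0 < ep).
Let T := T_dom a ep.
Let J (s : R) := 0 <= s <= 1.

Variables d1 d2 l1 l2 : R.
Hypothesis Hld : l1 * d1 + l2 * d2 = 1.

Definition char_len (q : R * R) : R := l1 * fst q + l2 * snd q.
Let c11 (s : R) := 1 + (s - 1) * (l1 * d1).
Let c12 (s : R) := (s - 1) * (l2 * d1).
Let c21 (s : R) := (s - 1) * (l1 * d2).
Let c22 (s : R) := 1 + (s - 1) * (l2 * d2).
Definition char_pt (s : R) (q : R * R) : R * R :=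
  (c11 s * fst q + c12 s * snd q, c21 s * fst q + c22 s * snd q).
Hypothesis c_le : forall s, J s -> Rabs (c11 s) <= 1 /\ Rabs (c12 s) <= 1 /\
  Rabs (c21 s) <= 1 /\ Rabs (c22 s) <= 1.
Hypothesis M_T : forall s q, J s -> T q -> T (char_pt s q).

Let M := char_pt.
Let P q := char_pt 0 q.
Let len := char_len.

Lemma char_pt_1 q : M 1 q = q.
Proof. destruct q; unfold M, char_pt, c11, c12, c21, c22; simpl; f_equal; ring. Qed.

Lemma char_pt_eq s q : M s q = (fst q + (s - 1) * len q * d1, snd q + (s - 1) * len q * d2).
Proof. unfold M, char_pt, c11, c12, c21, c22, len, char_len. f_equal; ring. Qed.

Lemma char_len_pt s q : len (M s q) = s * len q.
Proof.
rewrite char_pt_eq. unfold len, char_len; simpl.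
replace (l1 * _ + l2 * _) with (l1 * fst q + l2 * snd q +
  (s - 1) * (l1 * fst q + l2 * snd q) * (l1 * d1 + l2 * d2)) by ring.
rewrite Hld. ring.
Qed.

Lemma char_pt_comp s s' q : M s' (M s q) = M (s' * s) q.
Proof.
rewrite (char_pt_eq s'), char_len_pt, !char_pt_eq. simpl. f_equal; ring.
Qed.

Lemma char_start_pt s q : P (M s q) = P q.
Proof. unfold P. fold (M 0 (M s q)) (M 0 q). rewrite char_pt_comp. f_equal. ring. Qed.

Lemma char_start_T q : T q -> T (P q).
Proof. apply M_T. unfold J; lra. Qed.

Lemma coef_cont s : continuous c11 s /\ continuous c12 s /\ continuous c21 s /\ continuous c22 s.
Proof.
repeat split; apply (ex_derive_continuous (V := R1)); unfold c11, c12, c21, c22;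
  auto_derive; trivial.
Qed.

(** The line integral of [g] from [P q] to [q], rescaled to the fixed interval from 0 to 1; in this
    form its smoothness in [q] follows from that of [pint], also where the length vanishes. *)
Definition char_int (g : R * R -> R) (q : R * R) : R :=
  char_len q * pint a ep c11 c12 c21 c22 (fun _ => 1) g q.

Lemma weight_1 : (forall s, continuous (fun _ : R => 1) s) /\ forall s, J s -> Rabs 1 <= 1.
Proof. split; intros; [apply continuous_const | rewrite Rabs_R1; lra]. Qed.

Lemma Ck_on_fst n (D : R * R -> Prop) : CkR2 n D (fun q => fst q).
Proof.
apply (Ck_on_linear (E := R2)).
apply (is_linear_fst (U := R1) (V := R1)).
Qed.

Lemma Ck_on_snd n (D : R * R -> Prop) : CkR2 n D (fun q => snd q).
Proof.
apply (Ck_on_linear (E := R2)).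
apply (is_linear_snd (U := R1) (V := R1)).
Qed.

Lemma Ck_on_char_int n g : CkR2 n T g -> CkR2 n T (char_int g).
Proof.
intros Hg. apply (Ck_on_mult (E := R2)).
- apply (Ck_on_linear (E := R2)), is_linear_R2.
- apply (Ck_on_pint a ep Ha Hep); auto using coef_cont, weight_1.
Qed.

Lemma char_int_RInt g q :
  char_int g q = len q * RInt (fun s => ext a ep g (M s q)) 0 1.
Proof.
unfold char_int. fold (len q). f_equal. unfold pint. apply RInt_ext. intros s _. apply Rmult_1_l.
Qed.

Lemma ext_pt_continuous g q s : CkR2 0 T g ->
  continuous (fun s => ext a ep g (M s q)) s.
Proof.
intros Hg.
apply continuous_ext with (fun s => 1 * ext a ep g (M s q)); [intros; apply Rmult_1_l|].
apply (pint_integrand_continuous a ep Ha Hep c11 c12 c21 c22 coef_cont (fun _ => 1) g q s weight_1 Hg).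
Qed.

Lemma ext_pt_ex_RInt g q x y : CkR2 0 T g ->
  ex_RInt (fun s => ext a ep g (M s q)) x y.
Proof.
intros Hg. apply (ex_RInt_continuous (V := R_CompleteNormedModule)).
intros s _. now apply ext_pt_continuous.
Qed.

(** Parametrized by [0 <= s <= 1], an interval that does not degenerate where
    [char_len q = 0]. *)
Definition char_derive (f g : R * R -> R) : Prop :=
  forall q, T_dom a ep q -> forall s, 0 <= s <= 1 ->
    is_derive_on (fun s => 0 <= s <= 1) (fun s => f (char_pt s q)) s
      (char_len q * g (char_pt s q)).

Lemma char_derive_grad f fu fv :
  (forall q, T q -> is_grad T f q (fu q) (fv q)) ->
  char_derive f (fun q => d1 * fu q + d2 * fv q).
Proof.
intros Hf q Hq s Hs.
assert (H := is_derive_on_curve J T f (fun s => c11 s * fst q + c12 s * snd q)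
  (fun s => c21 s * fst q + c22 s * snd q) s (len q * d1) (len q * d2)
  (fu (M s q)) (fv (M s q)) Hs).
refine (is_derive_on_ext J _ _ s _ _ Hs (fun _ _ => eq_refl) _ (H _ _ _ _)).
- unfold len, M. ring.
- intros y Hy. now apply M_T.
- apply is_derive_on_of; [exact Hs|]. unfold c11, c12. auto_derive; [trivial|].
  unfold len, char_len. ring.
- apply is_derive_on_of; [exact Hs|]. unfold c21, c22. auto_derive; [trivial|].
  unfold len, char_len. ring.
- apply Hf. now apply M_T.
Qed.

(** Along [s |-> M s q] the difference of [f] and the primitive of its derivative has derivative
    zero, and [M 1 q = q]. *)
Lemma char_derive_FTC f g : char_derive f g -> CkR2 0 T g ->
  forall q, T q -> f q = f (P q) + char_int g q.
Proof.
intros Hf Hg q Hq.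
assert (HD : forall s, J s -> f (M s q) + - len q * RInt (fun s => ext a ep g (M s q)) 0 s
  = f (M 0 q) + - len q * RInt (fun s => ext a ep g (M s q)) 0 0).
{ apply (zero_derive_const 0 1 (fun s => f (M s q) + - len q *
    RInt (fun s => ext a ep g (M s q)) 0 s)).
  intros s Hs.
  assert (E : is_derive_on J (fun s => - len q * RInt (fun s => ext a ep g (M s q)) 0 s) s
     (- len q * ext a ep g (M s q))).
  { apply is_derive_on_of; [exact Hs|]. apply is_derive_scal.
    apply (is_derive_RInt_of_continuous (fun s => ext a ep g (M s q))).
    intros y. now apply ext_pt_continuous. }
  refine (is_derive_on_ext J _ _ s _ _ Hs (fun _ _ => eq_refl) _
    (is_derive_on_plus J _ _ s _ _ (Hf q Hq s Hs) E)).
  rewrite ext_T by (try assumption; now apply M_T). unfold len, M. ring. }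
specialize (HD 1 ltac:(unfold J; lra)). rewrite char_pt_1, RInt_point in HD.
rewrite char_int_RInt. unfold P, zero in *; simpl in HD. unfold M in HD at 2. lra.
Qed.

(** The characteristic that ends at [M s q] is the initial part of the one that ends at [q], so a
    linear substitution turns the integral over it into one with upper limit [s]. *)
Lemma char_int_pt g q s : CkR2 0 T g ->
  char_int g (M s q) = len q * RInt (fun s => ext a ep g (M s q)) 0 s.
Proof.
intros Hg. rewrite char_int_RInt, char_len_pt.
assert (E := RInt_comp_lin (V := R_CompleteNormedModule) (fun s => ext a ep g (M s q)) s 0 0 1).
replace (s * 0 + 0) with 0 in E by ring. replace (s * 1 + 0) with s in E by ring.
rewrite <- E by now apply ext_pt_ex_RInt.
rewrite (RInt_scal (V := R_CompleteNormedModule) (fun y => ext a ep g (M (s * y + 0) q))).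
- rewrite (RInt_ext (fun y => ext a ep g (M (s * y + 0) q)) (fun y => ext a ep g (M y (M s q)))).
  + unfold scal; simpl; unfold mult; simpl. ring.
  + intros y _. rewrite char_pt_comp, Rplus_0_r, (Rmult_comm s y). reflexivity.
- apply (ex_RInt_continuous (V := R_CompleteNormedModule)). intros y _.
  apply (continuous_comp (fun y => s * y + 0) (fun y => ext a ep g (M y q)));
    [|now apply ext_pt_continuous].
  apply (ex_derive_continuous (V := R1)). auto_derive; trivial.
Qed.

Lemma char_derive_int g : CkR2 0 T g -> char_derive (char_int g) g.
Proof.
intros Hg q Hq s Hs.
apply (is_derive_on_ext J (fun s => len q * RInt (fun s => ext a ep g (M s q)) 0 s)) with
  (len q * ext a ep g (M s q)); [exact Hs | | |].
- intros y _. symmetry. now apply char_int_pt.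
- rewrite ext_T by (try assumption; now apply M_T). reflexivity.
- apply is_derive_on_of; [exact Hs|]. apply is_derive_scal.
  apply (is_derive_RInt_of_continuous (fun s => ext a ep g (M s q))).
  intros y. now apply ext_pt_continuous.
Qed.

Lemma char_derive_of_int f g : CkR2 0 T g ->
  (forall q, T q -> f q = f (P q) + char_int g q) -> char_derive f g.
Proof.
intros Hg Hf q Hq s Hs.
apply (is_derive_on_ext J (fun s => char_int g (M s q) + f (P q))) with
  (len q * g (M s q) + 0); [exact Hs | | |].
- intros y Hy. rewrite (Hf (char_pt y q)) by now apply M_T.
  fold (M y q). rewrite char_start_pt. unfold M. ring.
- unfold len, M. ring.
- apply is_derive_on_plus; [|apply is_derive_on_const]. now apply char_derive_int.
Qed.

(** Variation of constants: [exp (- char_int l q) * Z q] has derivative [exp (- char_int l q) * S q]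
    along the characteristics, and the exponential is 1 at [P q], where the length vanishes. *)
Lemma char_linear_ode l S Z : CkR2 0 T l -> CkR2 0 T S ->
  char_derive Z (fun q => l q * Z q + S q) ->
  forall q, T q -> Z q = exp (char_int l q) *
    (Z (P q) + char_int (fun q => exp (- char_int l q) * S q) q).
Proof.
intros Hl HS HZ q Hq.
assert (He : CkR2 0 T (fun q => exp (- char_int l q))).
{ apply (Ck_on_comp1 (E := R2) 0 T (fun _ => True) (fun q => - char_int l q) exp);
    [trivial | apply Ck_on_exp_R|].
  apply (Ck_on_opp (E := R2)). now apply Ck_on_char_int. }
assert (H := char_derive_FTC (fun q => exp (- char_int l q) * Z q)
  (fun q => exp (- char_int l q) * S q)).
assert (HE : exp (char_int l q) * exp (- char_int l q) = 1).
{ rewrite <- exp_plus, Rplus_opp_r. apply exp_0. }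
assert (HP : char_int l (P q) = 0).
{ unfold char_int. fold (len (P q)). unfold P. fold (M 0 q). rewrite char_len_pt. ring. }
assert (E : exp (- char_int l q) * Z q =
  exp (- char_int l (P q)) * Z (P q) + char_int (fun q => exp (- char_int l q) * S q) q).
{ apply H; [|now apply (Ck_on_mult (E := R2))|exact Hq].
  clear H q Hq HE HP. intros q Hq s Hs.
  assert (E1 : is_derive_on J (fun s => exp (- char_int l (M s q))) s
     (exp (- char_int l (M s q)) * (- 1 * (len q * l (M s q))))).
  { apply (is_derive_on_comp J (fun _ => True) (fun s => - char_int l (M s q)) exp);
      [exact Hs | trivial | | apply is_derive_on_of; [trivial | apply is_derive_exp]].
    refine (is_derive_on_ext J (fun s => - 1 * char_int l (M s q)) _ s _ _ Hs _ _
      (is_derive_on_mult J (fun _ => -1) _ s _ _ Hs (is_derive_on_const J (-1) s)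
        (char_derive_int l Hl q Hq s Hs))).
    - intros; ring. - unfold len, M; ring. }
  refine (is_derive_on_ext J _ _ s _ _ Hs (fun _ _ => eq_refl) _
    (is_derive_on_mult J _ _ s _ _ Hs E1 (HZ q Hq s Hs))).
  unfold len, M; ring. }
rewrite HP, Ropp_0, exp_0, Rmult_1_l in E. rewrite <- E, <- Rmult_assoc, HE. ring.
Qed.

(** No second derivative of [f] transversal to the characteristics is assumed to exist. *)
Lemma char_derive_transversal f fu fv gu gv e1 e2 :
  (forall q, T q -> is_grad T f q (fu q) (fv q)) ->
  (forall q, T q -> is_grad T (fun q => d1 * fu q + d2 * fv q) q (gu q) (gv q)) ->
  CkR2 0 T fu -> CkR2 0 T fv ->
  CkR2 0 T gu -> CkR2 0 T gv ->
  char_derive (fun q => e1 * fu q + e2 * fv q) (fun q => e1 * gu q + e2 * gv q).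
Proof.
intros Hf Hg Hfu Hfv Hgu Hgv.
set (g := fun q => d1 * fu q + d2 * fv q) in *.
assert (Kc : forall k, CkR2 0 T (fun _ => k)).
{ intros k. apply (Ck_on_const (E := R2)). }
assert (Hgc : CkR2 0 T g).
{ apply (Ck_on_plus (E := R2)); apply (Ck_on_mult (E := R2)); auto. }
assert (Hegc : CkR2 0 T (fun q => e1 * gu q + e2 * gv q)).
{ apply (Ck_on_plus (E := R2)); apply (Ck_on_mult (E := R2)); auto. }
apply char_derive_of_int; [exact Hegc|].
intros q Hq.
(* [f] is its value at the starting point plus the integral of [g]. Differentiating this
   representation, and identifying the result with [fu], [fv] by uniqueness of the gradient, leaves
   only first derivatives of [g] and values of [fu], [fv] at [P q]. *)
assert (HFTC := char_derive_FTC f g (char_derive_grad f fu fv Hf) Hgc).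
destruct (weight_c c11 c12 c21 c22 coef_cont c_le) as [W1 [W2 [W3 W4]]].
assert (G1 := pint_grad a ep Ha Hep c11 c12 c21 c22 coef_cont c_le M_T (fun _ => 1) g gu gv q
  weight_1 Hg Hgu Hgv Hq).
assert (G2 := is_grad_mult T _ _ q _ _ _ _ Hq (is_grad_linear T q l1 l2) G1).
assert (G3 := is_grad_comp_lin T T f q (c11 0) (c12 0) (c21 0) (c22 0) (fu (P q)) (fv (P q)) Hq
  (fun p Hp => char_start_T p Hp) (Hf _ (char_start_T q Hq))).
assert (G4 := is_grad_plus T _ _ q _ _ _ _ G3 G2).
assert (G5 := is_grad_ext T _ f q _ _ Hq (fun p Hp => eq_sym (HFTC p Hp)) G4).
destruct (is_grad_unique a ep Ha Hep f q _ _ _ _ Hq (Hf q Hq) G5) as [E1 E2].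
fold (char_len q) in E1, E2. fold (len q) in E1, E2.
set (L := len q) in *.
set (I1 := pint a ep c11 c12 c21 c22 (fun _ => 1) g q) in *.
(* The rate of change of the length in the direction [e]. The derivative of [P] maps [e] to
   [e - lam * d], and the resulting term [- lam * g (P q)] is cancelled by means of [IBP]. *)
set (lam := e1 * l1 + e2 * l2).
set (dg := fun q => d1 * gu q + d2 * gv q).
set (eg := fun q => e1 * gu q + e2 * gv q) in *.
assert (Hdg : CkR2 0 T dg).
{ apply (Ck_on_plus (E := R2)); apply (Ck_on_mult (E := R2)); auto. }
assert (X : forall psi G, (forall s, continuous psi s) /\ (forall s, J s -> Rabs (psi s) <= 1) ->
  CkR2 0 T G -> is_RInt (fun s => psi s * ext a ep G (M s q)) 0 1
   (pint a ep c11 c12 c21 c22 psi G q)).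
{ intros psi G Hpsi HG. apply (RInt_correct (V := R_CompleteNormedModule)).
  apply (pint_ex a ep Ha Hep c11 c12 c21 c22 coef_cont); assumption. }
assert (Ws : (forall s, continuous (fun s => s - 1) s) /\ forall s, J s -> Rabs (s - 1) <= 1).
{ split.
  - intros s. apply (ex_derive_continuous (V := R1)). auto_derive; trivial.
  - intros s [S1 S2]. apply Rabs_le. lra. }
set (Q := pint a ep c11 c12 c21 c22 (fun s => s - 1) dg q).
(* integration by parts: [(s - 1) * g (M s q)] has derivative [h] *)
assert (IBP : I1 + L * Q = g (P q)).
{ set (h := fun s => 1 * ext a ep g (M s q) + L * ((s - 1) * ext a ep dg (M s q))).
  assert (Hh : is_RInt h 0 1 (I1 + L * Q)).
  { apply (is_RInt_plus (V := R1)); [now apply X, Hgc; apply weight_1|].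
    apply (is_RInt_scal (V := R1)). now apply X. }
  assert (Hhc : forall s, continuous h s).
  { intros s. apply (continuous_plus (V := R1)).
    - apply (pint_integrand_continuous a ep Ha Hep c11 c12 c21 c22 coef_cont (fun _ => 1)); auto.
      apply weight_1.
    - apply (continuous_scal_r (V := R1)).
      apply (pint_integrand_continuous a ep Ha Hep c11 c12 c21 c22 coef_cont (fun s => s - 1)); auto. }
  assert (HD : forall s, J s -> (s - 1) * g (M s q) + - 1 * RInt h 0 s
    = (0 - 1) * g (M 0 q) + - 1 * RInt h 0 0).
  { apply (zero_derive_const 0 1 (fun s => (s - 1) * g (M s q) + - 1 * RInt h 0 s)).
    intros s Hs.
    assert (A1 : is_derive_on J (fun s => - 1 * RInt h 0 s) s (- 1 * h s)).
    { apply is_derive_on_of; [exact Hs|]. apply is_derive_scal.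
      now apply is_derive_RInt_of_continuous. }
    assert (A2 : is_derive_on J (fun s => s - 1) s 1).
    { apply is_derive_on_of; [exact Hs|]. auto_derive; [trivial|ring]. }
    assert (A3 := char_derive_grad g gu gv Hg q Hq s Hs).
    refine (is_derive_on_ext J _ _ s _ _ Hs (fun _ _ => eq_refl) _
      (is_derive_on_plus J _ _ s _ _ (is_derive_on_mult J _ _ s _ _ Hs A2 A3) A1)).
    unfold h. rewrite !ext_T by (try assumption; now apply M_T). unfold dg, L, len, M. ring. }
  specialize (HD 1 ltac:(unfold J; lra)).
  rewrite RInt_point, (is_RInt_unique _ _ _ _ Hh) in HD.
  unfold zero in HD; simpl in HD. unfold P. fold (M 0 q). lra. }
(* The linear map [M s] sends [e] to [e + (s - 1) * lam * d]; this splits the integrand into the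
   part [eg] and the part with weight [s - 1] that occurs in [IBP]. *)
assert (Hsum : e1 * (pint a ep c11 c12 c21 c22 (fun s => 1 * c11 s) gu q +
     pint a ep c11 c12 c21 c22 (fun s => 1 * c21 s) gv q) +
   e2 * (pint a ep c11 c12 c21 c22 (fun s => 1 * c12 s) gu q +
     pint a ep c11 c12 c21 c22 (fun s => 1 * c22 s) gv q) =
   pint a ep c11 c12 c21 c22 (fun _ => 1) eg q + lam * Q).
{ assert (W1' := fun psi H => weight_mult (fun _ => 1) psi weight_1 H).
  refine (eq_trans (eq_sym (is_RInt_unique _ _ _ _
    (is_RInt_plus (V := R1) _ _ _ _ _ _
      (is_RInt_scal (V := R1) _ _ _ e1 _
        (is_RInt_plus (V := R1) _ _ _ _ _ _
          (X _ gu (W1' c11 W1) Hgu) (X _ gv (W1' c21 W3) Hgv)))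
      (is_RInt_scal (V := R1) _ _ _ e2 _
        (is_RInt_plus (V := R1) _ _ _ _ _ _
          (X _ gu (W1' c12 W2) Hgu) (X _ gv (W1' c22 W4) Hgv)))))) _).
  refine (eq_trans _ (is_RInt_unique _ _ _ _
    (is_RInt_plus (V := R1) _ _ _ _ _ _ (X (fun _ => 1) eg weight_1 Hegc)
      (is_RInt_scal (V := R1) _ _ _ lam _ (X (fun s => s - 1) dg Ws Hdg))))).
  apply RInt_ext. intros s Hs. rewrite Rmin_left, Rmax_right in Hs by lra.
  assert (Hs' : J s) by (unfold J; lra).
  rewrite !ext_T by (try assumption; now apply M_T).
  unfold plus, scal; simpl; unfold mult; simpl.
  unfold eg, dg, lam, c11, c12, c21, c22. ring. }
unfold char_int. fold (len q). fold L.
rewrite E1, E2.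
transitivity (e1 * (c11 0 * fu (P q) + c21 0 * fv (P q)) + e2 * (c12 0 * fu (P q) + c22 0 * fv (P q))
  + lam * I1 + L * (pint a ep c11 c12 c21 c22 (fun _ => 1) eg q + lam * Q)).
{ rewrite <- Hsum. unfold lam, L, len, char_len. ring. }
rewrite Rplus_assoc.
replace (lam * I1 + L * (pint a ep c11 c12 c21 c22 (fun _ => 1) eg q + lam * Q)) with
 (lam * g (P q) + L * pint a ep c11 c12 c21 c22 (fun _ => 1) eg q)
  by (rewrite <- IBP; ring).
unfold g, lam, c11, c12, c21, c22. ring.
Qed.

End Characteristics.

(** * Linear systems with reflection at both edges *)

Lemma Ck_on_id n (I : R -> Prop) : CkR n I (fun u => u).
Proof. apply (Ck_on_linear (E := R1)), is_linear_id. Qed.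

Lemma Ck_on_scal_id n (I : R -> Prop) c : CkR n I (fun u => c * u).
Proof.
apply (Ck_on_mult (E := R1));
  [apply (Ck_on_const (E := R1)) | apply Ck_on_id].
Qed.

Lemma Ck_on_comp_fst n (D : R * R -> Prop) (I : R -> Prop) f : (forall q, D q -> I (fst q)) ->
  CkR n I f -> CkR2 n D (fun q => f (fst q)).
Proof. intros H Hf. apply (Ck_on_comp1 (E := R2) n D I fst f H Hf). apply Ck_on_fst. Qed.

Lemma Ck_on_comp_snd n (D : R * R -> Prop) (I : R -> Prop) f : (forall q, D q -> I (snd q)) ->
  CkR n I f -> CkR2 n D (fun q => f (snd q)).
Proof. intros H Hf. apply (Ck_on_comp1 (E := R2) n D I snd f H Hf). apply Ck_on_snd. Qed.

Section Triangle2.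
Variables a ep : R.
Hypothesis (Ha : 0 < a < 1) (Hep : 0 < ep).
Let T := T_dom a ep.

Lemma T_dom_diag u : 0 <= u <= a * ep -> T (u, u).
Proof. intros H. apply T_dom_iff; auto. repeat split; nra. Qed.

Lemma T_dom_edge v : 0 <= v <= ep -> T (a * v, v).
Proof. intros H. apply T_dom_iff; auto. repeat split; nra. Qed.

Lemma Ck_on_diag n f : CkR2 n T f ->
  CkR n (fun u => 0 <= u <= a * ep) (fun u => f (u, u)).
Proof.
intros Hf.
apply (Ck_on_comp2 (E := R1) n _ T (fun u => u) (fun u => u) f);
  auto using T_dom_diag, Ck_on_id.
Qed.

Lemma Ck_on_edge n f : CkR2 n T f ->
  CkR n (fun v => 0 <= v <= ep) (fun v => f (a * v, v)).
Proof.
intros Hf.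
apply (Ck_on_comp2 (E := R1) n _ T (fun u => a * u) (fun u => u) f);
  auto using T_dom_edge, Ck_on_id, Ck_on_scal_id.
Qed.

(** For [v]: direction [(0, 1)], length [v - u], starting point on the diagonal. For [u]: direction
    [(1, 0)], length [u - a * v], starting point on the edge [u = a * v]. *)
Definition v_int := char_int a ep 0 1 (-1) 1.
Definition u_int := char_int a ep 1 0 1 (- a).
Definition v_derive := char_derive a ep 0 1 (-1) 1.
Definition u_derive := char_derive a ep 1 0 1 (- a).

Lemma v_pt s q : char_pt 0 1 (-1) 1 s q = (fst q, (1 - s) * fst q + s * snd q).
Proof. unfold char_pt. f_equal; ring. Qed.

Lemma u_pt s q : char_pt 1 0 1 (- a) s q = (s * fst q + (1 - s) * (a * snd q), snd q).
Proof. unfold char_pt. f_equal; ring. Qed.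

Lemma T_dom_fst q : T q -> 0 <= fst q <= a * ep.
Proof. destruct q. unfold T. rewrite T_dom_iff by auto. simpl; tauto. Qed.

Lemma T_dom_snd q : T q -> 0 <= snd q <= ep.
Proof. destruct q. unfold T. rewrite T_dom_iff by auto. simpl; nra. Qed.

Lemma v_pt_T s q : 0 <= s <= 1 -> T q -> T (char_pt 0 1 (-1) 1 s q).
Proof.
intros Hs Hq. rewrite v_pt.
replace (_, _) with (fst q + (fst q - fst q) * s, fst q + (snd q - fst q) * s)
  by (f_equal; ring).
exact (T_dom_convex a ep Ha (fst q, fst q) q s (T_dom_diag _ (T_dom_fst q Hq)) Hq Hs).
Qed.

Lemma u_pt_T s q : 0 <= s <= 1 -> T q -> T (char_pt 1 0 1 (- a) s q).
Proof.
intros Hs Hq. rewrite u_pt.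
replace (_, _) with (a * snd q + (fst q - a * snd q) * s, snd q + (snd q - snd q) * s)
  by (f_equal; ring).
exact (T_dom_convex a ep Ha (a * snd q, snd q) q s (T_dom_edge _ (T_dom_snd q Hq)) Hq Hs).
Qed.

Lemma v_coef_le s : 0 <= s <= 1 -> Rabs (1 + (s - 1) * (-1 * 0)) <= 1 /\
  Rabs ((s - 1) * (1 * 0)) <= 1 /\ Rabs ((s - 1) * (-1 * 1)) <= 1 /\
  Rabs (1 + (s - 1) * (1 * 1)) <= 1.
Proof. intros H. repeat split; apply Rabs_le; lra. Qed.

Lemma u_coef_le s : 0 <= s <= 1 -> Rabs (1 + (s - 1) * (1 * 1)) <= 1 /\
  Rabs ((s - 1) * (- a * 1)) <= 1 /\ Rabs ((s - 1) * (1 * 0)) <= 1 /\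
  Rabs (1 + (s - 1) * (- a * 0)) <= 1.
Proof. intros H. repeat split; apply Rabs_le; nra. Qed.

Lemma Ck_on_v_int n g : CkR2 n T g -> CkR2 n T (v_int g).
Proof. exact (Ck_on_char_int a ep Ha Hep 0 1 (-1) 1 v_coef_le v_pt_T n g). Qed.

Lemma Ck_on_u_int n g : CkR2 n T g -> CkR2 n T (u_int g).
Proof. exact (Ck_on_char_int a ep Ha Hep 1 0 1 (- a) u_coef_le u_pt_T n g). Qed.

Lemma v_linear_ode l S Z : CkR2 0 T l -> CkR2 0 T S ->
  v_derive Z (fun q => l q * Z q + S q) ->
  forall q, T q -> Z q = exp (v_int l q) *
    (Z (fst q, fst q) + v_int (fun q => exp (- v_int l q) * S q) q).
Proof.
intros Hl HS HZ q Hq.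
rewrite (char_linear_ode a ep Ha Hep 0 1 (-1) 1 ltac:(ring) v_coef_le v_pt_T l S Z Hl HS HZ q Hq).
rewrite v_pt. unfold v_int. do 2 f_equal. f_equal. f_equal. ring.
Qed.

Lemma u_linear_ode l S W : CkR2 0 T l -> CkR2 0 T S ->
  u_derive W (fun q => l q * W q + S q) ->
  forall q, T q -> W q = exp (u_int l q) *
    (W (a * snd q, snd q) + u_int (fun q => exp (- u_int l q) * S q) q).
Proof.
intros Hl HS HZ q Hq.
rewrite (char_linear_ode a ep Ha Hep 1 0 1 (- a) ltac:(ring) u_coef_le u_pt_T l S W Hl HS HZ q Hq).
rewrite u_pt. unfold u_int. do 2 f_equal. f_equal. f_equal. ring.
Qed.

(** Amplification factor of one round trip diagonal, edge, diagonal along characteristics. *)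
Definition round_trip (l1 l2 : R * R -> R) (phi1 phi2 : R -> R) (u : R) : R :=
  phi1 u * exp (u_int l2 (u, u)) * (phi2 u * exp (v_int l1 (a * u, u))).

Lemma Ck_on_exp n (D : R * R -> Prop) f :
  CkR2 n D f -> CkR2 n D (fun q => exp (f q)).
Proof.
intros Hf. apply (Ck_on_comp1 (E := R2) n D (fun _ => True) f exp); auto.
apply Ck_on_exp_R.
Qed.

Lemma Ck_on_round_trip n l1 l2 phi1 phi2 :
  CkR2 n T l1 -> CkR2 n T l2 ->
  CkR n (fun u => 0 <= u <= a * ep) phi1 ->
  CkR n (fun v => 0 <= v <= ep) phi2 ->
  CkR n (fun u => 0 <= u <= a * ep) (round_trip l1 l2 phi1 phi2).
Proof.
intros Hl1 Hl2 H1 H2.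
assert (Hsub : forall u, 0 <= u <= a * ep -> 0 <= u <= ep) by (intros; nra).
apply (Ck_on_mult (E := R1)); apply (Ck_on_mult (E := R1)).
- exact H1.
- apply (Ck_on_diag n (fun q => exp (u_int l2 q))). now apply Ck_on_exp, Ck_on_u_int.
- exact (Ck_on_subset (E := R1) _ _ _ _ Hsub H2).
- apply (Ck_on_subset (E := R1) _ _ _ _ Hsub).
  apply (Ck_on_edge n (fun q => exp (v_int l1 q))). now apply Ck_on_exp, Ck_on_v_int.
Qed.

(** Everything reduces to the trace of [Z] on the diagonal. The value [W (u, u)] comes along its
    characteristic from [(a * u, u)]; there [W] is reflected from [Z], which comes along its own
    characteristic from [(a * u, a * u)]. So [Z (u, u)] obeys the functional equation with the
    round-trip factor as [kap]. Once this trace is C^n, the solution formulas and the reflection on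
    the edge give [Z] and [W] in the whole triangle. *)
Lemma linear_system_Ck n th l1 S1 l2 S2 phi1 s1 phi2 s2 Z W : 0 < th < 1 ->
  CkR2 n T l1 -> CkR2 n T S1 ->
  CkR2 n T l2 -> CkR2 n T S2 ->
  CkR n (fun u => 0 <= u <= a * ep) phi1 ->
  CkR n (fun u => 0 <= u <= a * ep) s1 ->
  CkR n (fun v => 0 <= v <= ep) phi2 ->
  CkR n (fun v => 0 <= v <= ep) s2 ->
  CkR2 0 T Z -> CkR2 0 T W ->
  v_derive Z (fun q => l1 q * Z q + S1 q) -> u_derive W (fun q => l2 q * W q + S2 q) ->
  (forall u, 0 <= u <= a * ep -> Z (u, u) = phi1 u * W (u, u) + s1 u) ->
  (forall v, 0 <= v <= ep -> W (a * v, v) = phi2 v * Z (a * v, v) + s2 v) ->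
  (forall u, 0 <= u <= a * ep -> Rabs (round_trip l1 l2 phi1 phi2 u) <= th) ->
  CkR2 n T Z /\ CkR2 n T W.
Proof.
intros Hth Hl1 HS1 Hl2 HS2 Hp1 Hs1 Hp2 Hs2 HZ HW DZ DW BZ BW Hrt.
assert (Hle : forall f, CkR2 n T f -> CkR2 0 T f).
{ intros f. apply Ck_on_le. lia. }
assert (EZ := v_linear_ode l1 S1 Z (Hle _ Hl1) (Hle _ HS1) DZ).
assert (EW := u_linear_ode l2 S2 W (Hle _ Hl2) (Hle _ HS2) DW).
set (B1 := v_int (fun q => exp (- v_int l1 q) * S1 q)) in *.
set (B2 := u_int (fun q => exp (- u_int l2 q) * S2 q)) in *.
assert (HB1 : CkR2 n T B1).
{ apply Ck_on_v_int, (Ck_on_mult (E := R2)); [|exact HS1].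
  now apply Ck_on_exp, (Ck_on_opp (E := R2)), Ck_on_v_int. }
assert (HB2 : CkR2 n T B2).
{ apply Ck_on_u_int, (Ck_on_mult (E := R2)); [|exact HS2].
  now apply Ck_on_exp, (Ck_on_opp (E := R2)), Ck_on_u_int. }
assert (HE1 : CkR2 n T (fun q => exp (v_int l1 q))).
{ now apply Ck_on_exp, Ck_on_v_int. }
assert (HE2 : CkR2 n T (fun q => exp (u_int l2 q))).
{ now apply Ck_on_exp, Ck_on_u_int. }
assert (Hsub : forall u, 0 <= u <= a * ep -> 0 <= u <= ep) by (intros; nra).
assert (Hrestr := fun f => Ck_on_subset (E := R1) n _ _ f Hsub).
assert (Hz : CkR n (fun u => 0 <= u <= a * ep) (fun u => Z (u, u))).
{ apply (functional_equation_Ck a (a * ep) th) with (kap := round_trip l1 l2 phi1 phi2)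
    (sig := fun u => phi1 u * exp (u_int l2 (u, u)) * (phi2 u * exp (v_int l1 (a * u, u)) *
       B1 (a * u, u) + s2 u + B2 (u, u)) + s1 u); auto.
  - nra.
  - now apply Ck_on_round_trip.
  - apply (Ck_on_plus (E := R1)); [|exact Hs1].
    apply (Ck_on_mult (E := R1)).
    + apply (Ck_on_mult (E := R1)); [exact Hp1|].
      exact (Ck_on_diag n _ HE2).
    + apply (Ck_on_plus (E := R1)); [|exact (Ck_on_diag n _ HB2)].
      apply (Ck_on_plus (E := R1)); [|exact (Hrestr _ Hs2)].
      apply (Ck_on_mult (E := R1)); [|exact (Hrestr _ (Ck_on_edge n _ HB1))].
      apply (Ck_on_mult (E := R1)); [exact (Hrestr _ Hp2)|].
      exact (Hrestr _ (Ck_on_edge n _ HE1)).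
  - now apply Ck_on_diag.
  - intros u Hu. pose proof (Hsub u Hu) as Hu'. unfold round_trip.
    assert (EWu : W (u, u) = exp (u_int l2 (u, u)) * (W (a * u, u) + B2 (u, u)))
      by exact (EW (u, u) (T_dom_diag u Hu)).
    assert (EZu : Z (a * u, u) = exp (v_int l1 (a * u, u)) * (Z (a * u, a * u) + B1 (a * u, u)))
      by exact (EZ (a * u, u) (T_dom_edge u Hu')).
    etransitivity; [exact (BZ u Hu)|]. rewrite EWu, (BW u Hu'), EZu.
    match goal with |- ?x = _ => change (x = phi1 u * exp (u_int l2 (u, u)) *
      (phi2 u * exp (v_int l1 (a * u, u))) * Z (a * u, a * u) +
      (phi1 u * exp (u_int l2 (u, u)) * (phi2 u * exp (v_int l1 (a * u, u)) * B1 (a * u, u) +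
      s2 u + B2 (u, u)) + s1 u)) end. ring. }
assert (HZn : CkR2 n T Z).
{ apply (Ck_on_ext (E := R2)) with
   (fun q => exp (v_int l1 q) * ((fun u => Z (u, u)) (fst q) + B1 q)).
  - intros q Hq. symmetry. exact (EZ q Hq).
  - apply (Ck_on_mult (E := R2)); [exact HE1|].
    apply (Ck_on_plus (E := R2)); [|exact HB1].
    exact (Ck_on_comp_fst n T _ _ T_dom_fst Hz). }
split; [exact HZn|].
assert (Hw : CkR n (fun v => 0 <= v <= ep) (fun v => W (a * v, v))).
{ apply (Ck_on_ext (E := R1)) with (fun v => phi2 v * Z (a * v, v) + s2 v).
  - intros v Hv. symmetry. exact (BW v Hv).
  - apply (Ck_on_plus (E := R1)); [|exact Hs2].
    apply (Ck_on_mult (E := R1)); [exact Hp2|]. now apply Ck_on_edge. }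
apply (Ck_on_ext (E := R2)) with
   (fun q => exp (u_int l2 q) * ((fun v => W (a * v, v)) (snd q) + B2 q)).
- intros q Hq. symmetry. exact (EW q Hq).
- apply (Ck_on_mult (E := R2)); [exact HE2|].
  apply (Ck_on_plus (E := R2)); [|exact HB2].
  exact (Ck_on_comp_snd n T _ _ T_dom_snd Hw).
Qed.

End Triangle2.

(** * Mixed partial derivatives *)

Section MixedPartials.
Variables a ep : R.
Hypothesis (Ha : 0 < a < 1) (Hep : 0 < ep).
Let T := T_dom a ep.

Lemma v_derive_grad f fu fv : (forall q, T q -> is_grad T f q (fu q) (fv q)) ->
  v_derive a ep f fv.
Proof.
intros H q Hq s Hs.
refine (is_derive_on_ext _ _ _ s _ _ Hs (fun _ _ => eq_refl) _
  (char_derive_grad a ep 0 1 (-1) 1 (v_pt_T a ep Ha) f fu fv H q Hq s Hs)).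
ring.
Qed.

(** A one-sided form of Schwarz's theorem: only [fv] is assumed differentiable, and that the
    continuous function [fu] has a derivative in [v] is part of the conclusion. It is the
    transversal lemma with direction [(0, 1)] and [e = (1, 0)]. *)
Lemma v_derive_partial f fu fv gu gv :
  (forall q, T q -> is_grad T f q (fu q) (fv q)) ->
  (forall q, T q -> is_grad T fv q (gu q) (gv q)) ->
  CkR2 0 T fu -> CkR2 0 T gu -> CkR2 0 T gv ->
  v_derive a ep fu gu.
Proof.
intros Hf Hg Hfu Hgu Hgv q Hq s Hs.
assert (Hfv : CkR2 0 T fv).
{ intros p Hp. exact (fderiv_continuous (E := R2) _ _ _ _ (Hg p Hp)). }
assert (Hg' : forall q, T q -> is_grad T (fun q => 0 * fu q + 1 * fv q) q (gu q) (gv q)).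
{ intros p Hp. apply (is_grad_ext T fv); auto. intros; ring. }
refine (is_derive_on_ext _ _ _ s _ _ Hs _ _
  (char_derive_transversal a ep Ha Hep 0 1 (-1) 1 ltac:(ring) v_coef_le (v_pt_T a ep Ha)
     f fu fv gu gv 1 0 Hf Hg' Hfu Hfv Hgu Hgv q Hq s Hs)).
- intros; simpl; ring. - simpl; ring.
Qed.

Lemma u_derive_partial f fu fv gu gv :
  (forall q, T q -> is_grad T f q (fu q) (fv q)) ->
  (forall q, T q -> is_grad T fu q (gu q) (gv q)) ->
  CkR2 0 T fv -> CkR2 0 T gu -> CkR2 0 T gv ->
  u_derive a ep fv gv.
Proof.
intros Hf Hg Hfv Hgu Hgv q Hq s Hs.
assert (Hfu : CkR2 0 T fu).
{ intros p Hp. exact (fderiv_continuous (E := R2) _ _ _ _ (Hg p Hp)). }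
assert (Hg' : forall q, T q -> is_grad T (fun q => 1 * fu q + 0 * fv q) q (gu q) (gv q)).
{ intros p Hp. apply (is_grad_ext T fu); auto. intros; ring. }
refine (is_derive_on_ext _ _ _ s _ _ Hs _ _
  (char_derive_transversal a ep Ha Hep 1 0 1 (- a) ltac:(ring) (u_coef_le a Ha) (u_pt_T a ep Ha)
     f fu fv gu gv 0 1 Hf Hg' Hfu Hfv Hgu Hgv q Hq s Hs)).
- intros; simpl; ring. - simpl; ring.
Qed.

Lemma T_dom_dense f g : CkR2 0 T f -> CkR2 0 T g ->
  (forall q, T q -> fst q < snd q -> f q = g q) -> forall q, T q -> f q = g q.
Proof.
intros Hf Hg H q Hq.
assert (Hd := Ck_on_minus (E := R2) 0 T f g Hf Hg).
apply Rminus_diag_uniq, (eq_of_Rabs_le _ 0). intros eps He.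
destruct (proj1 (continuous_on2_iff _ _) Hd q Hq eps He) as [d [Hd1 Hd2]].
(* [q] is moved towards the vertex [(a * ep, ep)], which satisfies [u < v] strictly. [B] exceeds
   both coordinates of the displacement and is positive even if [q] is that vertex. *)
set (B := Rabs (a * ep - fst q) + Rabs (ep - snd q) + 1).
assert (HB1 : Rabs (a * ep - fst q) < B) by (pose proof (Rabs_pos (ep - snd q)); unfold B; lra).
assert (HB2 : Rabs (ep - snd q) < B) by (pose proof (Rabs_pos (a * ep - fst q)); unfold B; lra).
assert (HB : 0 < B) by (pose proof (Rabs_pos (ep - snd q)); lra).
set (s := Rmin 1 (d / B)).
assert (Hs0 : 0 < s) by (apply Rmin_pos; [lra | now apply Rdiv_lt_0_compat]).
assert (Hs1 : s <= 1) by apply Rmin_l.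
assert (Hs2 : s * B <= d).
{ apply Rle_trans with (d / B * B); [|right; field; lra].
  apply Rmult_le_compat_r; [lra|apply Rmin_r]. }
assert (Hv : T (a * ep, ep)) by (apply T_dom_edge; lra).
assert (Hp := T_dom_convex a ep Ha q (a * ep, ep) s Hq Hv ltac:(lra)). simpl fst in Hp.
simpl snd in Hp.
assert (Hlt : fst q <= snd q).
{ destruct q. unfold T in Hq. rewrite T_dom_iff in Hq by auto. simpl; tauto. }
set (p := (fst q + (a * ep - fst q) * s, snd q + (ep - snd q) * s)) in *.
assert (Ep : f p = g p).
{ apply H; [exact Hp|]. unfold p; simpl.
  assert (0 < (ep - a * ep) * s) by (apply Rmult_lt_0_compat; nra).
  assert (0 <= (snd q - fst q) * (1 - s)) by (apply Rmult_le_pos; lra). nra. }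
assert (Hc : Rabs ((f p - g p) - (f q - g q)) < eps).
{ apply (Hd2 p Hp); unfold p; simpl.
  - replace (fst q + (a * ep - fst q) * s - fst q) with ((a * ep - fst q) * s) by ring.
    rewrite Rabs_mult, (Rabs_pos_eq s) by lra. nra.
  - replace (snd q + (ep - snd q) * s - snd q) with ((ep - snd q) * s) by ring.
    rewrite Rabs_mult, (Rabs_pos_eq s) by lra. nra. }
rewrite Ep in Hc. replace (g p - g p - (f q - g q)) with (- (f q - g q - 0)) in Hc by ring.
rewrite Rabs_Ropp in Hc. lra.
Qed.

(** Both sides are derivatives of [fu] along the [v]-characteristic, up to the common factor
    [v - u]. The factor cancels off the diagonal, and density covers the diagonal. *)
Lemma mixed_partials f fu fv fuu fuv fvu fvv :
  (forall q, T q -> is_grad T f q (fu q) (fv q)) ->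
  (forall q, T q -> is_grad T fu q (fuu q) (fuv q)) ->
  (forall q, T q -> is_grad T fv q (fvu q) (fvv q)) ->
  CkR2 0 T fuv -> CkR2 0 T fvu -> CkR2 0 T fvv ->
  forall q, T q -> fuv q = fvu q.
Proof.
intros Hf Hu Hv Huv Hvu Hvv. apply T_dom_dense; [exact Huv | exact Hvu|].
intros q Hq Hlt.
assert (Hfu : CkR2 0 T fu).
{ intros p Hp. exact (fderiv_continuous (E := R2) _ _ _ _ (Hu p Hp)). }
assert (D1 := v_derive_grad fu fuu fuv Hu q Hq 1 ltac:(lra)).
assert (D2 := v_derive_partial f fu fv fvu fvv Hf Hv Hfu Hvu Hvv q Hq 1 ltac:(lra)).
assert (E := is_derive_on_unique 0 1 _ 1 _ _ ltac:(lra) ltac:(lra) D1 D2).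
rewrite v_pt in E. replace (_, _) with q in E.
- apply Rmult_eq_reg_l with (snd q - fst q); [unfold char_len in E; lra | lra].
- destruct q; simpl; f_equal; ring.
Qed.

End MixedPartials.

(** * Density and sound speed as smooth functions of the enthalpy *)

Lemma is_derive_of_on (D : R -> Prop) f x l : open D -> D x ->
  is_derive_on D f x l -> is_derive f x l.
Proof.
intros HD Hx. 
apply (filterdiff_filter_le (U := R1) (V := R1) (within D (locally x)) (locally x) f _ x).
- apply locally_filter.
- intros P HP; exact HP.
- intros P HP. unfold within in HP.
  generalize (filter_and _ _ HP (HD x Hx)). apply filter_imp. intuition.
- apply (within_filter_lim (E := R1)).
Qed.

Lemma Ck_on_Derive n (D : R -> Prop) f : open D ->
  CkR (S n) D f -> CkR n D (Derive f).
Proof.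
intros HD Hf. destruct (Ck_on_derive _ _ _ Hf) as [f' [H1 H2]].
apply (Ck_on_ext (E := R1)) with f'; [|exact H2].
intros x Hx. symmetry. apply is_derive_unique. apply is_derive_of_on with D; auto.
Qed.

Section Fluid.
Variable F : fluid.

Lemma eta_pos s : 0 < s -> 0 < eta F s.
Proof. intros Hs. apply sqrt_lt_R0, (pressure_incr F s Hs). Qed.

Lemma eta_sqr s : 0 < s -> eta F s * eta F s = Derive (pressure F) s.
Proof. intros Hs. apply sqrt_sqrt, Rlt_le, (pressure_incr F s Hs). Qed.

Lemma Ck_on_eta n : CkR n (fun s => 0 < s) (eta F).
Proof.
apply (Ck_on_comp1 (E := R1) n _ (fun x => 0 < x) (Derive (pressure F)) sqrt).
- exact (pressure_incr F).
- apply Ck_on_sqrt_R.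
- apply Ck_on_Derive; [apply open_gt | apply (pressure_smooth F)].
Qed.

Lemma Ck_on_continuous (D : R -> Prop) f x : open D -> D x ->
  CkR 0 D f -> continuous f x.
Proof.
intros HD Hx Hf P HP.
assert (H := Hf x Hx P HP). unfold filtermap, within in H.
refine (filter_imp (F := locally x) _ _ _ (filter_and _ _ H (HD x Hx))). intuition.
Qed.

Lemma enthalpy_derive s : 0 < s -> is_derive (enthalpy_int F) s (eta F s / s).
Proof.
intros Hs.
assert (Hc : forall y, 0 < y -> continuous (fun s => eta F s / s) y).
{ intros y Hy. apply Ck_on_continuous with (fun s => 0 < s); [apply open_gt | exact Hy|].
  apply (Ck_on_div (E := R1)).
  - intros; lra. - apply Ck_on_eta. - apply Ck_on_id. }
apply (is_derive_RInt (V := R1) (fun s => eta F s / s) _ (rho_ref F)); [|auto].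
apply filter_imp with (2 := open_gt 0 s Hs). intros y Hy.
apply (RInt_correct (V := R_CompleteNormedModule)).
apply (ex_RInt_continuous (V := R_CompleteNormedModule)).
intros z [Hz _]. apply Hc. pose proof (rho_ref_pos F).
eapply Rlt_le_trans; [|exact Hz]. now apply Rmin_pos.
Qed.

Lemma enthalpy_increasing s t : 0 < s -> s < t -> enthalpy_int F s < enthalpy_int F t.
Proof.
intros Hs Hst.
apply (incr_function (enthalpy_int F) 0 p_infty (fun s => eta F s / s)); simpl; auto.
- intros x Hx _. now apply enthalpy_derive.
- intros x Hx _. apply Rdiv_lt_0_compat; [now apply eta_pos | exact Hx].
Qed.

Lemma enthalpy_injective s t : 0 < s -> 0 < t -> enthalpy_int F s = enthalpy_int F t -> s = t.
Proof.
intros Hs Ht E. destruct (Rtotal_order s t) as [H|[H|H]]; [|exact H|].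
- pose proof (enthalpy_increasing s t Hs H). lra.
- pose proof (enthalpy_increasing t s Ht H). lra.
Qed.

(** The choice in [state_of] is determined on the image: the enthalpy integral is strictly
    increasing, so half the sum of the invariants fixes the density, and half their difference is
    the velocity. *)
Lemma state_of_eq al be s : is_state F al be s -> state_of F al be = s.
Proof.
intros H. assert (H' : is_state F al be (state_of F al be)).
{ apply (epsilon_spec (inhabits (1, 0)) (is_state F al be)). now exists s. }
destruct H as [H1 [H2 H3]], H' as [H1' [H2' H3']].
unfold riem_alpha, riem_beta in *.
destruct (state_of F al be) as [r w], s as [r' w']; simpl in *.
assert (r = r') by (apply enthalpy_injective; lra). subst r'. f_equal. lra.
Qed.

Lemma rho_of_riem rho w : 0 < rho -> rho_of F (riem_alpha F rho w) (riem_beta F rho w) = rho.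
Proof.
intros H. unfold rho_of. rewrite (state_of_eq _ _ (rho, w)); [reflexivity|]. now split.
Qed.

Lemma w_of_riem rho w : 0 < rho -> w_of F (riem_alpha F rho w) (riem_beta F rho w) = w.
Proof.
intros H. unfold w_of. rewrite (state_of_eq _ _ (rho, w)); [reflexivity|]. now split.
Qed.

Definition enthalpy_range (h : R) : Prop := exists rho, 0 < rho /\ enthalpy_int F rho = h.
(** The inverse of the enthalpy integral: a fluid at rest has both Riemann invariants equal to its
    enthalpy. *)
Definition rho_h (h : R) : R := rho_of F h h.
Definition eta_h (h : R) : R := eta F (rho_h h).
(** The chain rule for [eta_h], the density having derivative [rho / eta] in the enthalpy. *)
Definition eta_h' (h : R) : R := Derive (eta F) (rho_h h) * (rho_h h / eta_h h).

Lemma rho_h_eq rho : 0 < rho -> rho_h (enthalpy_int F rho) = rho.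
Proof.
intros H. generalize (rho_of_riem rho 0 H). unfold riem_alpha, riem_beta, rho_h.
now rewrite Rplus_0_r, Rminus_0_r.
Qed.

Lemma rho_h_pos h : enthalpy_range h -> 0 < rho_h h.
Proof. intros [rho [H <-]]. now rewrite rho_h_eq. Qed.

Lemma enthalpy_rho_h h : enthalpy_range h -> enthalpy_int F (rho_h h) = h.
Proof. intros [rho [H <-]]. now rewrite rho_h_eq. Qed.

Lemma eta_h_pos h : enthalpy_range h -> 0 < eta_h h.
Proof. intros H. now apply eta_pos, rho_h_pos. Qed.

Lemma in_image_range al be : in_image F al be -> enthalpy_range ((al + be) / 2).
Proof.
intros [[rho w] [H1 [H2 H3]]]. unfold riem_alpha, riem_beta in *; simpl in *.
exists rho. split; [exact H1|]. lra.
Qed.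

Lemma rho_of_h al be : in_image F al be -> rho_of F al be = rho_h ((al + be) / 2).
Proof.
intros [[rho w] [H1 [H2 H3]]]. simpl in *. rewrite <- H2, <- H3, rho_of_riem by exact H1.
unfold riem_alpha, riem_beta. replace (_ / 2) with (enthalpy_int F rho) by field.
now rewrite rho_h_eq.
Qed.

Lemma w_of_h al be : in_image F al be -> w_of F al be = (al - be) / 2.
Proof.
intros [[rho w] [H1 [H2 H3]]]. simpl in *. rewrite <- H2, <- H3, w_of_riem by exact H1.
unfold riem_alpha, riem_beta. field.
Qed.

(** Monotonicity alone: the enthalpies at densities [rho_h h - e] and [rho_h h + e] enclose [h], and
    whatever lies between them has its density in between. *)
Lemma rho_h_continuous h : enthalpy_range h -> forall eps, 0 < eps -> exists d, 0 < d /\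
  forall y, enthalpy_range y -> Rabs (y - h) < d -> Rabs (rho_h y - rho_h h) < eps.
Proof.
intros Hh eps He. pose proof (rho_h_pos h Hh) as Hr.
set (e := Rmin eps (rho_h h / 2)).
assert (e0 : 0 < e) by (apply Rmin_pos; lra).
assert (e1 : e <= eps) by apply Rmin_l.
assert (e2 : e <= rho_h h / 2) by apply Rmin_r.
pose proof (enthalpy_increasing (rho_h h - e) (rho_h h) ltac:(lra) ltac:(lra)) as M1.
pose proof (enthalpy_increasing (rho_h h) (rho_h h + e) ltac:(lra) ltac:(lra)) as M2.
rewrite enthalpy_rho_h in M1, M2 by exact Hh.
set (d := Rmin (h - enthalpy_int F (rho_h h - e)) (enthalpy_int F (rho_h h + e) - h)).
assert (d1 : d <= h - enthalpy_int F (rho_h h - e)) by apply Rmin_l.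
assert (d2 : d <= enthalpy_int F (rho_h h + e) - h) by apply Rmin_r.
exists d. split; [apply Rmin_pos; lra|].
intros y Hy Hyh. apply Rabs_def2 in Hyh. pose proof (rho_h_pos y Hy) as Hry.
pose proof (enthalpy_rho_h y Hy) as Ey.
apply Rabs_def1.
- destruct (Rlt_dec (rho_h y) (rho_h h + e)); [lra|].
  destruct (Req_dec (rho_h y) (rho_h h + e)) as [E|N]; [rewrite E in Ey; lra|].
  pose proof (enthalpy_increasing (rho_h h + e) (rho_h y) ltac:(lra) ltac:(lra)). lra.
- destruct (Rlt_dec (rho_h h - e) (rho_h y)); [lra|].
  destruct (Req_dec (rho_h y) (rho_h h - e)) as [E|N]; [rewrite E in Ey; lra|].
  pose proof (enthalpy_increasing (rho_h y) (rho_h h - e) ltac:(lra) ltac:(lra)). lra.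
Qed.

Lemma rho_h_derive h : enthalpy_range h ->
  is_derive_on enthalpy_range rho_h h (rho_h h / eta_h h).
Proof.
intros Hh. pose proof (rho_h_pos h Hh) as Hr. pose proof (eta_h_pos h Hh) as He'.
apply is_derive_on_iff; [exact Hh|]. intros eps He.
set (k := eta_h h / rho_h h).
assert (Hk : 0 < k) by now apply Rdiv_lt_0_compat.
assert (HD : is_derive_on (fun s => 0 < s) (enthalpy_int F) (rho_h h) k).
{ apply is_derive_on_of; [exact Hr|]. now apply enthalpy_derive. }
rewrite is_derive_on_iff in HD by exact Hr.
(* Accuracy [k / 2] gives [k * Rabs x <= 2 * Rabs z]; accuracy [eps * k * k / 2], divided by [k] and
   combined with that bound, gives [eps * Rabs z]. *)
set (m := Rmin (k / 2) (eps * k * k / 2)).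
assert (m0 : 0 < m) by (apply Rmin_pos; [lra | apply Rdiv_lt_0_compat; [|lra];
  exact (Rmult_lt_0_compat _ _ (Rmult_lt_0_compat _ _ He Hk) Hk)]).
assert (m1 : m <= k / 2) by apply Rmin_l.
assert (m2 : m <= eps * k * k / 2) by apply Rmin_r.
destruct (HD m m0) as [d1 [D1 D1']].
destruct (rho_h_continuous h Hh d1 D1) as [d [Hd Hd']].
exists d. split; [exact Hd|]. intros y Hy Hyh.
specialize (D1' (rho_h y) (rho_h_pos y Hy) (Hd' y Hy Hyh)).
rewrite !enthalpy_rho_h in D1' by assumption.
set (x := rho_h y - rho_h h) in *. set (z := y - h) in *.
assert (B : k * Rabs x <= 2 * Rabs z).
{ assert (Rabs (k * x) <= Rabs z + Rabs (z - k * x)).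
  { replace (k * x) with (z - (z - k * x)) at 1 by ring.
    eapply Rle_trans; [apply Rabs_triang|]. rewrite Rabs_Ropp. lra. }
  rewrite Rabs_mult, (Rabs_pos_eq k) in H by lra. pose proof (Rabs_pos x). nra. }
replace (rho_h h / eta_h h) with (/ k) by (unfold k; field; split; lra).
replace (x - / k * z) with (- / k * (z - k * x)) by (field; lra).
rewrite Rabs_mult, Rabs_Ropp, (Rabs_pos_eq (/ k)) by (apply Rlt_le, Rinv_0_lt_compat; lra).
apply Rmult_le_reg_l with k; [exact Hk|].
rewrite <- Rmult_assoc, Rinv_r, Rmult_1_l by lra.
eapply Rle_trans; [exact D1'|].
apply Rle_trans with (eps * k * k / 2 * Rabs x).
- apply Rmult_le_compat_r; [apply Rabs_pos | exact m2].
- replace (eps * k * k / 2 * Rabs x) with (eps * k / 2 * (k * Rabs x)) by field.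
  replace (k * (eps * Rabs z)) with (eps * k / 2 * (2 * Rabs z)) by field.
  apply Rmult_le_compat_l; [|exact B]. apply Rdiv_le_0_compat; [|lra]. nra.
Qed.

(** Bootstrap on the differential equation [rho_h' = rho_h / eta (rho_h)], whose right-hand side is
    as regular as [rho_h]. *)
Lemma Ck_on_rho_h n : CkR n enthalpy_range rho_h.
Proof.
induction n as [|n IH].
- intros h Hh. exact (fderiv_continuous (E := R1) _ _ _ _ (rho_h_derive h Hh)).
- apply Ck_on_of_derive with (fun h => rho_h h / eta_h h); [exact rho_h_derive|].
  apply (Ck_on_div (E := R1)); [|exact IH|].
  + intros h Hh. apply Rgt_not_eq, eta_h_pos, Hh.
  + exact (Ck_on_comp1 (E := R1) n _ _ rho_h (eta F) rho_h_pos (Ck_on_eta n) IH).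
Qed.

Lemma Ck_on_eta_h n : CkR n enthalpy_range eta_h.
Proof.
exact (Ck_on_comp1 (E := R1) n _ _ rho_h (eta F) rho_h_pos (Ck_on_eta n)
  (Ck_on_rho_h n)).
Qed.

Lemma Ck_on_eta_h' n : CkR n enthalpy_range eta_h'.
Proof.
apply (Ck_on_mult (E := R1)).
- apply (Ck_on_comp1 (E := R1) n _ (fun s => 0 < s) rho_h (Derive (eta F)) rho_h_pos);
    [|apply Ck_on_rho_h].
  apply Ck_on_Derive; [apply open_gt | apply Ck_on_eta].
- apply (Ck_on_div (E := R1)); auto using Ck_on_rho_h, Ck_on_eta_h.
  intros h Hh. apply Rgt_not_eq, eta_h_pos, Hh.
Qed.

Lemma eta_h_derive h : enthalpy_range h -> is_derive_on enthalpy_range eta_h h (eta_h' h).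
Proof.
intros Hh.
apply (is_derive_on_comp _ (fun s => 0 < s) rho_h (eta F)); auto using rho_h_pos, rho_h_derive.
pose proof (rho_h_pos h Hh) as Hr.
destruct (Ck_on_derive _ _ _ (Ck_on_eta 1)) as [f' [H1 _]].
specialize (H1 _ Hr).
rewrite (is_derive_unique _ _ _ (is_derive_of_on _ _ _ _ (open_gt 0) Hr H1)). exact H1.
Qed.

Lemma pressure_derive s : 0 < s -> is_derive (pressure F) s (eta F s * eta F s).
Proof.
intros Hs. rewrite eta_sqr by exact Hs.
destruct (Ck_on_derive _ _ _ (pressure_smooth F 1%nat)) as [f' [H1 _]].
specialize (H1 _ Hs). assert (H2 := is_derive_of_on _ _ _ _ (open_gt 0) Hs H1).
now rewrite (is_derive_unique _ _ _ H2).
Qed.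

End Fluid.

(** * Gain of one derivative *)

(** Follows sums and products and leaves the gradient to unification; the leaves come from gradients
    in the context. Differences have to be presented as sums with a factor -1, which accounts for
    such forms below. *)
Ltac grad_tac Hq :=
  lazymatch goal with
  | |- is_grad ?D (fun p => @?f p + @?g p) ?q _ _ =>
      eapply (is_grad_plus D f g q); grad_tac Hq
  | |- is_grad ?D (fun p => @?f p * @?g p) ?q _ _ =>
      eapply (is_grad_mult D f g q _ _ _ _ Hq); grad_tac Hq
  | |- is_grad ?D (fun _ => ?c) ?q _ _ => exact (is_grad_const D q c)
  | |- is_grad _ (fun p => ?f p) _ _ _ =>
      match goal with H : is_grad _ f _ _ _ |- _ => exact H end
  | |- is_grad _ ?f _ _ _ => match goal with H : is_grad _ f _ _ _ |- _ => exact H end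
  end.

Ltac Ck_tac :=
  repeat first
    [ assumption
    | apply (Ck_on_plus (E := R2))
    | apply (Ck_on_minus (E := R2))
    | apply (Ck_on_mult (E := R2))
    | apply (Ck_on_opp (E := R2))
    | apply (Ck_on_const (E := R2)) ].

Ltac Ck1_tac :=
  repeat first
    [ assumption
    | apply (Ck_on_plus (E := R1))
    | apply (Ck_on_minus (E := R1))
    | apply (Ck_on_mult (E := R1))
    | apply (Ck_on_opp (E := R1))
    | apply (Ck_on_const (E := R1)) ].

Section TransportPair.
Variables a ep : R.
Hypothesis (Ha : 0 < a < 1) (Hep : 0 < ep).
Let T := T_dom a ep.

Lemma is_derive_on_diag f fu fv u : 0 <= u <= a * ep -> is_grad T f (u, u) fu fv ->
  is_derive_on (fun u => 0 <= u <= a * ep) (fun u => f (u, u)) u (fu + fv).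
Proof.
intros Hu Hf.
refine (is_derive_on_ext _ _ _ u _ _ Hu (fun _ _ => eq_refl) _
  (is_derive_on_curve _ T f (fun u => u) (fun u => u) u 1 1 fu fv Hu _ _ _ Hf)).
- ring.
- intros y Hy. now apply T_dom_diag.
- apply is_derive_on_of; [exact Hu | apply (is_derive_id (K := R_AbsRing))].
- apply is_derive_on_of; [exact Hu | apply (is_derive_id (K := R_AbsRing))].
Qed.

Lemma is_derive_on_edge f fu fv v : 0 <= v <= ep -> is_grad T f (a * v, v) fu fv ->
  is_derive_on (fun v => 0 <= v <= ep) (fun v => f (a * v, v)) v (a * fu + fv).
Proof.
intros Hv Hf.
refine (is_derive_on_ext _ _ _ v _ _ Hv (fun _ _ => eq_refl) _
  (is_derive_on_curve _ T f (fun v => a * v) (fun v => v) v a 1 fu fv Hv _ _ _ Hf)).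
- ring.
- intros y Hy. now apply T_dom_edge.
- apply is_derive_on_of; [exact Hv | auto_derive; [trivial | ring]].
- apply is_derive_on_of; [exact Hv | apply (is_derive_id (K := R_AbsRing))].
Qed.

(** [Mu] satisfies [(Mu)_v = (G1)_u = l1 * Mu + S1], and [Nv] the analogous equation in [u]. The
    boundary relations are differentiated along the tangents [(1, 1)] and [(a, 1)]: the first gives
    the reflection coefficient [- b1], the second gives [- (a * b2)], as the tangent of the edge
    takes only the fraction [a] of [Mu]. Here [b1], [b2], [psi1], [psi2] must have one derivative
    more than the conclusion, because their derivatives enter. *)
Lemma transport_pair_Ck k th M N Mu Nv G1 G2 l1 S1 l2 S2 b1 b2 psi1 psi2 : (1 <= k)%nat ->
  0 < th < 1 ->
  (forall q, T q -> is_grad T M q (Mu q) (G1 q)) ->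
  (forall q, T q -> is_grad T N q (G2 q) (Nv q)) ->
  CkR2 0 T Mu -> CkR2 0 T Nv ->
  CkR2 k T M -> CkR2 k T N ->
  CkR2 k T G1 -> CkR2 k T G2 ->
  (forall q, T q -> exists c, is_grad T G1 q (l1 q * Mu q + S1 q) c) ->
  (forall q, T q -> exists c, is_grad T G2 q c (l2 q * Nv q + S2 q)) ->
  CkR2 k T l1 -> CkR2 k T S1 ->
  CkR2 k T l2 -> CkR2 k T S2 ->
  CkR (S k) (fun u => 0 <= u <= a * ep) b1 ->
  CkR (S k) (fun u => 0 <= u <= a * ep) psi1 ->
  CkR (S k) (fun v => 0 <= v <= ep) b2 ->
  CkR (S k) (fun v => 0 <= v <= ep) psi2 ->
  (forall u, 0 <= u <= a * ep -> M (u, u) + b1 u * N (u, u) = psi1 u) ->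
  (forall v, 0 <= v <= ep -> N (a * v, v) + b2 v * M (a * v, v) = psi2 v) ->
  (forall u, 0 <= u <= a * ep ->
    Rabs (round_trip a ep l1 l2 (fun u => - b1 u) (fun v => - (a * b2 v)) u) <= th) ->
  CkR2 k T Mu /\ CkR2 k T Nv.
Proof.
intros Hk Hth HM HN HMu HNv CM CN CG1 CG2 HG1 HG2 Cl1 CS1 Cl2 CS2 Cb1 Cp1 Cb2 Cp2 B1 B2 Hrt.
assert (Hle : forall f, CkR2 k T f -> CkR2 1 T f).
{ intros f. now apply Ck_on_le. }
assert (DZ : v_derive a ep Mu (fun q => l1 q * Mu q + S1 q)).
{ destruct (Ck_on_grad _ _ _ (Hle _ CG1)) as [gu [gv [E1 [E2 E3]]]].
  assert (D := v_derive_partial a ep Ha Hep M Mu G1 gu gv HM E1 HMu E2 E3).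
  intros q Hq s Hs.
  refine (is_derive_on_ext _ _ _ s _ _ Hs (fun _ _ => eq_refl) _ (D q Hq s Hs)).
  f_equal. assert (Hp := v_pt_T a ep Ha s q Hs Hq).
  destruct (HG1 _ Hp) as [c Hc].
  exact (proj1 (is_grad_unique a ep Ha Hep G1 _ _ _ _ _ Hp (E1 _ Hp) Hc)). }
assert (DW : u_derive a ep Nv (fun q => l2 q * Nv q + S2 q)).
{ destruct (Ck_on_grad _ _ _ (Hle _ CG2)) as [gu [gv [E1 [E2 E3]]]].
  assert (D := u_derive_partial a ep Ha Hep N G2 Nv gu gv HN E1 HNv E2 E3).
  intros q Hq s Hs.
  refine (is_derive_on_ext _ _ _ s _ _ Hs (fun _ _ => eq_refl) _ (D q Hq s Hs)).
  f_equal. assert (Hp := u_pt_T a ep Ha s q Hs Hq).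
  destruct (HG2 _ Hp) as [c Hc].
  exact (proj2 (is_grad_unique a ep Ha Hep G2 _ _ _ _ _ Hp (E1 _ Hp) Hc)). }
pose proof (Ck_on_S _ _ _ Cb1) as Cb1k. pose proof (Ck_on_S _ _ _ Cb2) as Cb2k.
destruct (Ck_on_derive _ _ _ Cb1) as [b1' [Db1 Cb1']].
destruct (Ck_on_derive _ _ _ Cb2) as [b2' [Db2 Cb2']].
destruct (Ck_on_derive _ _ _ Cp1) as [psi1' [Dp1 Cp1']].
destruct (Ck_on_derive _ _ _ Cp2) as [psi2' [Dp2 Cp2']].
apply (linear_system_Ck a ep Ha Hep k th l1 S1 l2 S2 (fun u => - b1 u)
  (fun u : R => psi1' u - G1 (u, u) - b1' u * N (u, u) - b1 u * G2 (u, u))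
  (fun v => - (a * b2 v))
  (fun v : R => psi2' v - a * G2 (a * v, v) - b2' v * M (a * v, v) - b2 v * G1 (a * v, v)));
  auto.
- Ck1_tac.
- pose proof (Ck_on_diag a ep Ha k _ CG1). pose proof (Ck_on_diag a ep Ha k _ CG2).
  pose proof (Ck_on_diag a ep Ha k _ CN). Ck1_tac.
- Ck1_tac.
- pose proof (Ck_on_edge a ep Ha k _ CG1). pose proof (Ck_on_edge a ep Ha k _ CG2).
  pose proof (Ck_on_edge a ep Ha k _ CM). Ck1_tac.
- intros u Hu.
  assert (D := is_derive_on_plus _ _ _ u _ _
    (is_derive_on_diag M _ _ u Hu (HM _ (T_dom_diag a ep Ha u Hu)))
    (is_derive_on_mult _ _ _ u _ _ Hu (Db1 u Hu)
      (is_derive_on_diag N _ _ u Hu (HN _ (T_dom_diag a ep Ha u Hu))))).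
  assert (D' := is_derive_on_ext _ _ psi1 u _ _ Hu B1 eq_refl D).
  assert (E := is_derive_on_unique 0 (a * ep) psi1 u _ _ ltac:(nra) Hu D' (Dp1 u Hu)).
  rewrite <- E. ring.
- intros v Hv.
  assert (D := is_derive_on_plus _ _ _ v _ _
    (is_derive_on_edge N _ _ v Hv (HN _ (T_dom_edge a ep Ha v Hv)))
    (is_derive_on_mult _ _ _ v _ _ Hv (Db2 v Hv)
      (is_derive_on_edge M _ _ v Hv (HM _ (T_dom_edge a ep Ha v Hv))))).
  assert (D' := is_derive_on_ext _ _ psi2 v _ _ Hv B2 eq_refl D).
  assert (E := is_derive_on_unique 0 ep psi2 v _ _ Hep Hv D' (Dp2 v Hv)).
  rewrite <- E. ring.
Qed.

End TransportPair.

Section Gain.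
Variables a ep : R.
Hypothesis (Ha : 0 < a < 1) (Hep : 0 < ep).
Let T := T_dom a ep.
Variables x y m n xu yv mu nv k0 k1 p0 p1 p2 q0 q1 q2 : R * R -> R.

Definition cross_coef (q : R * R) : R := k0 q - k1 q * (m q + n q).
Definition quad_m (q : R * R) : R := p0 q + p1 q * m q + p2 q * n q + k1 q * (m q * (m q + n q)).
Definition quad_n (q : R * R) : R := q0 q + q1 q * n q + q2 q * m q + k1 q * (n q * (m q + n q)).
Let K := cross_coef. Let N1 := quad_m. Let N2 := quad_n.
(** The coefficient of [mu] in the [u]-derivative of [y * N1]: [y] times the partial derivative of
    the quadratic polynomial in [m]. *)
Definition lin_m (q : R * R) : R := y q * (p1 q + k1 q * (2 * m q + n q)).
Definition lin_n (q : R * R) : R := x q * (q1 q + k1 q * (2 * n q + m q)).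

Hypothesis Hx : forall q, T q -> is_grad T x q (xu q) (x q * y q * K q).
Hypothesis Hy : forall q, T q -> is_grad T y q (x q * y q * K q) (yv q).
Hypothesis Hm : forall q, T q -> is_grad T m q (mu q) (y q * N1 q).
Hypothesis Hn : forall q, T q -> is_grad T n q (x q * N2 q) (nv q).
Hypothesis Cxu : CkR2 0 T xu.
Hypothesis Cyv : CkR2 0 T yv.
Hypothesis Cmu : CkR2 0 T mu.
Hypothesis Cnv : CkR2 0 T nv.
Variables b1 b2 psi1 psi2 c1 c2 : R -> R.
Hypothesis Bm1 : forall u, 0 <= u <= a * ep -> m (u, u) + b1 u * n (u, u) = psi1 u.
Hypothesis Bm2 : forall v, 0 <= v <= ep -> n (a * v, v) + b2 v * m (a * v, v) = psi2 v.
Hypothesis Bx1 : forall u, 0 <= u <= a * ep -> x (u, u) + c1 u * y (u, u) = 0.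
Hypothesis Bx2 : forall v, 0 <= v <= ep -> y (a * v, v) + c2 v * x (a * v, v) = 0.
Variable th : R.
Hypothesis Hth : 0 < th < 1.
Hypothesis Rm : forall u, 0 <= u <= a * ep ->
  Rabs (round_trip a ep lin_m lin_n (fun u => - b1 u) (fun v => - (a * b2 v)) u) <= th.
Hypothesis Rx : forall u, 0 <= u <= a * ep ->
  Rabs (round_trip a ep (fun q => y q * K q) (fun q => x q * K q)
    (fun u => - c1 u) (fun v => - (a * c2 v)) u) <= th.

(** In the [u]-derivative of [y * N1] all derivatives except [mu] are given by the equations, such
    as [y_u = x * y * K] and [n_u = x * N2], or fall on the coefficients; so the pair [(m, n)]
    closes by itself. The [u]-derivative of [x * y * K] contains [mu] through [K], hence [(x, y)]
    comes second, when [mu] and [nv] are already C^k. *)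
Lemma regularity_gain k : (1 <= k)%nat ->
  CkR2 k T x -> CkR2 k T y ->
  CkR2 k T m -> CkR2 k T n ->
  CkR2 (S k) T k0 -> CkR2 (S k) T k1 ->
  CkR2 (S k) T p0 -> CkR2 (S k) T p1 -> CkR2 (S k) T p2 ->
  CkR2 (S k) T q0 -> CkR2 (S k) T q1 -> CkR2 (S k) T q2 ->
  CkR (S k) (fun u => 0 <= u <= a * ep) b1 ->
  CkR (S k) (fun u => 0 <= u <= a * ep) psi1 ->
  CkR (S k) (fun u => 0 <= u <= a * ep) c1 ->
  CkR (S k) (fun v => 0 <= v <= ep) b2 ->
  CkR (S k) (fun v => 0 <= v <= ep) psi2 ->
  CkR (S k) (fun v => 0 <= v <= ep) c2 ->
  CkR2 (S k) T x /\ CkR2 (S k) T y /\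
  CkR2 (S k) T m /\ CkR2 (S k) T n.
Proof.
intros Hk Cx Cy Cm Cn Ck0 Ck1 Cp0 Cp1 Cp2 Cq0 Cq1 Cq2 Cb1 Cpsi1 Cc1 Cb2 Cpsi2 Cc2.
assert (Dk0 := Ck_on_S _ _ _ Ck0). assert (Dk1 := Ck_on_S _ _ _ Ck1).
assert (Dp0 := Ck_on_S _ _ _ Cp0). assert (Dp1 := Ck_on_S _ _ _ Cp1).
assert (Dp2 := Ck_on_S _ _ _ Cp2). assert (Dq0 := Ck_on_S _ _ _ Cq0).
assert (Dq1 := Ck_on_S _ _ _ Cq1). assert (Dq2 := Ck_on_S _ _ _ Cq2).
destruct (Ck_on_grad _ _ _ Ck0) as [k0u [k0v [Gk0 [Ck0u Ck0v]]]].
destruct (Ck_on_grad _ _ _ Ck1) as [k1u [k1v [Gk1 [Ck1u Ck1v]]]].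
destruct (Ck_on_grad _ _ _ Cp0) as [p0u [p0v [Gp0 [Cp0u Cp0v]]]].
destruct (Ck_on_grad _ _ _ Cp1) as [p1u [p1v [Gp1 [Cp1u Cp1v]]]].
destruct (Ck_on_grad _ _ _ Cp2) as [p2u [p2v [Gp2 [Cp2u Cp2v]]]].
destruct (Ck_on_grad _ _ _ Cq0) as [q0u [q0v [Gq0 [Cq0u Cq0v]]]].
destruct (Ck_on_grad _ _ _ Cq1) as [q1u [q1v [Gq1 [Cq1u Cq1v]]]].
destruct (Ck_on_grad _ _ _ Cq2) as [q2u [q2v [Gq2 [Cq2u Cq2v]]]].
assert (CK : CkR2 k T K) by (unfold K, cross_coef; Ck_tac).
assert (CN1 : CkR2 k T N1) by (unfold N1, quad_m; Ck_tac).
assert (CN2 : CkR2 k T N2) by (unfold N2, quad_n; Ck_tac).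
assert (CG1 : CkR2 k T (fun q => y q * N1 q)) by Ck_tac.
assert (CG2 : CkR2 k T (fun q => x q * N2 q)) by Ck_tac.
assert (Hmn : CkR2 k T mu /\ CkR2 k T nv).
{ apply (transport_pair_Ck a ep Ha Hep k th m n mu nv (fun q => y q * N1 q)
   (fun q => x q * N2 q)
   lin_m (fun q => x q * y q * K q * N1 q + y q * (p0u q + p1u q * m q + p2u q * n q +
      p2 q * (x q * N2 q) + k1u q * (m q * (m q + n q)) + k1 q * m q * (x q * N2 q)))
   lin_n (fun q => x q * y q * K q * N2 q + x q * (q0v q + q1v q * n q + q2v q * m q +
      q2 q * (y q * N1 q) + k1v q * (n q * (m q + n q)) + k1 q * n q * (y q * N1 q)))
   b1 b2 psi1 psi2); auto.
  - intros q Hq. specialize (Hy q Hq). specialize (Hm q Hq). specialize (Hn q Hq).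
    specialize (Gp0 q Hq). specialize (Gp1 q Hq). specialize (Gp2 q Hq). specialize (Gk1 q Hq).
    eexists. eapply is_grad_eq; [unfold N1, quad_m; grad_tac Hq | | reflexivity].
    unfold lin_m, N1, quad_m. ring.
  - intros q Hq. specialize (Hx q Hq). specialize (Hm q Hq). specialize (Hn q Hq).
    specialize (Gq0 q Hq). specialize (Gq1 q Hq). specialize (Gq2 q Hq). specialize (Gk1 q Hq).
    eexists. eapply is_grad_eq; [unfold N2, quad_n; grad_tac Hq | reflexivity |].
    unfold lin_n, N2, quad_n. ring.
  - unfold lin_m. Ck_tac.
  - Ck_tac.
  - unfold lin_n. Ck_tac.
  - Ck_tac. }
destruct Hmn as [Cmuk Cnvk].
assert (CG : CkR2 k T (fun q => x q * y q * K q)) by Ck_tac.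
assert (Hxy : CkR2 k T xu /\ CkR2 k T yv).
{ apply (transport_pair_Ck a ep Ha Hep k th x y xu yv (fun q => x q * y q * K q)
   (fun q => x q * y q * K q)
   (fun q => y q * K q) (fun q => x q * (x q * y q * K q * K q +
      y q * (k0u q - k1u q * (m q + n q) - k1 q * (mu q + x q * N2 q))))
   (fun q => x q * K q) (fun q => y q * (x q * y q * K q * K q +
      x q * (k0v q - k1v q * (m q + n q) - k1 q * (y q * N1 q + nv q))))
   c1 c2 (fun _ => 0) (fun _ => 0)); auto.
  - intros q Hq. specialize (Hx q Hq). specialize (Hy q Hq).
    specialize (Hm q Hq). specialize (Hn q Hq).
    specialize (Gk0 q Hq). specialize (Gk1 q Hq).
    assert (GK : is_grad T K q (k0u q - k1u q * (m q + n q) - k1 q * (mu q + x q * N2 q))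
       (k0v q - k1v q * (m q + n q) - k1 q * (y q * N1 q + nv q))).
    { apply (is_grad_ext T (fun q => k0 q + (-1) * (k1 q * (m q + n q)))); auto.
      - intros; unfold K, cross_coef; ring.
      - eapply is_grad_eq; [grad_tac Hq | ring | ring]. }
    eexists. eapply is_grad_eq; [grad_tac Hq | | reflexivity]. ring.
  - intros q Hq. specialize (Hx q Hq). specialize (Hy q Hq).
    specialize (Hm q Hq). specialize (Hn q Hq).
    specialize (Gk0 q Hq). specialize (Gk1 q Hq).
    assert (GK : is_grad T K q (k0u q - k1u q * (m q + n q) - k1 q * (mu q + x q * N2 q))
       (k0v q - k1v q * (m q + n q) - k1 q * (y q * N1 q + nv q))).
    { apply (is_grad_ext T (fun q => k0 q + (-1) * (k1 q * (m q + n q)))); auto.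
      - intros; unfold K, cross_coef; ring.
      - eapply is_grad_eq; [grad_tac Hq | ring | ring]. }
    eexists. eapply is_grad_eq; [grad_tac Hq | reflexivity |]. ring.
  - Ck_tac.
  - Ck_tac.
  - Ck_tac.
  - Ck_tac.
  - apply (Ck_on_const (E := R1)).
  - apply (Ck_on_const (E := R1)). }
destruct Hxy as [Cxuk Cyvk].
split; [|split; [|split]].
- exact (Ck_on_of_grad k T x _ _ Hx Cxuk CG).
- exact (Ck_on_of_grad k T y _ _ Hy CG Cyvk).
- exact (Ck_on_of_grad k T m _ _ Hm Cmuk CG1).
- exact (Ck_on_of_grad k T n _ _ Hn CG2 Cnvk).
Qed.

End Gain.

(** * The equations in characteristic coordinates *)

Section Flow.
Variable F : fluid.
Variables a ep : R.
Hypothesis (Ha : 0 < a < 1) (Hep : 0 < ep).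
Let T := T_dom a ep.
Variables al be t r x y m n : R * R -> R.

Definition enth (q : R * R) : R := (al q + be q) / 2.
Definition vel (q : R * R) : R := (al q - be q) / 2.
Definition sound (q : R * R) : R := eta_h F (enth q).
Definition dsound (q : R * R) : R := eta_h' F (enth q).
Definition speed_in (q : R * R) : R := vel q - sound q.
Definition speed_out (q : R * R) : R := vel q + sound q.
Definition source (q : R * R) : R := - (2 * sound q * vel q / r q).

(** These three are the partial derivatives of [source] in [alpha], [beta] and [r]; [enth] has both
    partial derivatives 1/2, [vel] has 1/2 and -1/2. *)
Definition source_al (q : R * R) : R := - ((dsound q * vel q + sound q) / r q).
Definition source_be (q : R * R) : R := - ((dsound q * vel q - sound q) / r q).
Definition source_r (q : R * R) : R := - (source q / r q).

(** Equating the mixed derivatives of [r] gives [2 * sound * x_v = (c_in)_v * x - (c_out)_u * y].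
    Divided by [2 * sound * x * y], the right-hand side is affine in [m + n], with constant term
    [coef_k0] and slope [- coef_k1]. *)
Definition coef_k0 (q : R * R) : R := (1 - dsound q) * source q / (2 * sound q).
Definition coef_k1 (q : R * R) : R := (1 + dsound q) / (4 * sound q).
(** The mixed derivatives of [alpha] give [m_v = y * (A_u / x + (A - m) * K)] with [A] the source;
    these are its coefficients as a polynomial in [m], [n], and those with [q] are the analogue for
    [beta]. The quadratic part [k1 * m * (m + n)] comes from [- m * K]. *)
Definition coef_p0 (q : R * R) : R :=
  source_be q * source q + source_r q * speed_in q + source q * coef_k0 q.
Definition coef_p1 (q : R * R) : R := source_al q - coef_k0 q - source q * coef_k1 q.
Definition coef_q0 (q : R * R) : R :=
  source_al q * source q + source_r q * speed_out q + source q * coef_k0 q.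
Definition coef_q1 (q : R * R) : R := source_be q - coef_k0 q - source q * coef_k1 q.
Definition coef_2 (q : R * R) : R := - (source q * coef_k1 q).

Hypothesis Hrange : forall q, T q -> enthalpy_range F (enth q).
Hypothesis Hr : forall q, T q -> 0 < r q.

Lemma sound_pos q : T q -> 0 < sound q.
Proof. intros Hq. now apply eta_h_pos, Hrange. Qed.

Section Level.
Variable k : nat.
Hypothesis Cal : CkR2 k T al.
Hypothesis Cbe : CkR2 k T be.
Hypothesis Cr : CkR2 k T r.

Lemma Ck_on_vel : CkR2 k T vel.
Proof. unfold vel. unfold Rdiv. Ck_tac. Qed.
Lemma Ck_on_enth : CkR2 k T enth.
Proof. unfold enth. unfold Rdiv. Ck_tac. Qed.
Lemma Ck_on_sound : CkR2 k T sound.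
Proof.
exact (Ck_on_comp1 (E := R2) k T _ enth (eta_h F) Hrange (Ck_on_eta_h F k) Ck_on_enth).
Qed.
Lemma Ck_on_dsound : CkR2 k T dsound.
Proof.
exact (Ck_on_comp1 (E := R2) k T _ enth (eta_h' F) Hrange (Ck_on_eta_h' F k) Ck_on_enth).
Qed.
Lemma Ck_on_speed_in : CkR2 k T speed_in.
Proof. pose proof Ck_on_vel. pose proof Ck_on_sound. unfold speed_in. Ck_tac. Qed.
Lemma Ck_on_speed_out : CkR2 k T speed_out.
Proof. pose proof Ck_on_vel. pose proof Ck_on_sound. unfold speed_out. Ck_tac. Qed.
Lemma Ck_on_inv_r : CkR2 k T (fun q => / r q).
Proof. apply (Ck_on_inv (E := R2)); [|exact Cr]. intros q Hq. apply Rgt_not_eq, Hr, Hq. Qed.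
Lemma Ck_on_source : CkR2 k T source.
Proof.
pose proof Ck_on_vel. pose proof Ck_on_sound. pose proof Ck_on_inv_r.
unfold source, Rdiv. Ck_tac.
Qed.

Lemma Ck_on_coefs :
  CkR2 k T coef_k0 /\ CkR2 k T coef_k1 /\
  CkR2 k T coef_p0 /\ CkR2 k T coef_p1 /\
  CkR2 k T coef_q0 /\ CkR2 k T coef_q1 /\
  CkR2 k T coef_2.
Proof.
pose proof Ck_on_vel. pose proof Ck_on_sound. pose proof Ck_on_dsound.
pose proof Ck_on_inv_r. pose proof Ck_on_source.
pose proof Ck_on_speed_in. pose proof Ck_on_speed_out.
assert (forall c, 0 < c -> CkR2 k T (fun q => / (c * sound q))).
{ intros c Hc. apply (Ck_on_inv (E := R2)); [|Ck_tac]. intros q Hq.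
  pose proof (sound_pos q Hq). apply Rgt_not_eq, Rmult_lt_0_compat; assumption. }
pose proof (H6 2 ltac:(lra)). pose proof (H6 4 ltac:(lra)).
assert (CkR2 k T coef_k0) by (unfold coef_k0, Rdiv; Ck_tac).
assert (CkR2 k T coef_k1) by (unfold coef_k1, Rdiv; Ck_tac).
repeat split; unfold coef_p0, coef_p1, coef_q0, coef_q1, coef_2, source_al, source_be,
  source_r, Rdiv; try assumption; Ck_tac.
Qed.

End Level.

Hypothesis Gt : forall q, T q -> is_grad T t q (x q) (y q).
Hypothesis Gr : forall q, T q -> is_grad T r q (speed_in q * x q) (speed_out q * y q).
Hypothesis Gal : forall q, T q -> is_grad T al q (m q * x q) (source q * y q).
Hypothesis Gbe : forall q, T q -> is_grad T be q (source q * x q) (n q * y q).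

(** The gradients contain [al], [be], [r] through the speeds and the source, so regularity is
    climbed one order at a time, up to [S k], where that of [x], [y], [m], [n] is exhausted. *)
Lemma state_Ck k :
  CkR2 k T x -> CkR2 k T y ->
  CkR2 k T m -> CkR2 k T n ->
  CkR2 (S k) T t /\ CkR2 (S k) T r /\
  CkR2 (S k) T al /\ CkR2 (S k) T be.
Proof.
intros Cx Cy Cm Cn.
assert (H : forall j, (j <= S k)%nat ->
  CkR2 j T t /\ CkR2 j T r /\
  CkR2 j T al /\ CkR2 j T be); [|now apply H].
induction j as [|j IH]; intros Hj.
- split; [|split; [|split]]; intros q Hq.
  + exact (fderiv_continuous (E := R2) _ _ _ _ (Gt q Hq)).
  + exact (fderiv_continuous (E := R2) _ _ _ _ (Gr q Hq)).
  + exact (fderiv_continuous (E := R2) _ _ _ _ (Gal q Hq)).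
  + exact (fderiv_continuous (E := R2) _ _ _ _ (Gbe q Hq)).
- destruct (IH ltac:(lia)) as [Ct [Cr [Cal Cbe]]].
  assert (Hle : forall f, CkR2 k T f -> CkR2 j T f).
  { intros f. apply Ck_on_le. lia. }
  apply Hle in Cx, Cy, Cm, Cn.
  pose proof (Ck_on_speed_in j Cal Cbe). pose proof (Ck_on_speed_out j Cal Cbe).
  pose proof (Ck_on_source j Cal Cbe Cr).
  split; [|split; [|split]].
  + exact (Ck_on_of_grad j T t _ _ Gt Cx Cy).
  + apply (Ck_on_of_grad j T r _ _ Gr); Ck_tac.
  + apply (Ck_on_of_grad j T al _ _ Gal); Ck_tac.
  + apply (Ck_on_of_grad j T be _ _ Gbe); Ck_tac.
Qed.

Lemma mixed_partials_eq f fu fv q c1 c c' c2 :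
  (forall q, T q -> is_grad T f q (fu q) (fv q)) ->
  CkR2 1 T fu -> CkR2 1 T fv -> T q ->
  is_grad T fu q c1 c -> is_grad T fv q c' c2 -> c = c'.
Proof.
intros Hf Hu Hv Hq H1 H2.
destruct (Ck_on_grad _ _ _ Hu) as [g1 [g2 [G [C1 C2]]]].
destruct (Ck_on_grad _ _ _ Hv) as [g3 [g4 [G' [C3 C4]]]].
rewrite (proj2 (is_grad_unique a ep Ha Hep _ _ _ _ _ _ Hq H1 (G q Hq))).
rewrite (proj1 (is_grad_unique a ep Ha Hep _ _ _ _ _ _ Hq H2 (G' q Hq))).
apply (mixed_partials a ep Ha Hep f fu fv g1 g2 g3 g4); auto.
Qed.

Lemma sound_grad q : T q -> is_grad T sound q
  (dsound q * ((m q * x q + source q * x q) / 2))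
  (dsound q * ((source q * y q + n q * y q) / 2)).
Proof.
intros Hq. apply (is_grad_comp1 T (enthalpy_range F) enth); auto.
- pose proof (Gal q Hq). pose proof (Gbe q Hq). unfold enth, Rdiv.
  eapply is_grad_eq; [grad_tac Hq | ring | ring].
- apply eta_h_derive. now apply Hrange.
Qed.

Lemma vel_grad q : T q -> is_grad T vel q
  ((m q * x q - source q * x q) / 2) ((source q * y q - n q * y q) / 2).
Proof.
intros Hq. pose proof (Gal q Hq). pose proof (Gbe q Hq).
apply (is_grad_ext T (fun q => / 2 * al q + (- / 2) * be q)); auto.
- intros; unfold vel; field.
- eapply is_grad_eq; [grad_tac Hq | field | field].
Qed.

Lemma source_grad q : T q -> is_grad T source q
  (source_al q * (m q * x q) + source_be q * (source q * x q)
    + source_r q * (speed_in q * x q))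
  (source_al q * (source q * y q) + source_be q * (n q * y q)
    + source_r q * (speed_out q * y q)).
Proof.
intros Hq. pose proof (sound_grad q Hq) as G1. pose proof (vel_grad q Hq) as G2.
assert (G3 : is_grad T (fun q => / r q) q (- (/ r q * / r q) * (speed_in q * x q))
  (- (/ r q * / r q) * (speed_out q * y q))).
{ apply (is_grad_comp1 T (fun x => x <> 0) r Rinv); auto.
  - intros p Hp. apply Rgt_not_eq, Hr, Hp.
  - assert (r q <> 0) by (apply Rgt_not_eq, Hr, Hq).
    apply is_derive_on_of; [assumption|]. auto_derive; [assumption|]. field. assumption. }
assert (r q <> 0) by (apply Rgt_not_eq, Hr, Hq).
apply (is_grad_ext T (fun q => -2 * (sound q * vel q * / r q))); auto.
- intros; unfold source, Rdiv; ring.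
- eapply is_grad_eq; [grad_tac Hq | |];
  (* The fourth occurrence is the one inside [source_r]; the others are derivatives of [al] and [be]
     and remain opaque. *)
  unfold source_al, source_be, source_r; unfold source at 4; field; assumption.
Qed.

Variables xu xv yu yv mu mv nu nv : R * R -> R.
Hypothesis Gx : forall q, T q -> is_grad T x q (xu q) (xv q).
Hypothesis Gy : forall q, T q -> is_grad T y q (yu q) (yv q).
Hypothesis Gm : forall q, T q -> is_grad T m q (mu q) (mv q).
Hypothesis Gn : forall q, T q -> is_grad T n q (nu q) (nv q).
Hypothesis Cx : CkR2 1 T x.
Hypothesis Cy : CkR2 1 T y.
Hypothesis Cm : CkR2 1 T m.
Hypothesis Cn : CkR2 1 T n.
Hypothesis Hx : forall q, T q -> x q <> 0.
Hypothesis Hy : forall q, T q -> y q <> 0.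

Let KK := cross_coef m n coef_k0 coef_k1.

(** The mixed derivatives of [t] give [xv = yu]; those of [r] are then a linear equation for the
    common value, with coefficient [speed_out - speed_in], twice the sound speed and therefore
    positive. *)
Lemma cross_derivatives q : T q ->
  xv q = x q * y q * KK q /\ yu q = x q * y q * KK q.
Proof.
intros Hq.
assert (CC := state_Ck 1 Cx Cy Cm Cn). destruct CC as [Ct [Cr [Cal Cbe]]].
apply Ck_on_S in Cal, Cbe, Cr.
pose proof (Ck_on_speed_in 1 Cal Cbe). pose proof (Ck_on_speed_out 1 Cal Cbe).
assert (E1 : xv q = yu q).
{ exact (mixed_partials_eq t x y q _ _ _ _ Gt Cx Cy Hq (Gx q Hq) (Gy q Hq)). }
pose proof (sound_grad q Hq) as G1. pose proof (vel_grad q Hq) as G2.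
pose proof (Gx q Hq) as G3. pose proof (Gy q Hq) as G4.
assert (G5 : is_grad T speed_in q
   ((m q * x q - source q * x q) / 2 - dsound q * ((m q * x q + source q * x q) / 2))
   ((source q * y q - n q * y q) / 2 - dsound q * ((source q * y q + n q * y q) / 2))).
{ apply (is_grad_ext T (fun q => vel q + -1 * sound q)); auto.
  - intros; unfold speed_in; ring.
  - eapply is_grad_eq; [grad_tac Hq | ring | ring]. }
assert (G6 : is_grad T speed_out q
   ((m q * x q - source q * x q) / 2 + dsound q * ((m q * x q + source q * x q) / 2))
   ((source q * y q - n q * y q) / 2 + dsound q * ((source q * y q + n q * y q) / 2))).
{ unfold speed_out. grad_tac Hq. }
assert (E2 := mixed_partials_eq r (fun q => speed_in q * x q) (fun q => speed_out q * y q) q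
   _ _ _ _ Gr ltac:(Ck_tac) ltac:(Ck_tac) Hq
   (is_grad_mult T _ _ q _ _ _ _ Hq G5 G3) (is_grad_mult T _ _ q _ _ _ _ Hq G6 G4)).
assert (Hs := sound_pos q Hq).
assert (E3 : xv q = x q * y q * KK q); [|rewrite <- E1; auto].
rewrite <- E1 in E2. unfold KK, cross_coef, coef_k0, coef_k1.
apply Rmult_eq_reg_l with (2 * sound q); [|lra].
transitivity (speed_out q * xv q - speed_in q * xv q);
  [unfold speed_out, speed_in; ring|].
replace (speed_out q * xv q - speed_in q * xv q) with
  (((source q * y q - n q * y q) / 2 - dsound q * ((source q * y q + n q * y q) / 2)) * x q -
   ((m q * x q - source q * x q) / 2 + dsound q * ((m q * x q + source q * x q) / 2)) * y q)
  by lra.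
field. lra.
Qed.

(** The mixed derivatives of [al] and [be], with [xv] and [yu] replaced by their known values, are
    solved for [mv] and [nu] by dividing by [x] and [y]. *)
Lemma quad_derivatives q : T q ->
  mv q = y q * quad_m m n coef_k1 coef_p0 coef_p1 coef_2 q /\
  nu q = x q * quad_n m n coef_k1 coef_q0 coef_q1 coef_2 q.
Proof.
intros Hq.
assert (CC := state_Ck 1 Cx Cy Cm Cn). destruct CC as [Ct [Cr [Cal Cbe]]].
apply Ck_on_S in Cal, Cbe, Cr.
pose proof (Ck_on_source 1 Cal Cbe Cr).
destruct (cross_derivatives q Hq) as [E1 E2].
pose proof (source_grad q Hq) as G1.
pose proof (Gx q Hq) as G3. pose proof (Gy q Hq) as G4.
pose proof (Gm q Hq) as G5. pose proof (Gn q Hq) as G6.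
assert (E3 := mixed_partials_eq al (fun q => m q * x q) (fun q => source q * y q) q
   _ _ _ _ Gal ltac:(Ck_tac) ltac:(Ck_tac) Hq
   (is_grad_mult T _ _ q _ _ _ _ Hq G5 G3) (is_grad_mult T _ _ q _ _ _ _ Hq G1 G4)).
assert (E4 := mixed_partials_eq be (fun q => source q * x q) (fun q => n q * y q) q
   _ _ _ _ Gbe ltac:(Ck_tac) ltac:(Ck_tac) Hq
   (is_grad_mult T _ _ q _ _ _ _ Hq G1 G3) (is_grad_mult T _ _ q _ _ _ _ Hq G6 G4)).
rewrite E1, E2 in *. unfold KK, cross_coef in *.
unfold quad_m, quad_n, coef_p0, coef_p1, coef_q0, coef_q1, coef_2.
split.
- apply Rmult_eq_reg_r with (x q); [|now apply Hx]. lra.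
- apply Rmult_eq_reg_r with (y q); [|now apply Hy]. lra.
Qed.

End Flow.

(** * Reflection at the shocks *)

(** The last two hypotheses are [J = 0] and its derivative along the shock, primes denoting
    derivatives; [P] and [M] stand for momentum flux and momentum. *)
Lemma jump_derivative_algebra (b x y m n A rho w e V rhom wm em rt wt pp pm al' be' t' : R) :
  e <> 0 -> rho <> 0 -> x <> 0 -> b <> 0 -> rho - rhom <> 0 -> w + e - V <> 0 ->
  let g := (V - (w - e)) / (w + e - V) in
  let Psi := 2 * V * (rt * wm + rhom * wt) - (rt * wm * wm + 2 * rhom * wm * wt + em * em * rt)
     - V * V * rt in
  y = b * g * x ->
  al' = b * (m * x) + A * y -> be' = b * (A * x) + n * y -> t' = b * x + y ->
  (rho - rhom) * V = rho * w - rhom * wm ->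
  (rho * w - rhom * wm) * (rho * w - rhom * wm) -
    ((rho * w * w + pp) - (rhom * wm * wm + pm)) * (rho - rhom) = 0 ->
  let rho' := rho / e * ((al' + be') / 2) in let w' := (al' - be') / 2 in
  let rhom' := rt * t' in let wm' := wt * t' in
  let M' := (rho' * w + rho * w') - (rhom' * wm + rhom * wm') in
  let P' := (rho' * w * w + 2 * rho * w * w' + e * e * rho') -
    (rhom' * wm * wm + 2 * rhom * wm * wm' + em * em * rhom') in
  2 * (rho * w - rhom * wm) * M' - (P' * (rho - rhom) +
    ((rho * w * w + pp) - (rhom * wm * wm + pm)) * (rho' - rhom')) = 0 ->
  m + g ^ 3 * n = - ((1 + g) * Psi * (2 * e) / (rho * (w + e - V) ^ 2)) - A * g - A * g * g.
Proof.
intros He Hrho Hx Hb HR Hc g Psi Hy Hal Hbe Ht HV HJ rho' w' rhom' wm' M' P' HD.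
set (c := w + e - V) in *. set (R := rho - rhom) in *.
(* [J = 0] divided by the density jump: with [V] defined by the mass balance, this is the momentum
   balance. *)
assert (HP : (rho * w * w + pp) - (rhom * wm * wm + pm) = V * V * R).
{ apply Rmult_eq_reg_r with R; [|exact HR]. rewrite <- HV in HJ. lra. }
rewrite HP, <- HV in HD.
assert (E : 2 * V * M' - P' - V * V * (rho' - rhom') = 0).
{ apply Rmult_eq_reg_l with R; [|exact HR]. rewrite Rmult_0_r, <- HD. ring. }
assert (Hg : V = w - e + g * c) by (unfold g; field; exact Hc).
(* The state behind enters through squares: [al'] has the factor [(c_out - V)^2] and [be'] the
   factor [(V - c_in)^2], of quotient [g^2]. The third power of [g] in the conclusion arises from
   [be'] containing [n * y] with [y = b * g * x]. [Psi] collects the contribution of the state ahead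
   per unit of [t']. *)
assert (Hsum : t' * Psi = - (rho / (2 * e)) * (al' * (c * c) + be' * (g * c * (g * c)))).
{ assert (E2 : 2 * V * (rho' * w + rho * w') - (rho' * w * w + 2 * rho * w * w' + e * e * rho')
     - V * V * rho' = - (rho / (2 * e)) * (al' * (c * c) + be' * (g * c * (g * c)))).
  { replace (g * c) with (V - (w - e)) by lra. unfold rho', w', c. field. exact He. }
  rewrite <- E2. unfold M', P', rhom', wm' in E. unfold Psi. lra. }
apply Rmult_eq_reg_l with (b * x * (rho / (2 * e) * (c * c))).
2:{ repeat apply Rmult_integral_contrapositive_currified; try assumption.
  apply Rinv_neq_0_compat. lra. }
transitivity (- (t' * Psi) - b * x * (rho / (2 * e) * (c * c)) * (A * g + A * g * g)).
- rewrite Hsum, Hal, Hbe, Hy. unfold Rdiv. ring.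
- rewrite Ht, Hy. field. repeat split; assumption.
Qed.

Section Boundary.
Variable F : fluid.
Variables a ep : R.
Hypothesis (Ha : 0 < a < 1) (Hep : 0 < ep).
Let T := T_dom a ep.
Variables al be t r x y m n : R * R -> R.
Hypothesis Himage : forall q, T q -> in_image F (al q) (be q).
Hypothesis Hr : forall q, T q -> 0 < r q.
Hypothesis Gt : forall q, T q -> is_grad T t q (x q) (y q).
Hypothesis Gr : forall q, T q ->
  is_grad T r q (speed_in F al be q * x q) (speed_out F al be q * y q).
Hypothesis Gal : forall q, T q -> is_grad T al q (m q * x q) (source F al be r q * y q).
Hypothesis Gbe : forall q, T q -> is_grad T be q (source F al be r q * x q) (n q * y q).
Hypothesis Hx : forall q, T q -> x q <> 0.

Variable St : ahead.
Variable D : R * R -> Prop.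
Hypothesis rho_a_smooth : smooth_on D (rho_a St).
Hypothesis w_a_smooth : smooth_on D (w_a St).
Hypothesis rho_a_pos : forall p, D p -> 0 < rho_a St p.
Variables b L : R.
Hypothesis Hb : b <> 0.
Hypothesis HL : 0 < L.
Let I (s : R) := 0 <= s <= L.
Hypothesis curve_T : forall s, I s -> T (b * s, s).
Let c (s : R) : R * R := (b * s, s).
Let pos (s : R) : R * R := (t (c s), r (c s)).
Hypothesis curve_D : forall s, I s -> D (pos s).

Definition shock_at (q : R * R) : R := speed_at F St al be t r q.
Definition shock_ratio (q : R * R) : R :=
  (shock_at q - speed_in F al be q) / (speed_out F al be q - shock_at q).
Let V (s : R) := shock_at (c s).
Let g (s : R) := shock_ratio (c s).
Hypothesis jump_rho : forall s, I s -> rho_h F (enth al be (c s)) <> rho_a St (pos s).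
Hypothesis lax : forall s, I s -> speed_out F al be (c s) - V s <> 0.
Hypothesis bdry : forall s, I s -> exists dr dt,
  is_derive_on (fun s => 0 <= s <= L) (fun s => r (b * s, s)) s dr /\
  is_derive_on (fun s => 0 <= s <= L) (fun s => t (b * s, s)) s dt /\
  dr = speed_at F St al be t r (b * s, s) * dt.
Hypothesis jump : forall s, I s ->
  J F (al (c s)) (be (c s)) (alpha_a F St (pos s)) (beta_a F St (pos s)) = 0.

Lemma curve_derive f fu fv s : I s -> is_grad T f (c s) fu fv ->
  is_derive_on I (fun s => f (b * s, s)) s (b * fu + fv).
Proof.
intros Hs Hf.
refine (is_derive_on_ext _ _ _ s _ _ Hs (fun _ _ => eq_refl) _
  (is_derive_on_curve _ T f (fun v => b * v) (fun v => v) s b 1 fu fv Hs curve_T _ _ Hf)).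
- ring.
- apply is_derive_on_of; [exact Hs | auto_derive; [trivial | ring]].
- apply is_derive_on_of; [exact Hs | apply (is_derive_id (K := R_AbsRing))].
Qed.

Lemma Ck_on_curve k f : CkR2 k T f ->
  CkR k I (fun s : R => f (b * s, s)).
Proof.
intros Hf.
apply (Ck_on_comp2 (E := R1) k I T (fun s => b * s) (fun s => s) f curve_T Hf);
  auto using Ck_on_id, Ck_on_scal_id.
Qed.

(** With tangent [(b, 1)], the condition [dr = V * dt] reads [b * c_in * x + c_out * y = V * (b * x
    + y)], and [lax] allows solving for [y]. *)
Lemma shock_ratio_eq s : I s -> y (c s) = b * g s * x (c s).
Proof.
intros Hs. destruct (bdry s Hs) as [dr [dt [H1 [H2 H3]]]].
pose proof (curve_derive r _ _ s Hs (Gr _ (curve_T s Hs))) as E1.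
pose proof (curve_derive t _ _ s Hs (Gt _ (curve_T s Hs))) as E2.
rewrite (is_derive_on_unique 0 L _ s _ _ HL Hs H1 E1) in H3.
rewrite (is_derive_on_unique 0 L _ s _ _ HL Hs H2 E2) in H3.
fold (c s) in H3. fold (shock_at (c s)) in H3. fold (V s) in H3.
unfold g, shock_ratio. fold (V s). pose proof (lax s Hs) as Hlax.
apply Rmult_eq_reg_l with (speed_out F al be (c s) - V s); [|exact Hlax].
transitivity (b * (V s - speed_in F al be (c s)) * x (c s)); [lra|]. field. exact Hlax.
Qed.

Lemma shock_at_eq q : T q -> D (t q, r q) -> shock_at q =
  (rho_h F (enth al be q) * vel al be q - rho_a St (t q, r q) * w_a St (t q, r q)) /
  (rho_h F (enth al be q) - rho_a St (t q, r q)).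
Proof.
intros Hq HD. unfold shock_at, speed_at, shock_speed.
unfold alpha_a, beta_a. rewrite rho_of_riem, w_of_riem by now apply rho_a_pos.
rewrite (rho_of_h F _ _ (Himage q Hq)), (w_of_h F _ _ (Himage q Hq)). reflexivity.
Qed.

Let Hrange q (Hq : T q) : enthalpy_range F (enth al be q) := in_image_range F _ _ (Himage q Hq).

Lemma Ck_on_rho_h_enth k : CkR2 k T al -> CkR2 k T be ->
  CkR2 k T (fun q => rho_h F (enth al be q)).
Proof.
intros Cal Cbe.
exact (Ck_on_comp1 (E := R2) k T _ (enth al be) (rho_h F) Hrange (Ck_on_rho_h F k)
  (Ck_on_enth a ep al be k Cal Cbe)).
Qed.

Section BoundaryLevel.
Variable k : nat.
Hypothesis Cal : CkR2 k T al.
Hypothesis Cbe : CkR2 k T be.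
Hypothesis Ct : CkR2 k T t.
Hypothesis Cr : CkR2 k T r.

Lemma Ck_on_ahead G : CkR2 k D G ->
  CkR k I (fun s : R => G (t (b * s, s), r (b * s, s))).
Proof.
intros HG.
apply (Ck_on_comp2 (E := R1) k I D _ _ G curve_D HG); now apply Ck_on_curve.
Qed.

Lemma Ck_on_shock_at : CkR k I (fun s : R => shock_at (b * s, s)).
Proof.
pose proof (Ck_on_curve k _ (Ck_on_rho_h_enth k Cal Cbe)) as C1.
pose proof (Ck_on_curve k _ (Ck_on_vel a ep al be k Cal Cbe)) as C2.
pose proof (Ck_on_ahead _ (rho_a_smooth k)) as C3.
pose proof (Ck_on_ahead _ (w_a_smooth k)) as C4.
apply (Ck_on_ext (E := R1)) with (fun s : R =>
  (rho_h F (enth al be (b * s, s)) * vel al be (b * s, s) -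
    rho_a St (t (b * s, s), r (b * s, s)) * w_a St (t (b * s, s), r (b * s, s))) /
  (rho_h F (enth al be (b * s, s)) - rho_a St (t (b * s, s), r (b * s, s)))).
- intros s Hs. symmetry. apply shock_at_eq; [now apply curve_T | now apply curve_D].
- apply (Ck_on_div (E := R1)); Ck1_tac.
  intros s Hs. apply Rminus_eq_contra. now apply jump_rho.
Qed.

Lemma Ck_on_shock_ratio : CkR k I (fun s : R => shock_ratio (b * s, s)).
Proof.
pose proof Ck_on_shock_at as C1.
pose proof (Ck_on_curve k _ (Ck_on_speed_in F a ep al be Hrange k Cal Cbe)) as C2.
pose proof (Ck_on_curve k _ (Ck_on_speed_out F a ep al be Hrange k Cal Cbe)) as C3.
apply (Ck_on_div (E := R1)); [exact lax | Ck1_tac | Ck1_tac].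
Qed.

(** This combination inherits the regularity of the boundary values of [al], [be], [t], [r], without
    any continuity of [m] or [n] being presupposed: the algebra of the differentiated jump condition
    expresses it by those values and by first derivatives of the state ahead. *)
Lemma Ck_on_reflection : CkR k I
  (fun s : R => m (b * s, s) + shock_ratio (b * s, s) ^ 3 * n (b * s, s)).
Proof.
destruct (Ck_on_grad _ _ _ (rho_a_smooth (S k))) as [rt [rr [Grho [Crt Crr]]]].
destruct (Ck_on_grad _ _ _ (w_a_smooth (S k))) as [wt [wr [Gw [Cwt Cwr]]]].
(* The derivative of the density ahead along the shock per unit of time, since there [dr = V * dt];
   [wtil] is the same for the velocity. *)
set (rtil := fun s : R => rt (pos s) + rr (pos s) * V s).
set (wtil := fun s : R => wt (pos s) + wr (pos s) * V s).
set (rm := fun s : R => rho_a St (pos s)). set (wm := fun s : R => w_a St (pos s)).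
set (rp := fun s : R => rho_h F (enth al be (c s))). set (wp := fun s : R => vel al be (c s)).
set (e := fun s : R => sound F al be (c s)).
set (A := fun s : R => source F al be r (c s)).
set (Psi := fun s : R => 2 * V s * (rtil s * wm s + rm s * wtil s) -
  (rtil s * wm s * wm s + 2 * rm s * wm s * wtil s + eta F (rm s) * eta F (rm s) * rtil s)
  - V s * V s * rtil s).
apply (Ck_on_ext (E := R1)) with (fun s : R =>
  - ((1 + g s) * Psi s * (2 * e s) / (rp s * (wp s + e s - V s) ^ 2)) - A s * g s
    - A s * g s * g s).
- intros s Hs. symmetry.
  assert (HT := curve_T s Hs). assert (HD := curve_D s Hs).
  assert (Hrp : 0 < rp s) by now apply rho_h_pos, Hrange.
  assert (Hrm : 0 < rm s) by now apply rho_a_pos.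
  assert (Hes : 0 < e s) by now apply eta_h_pos, Hrange.
  assert (HR : rp s - rm s <> 0) by now apply Rminus_eq_contra, jump_rho.
  assert (HV : (rp s - rm s) * V s = rp s * wp s - rm s * wm s).
  { unfold V. rewrite shock_at_eq by assumption.
    change ((rp s - rm s) * ((rp s * wp s - rm s * wm s) / (rp s - rm s)) =
      rp s * wp s - rm s * wm s). field. exact HR. }
  (* Differences are written with [+ -1 *] so that the expression is syntactically the one
     differentiated in [DJ]. *)
  assert (EJ : forall s, I s -> (rp s * wp s + -1 * (rm s * wm s)) *
    (rp s * wp s + -1 * (rm s * wm s)) + -1 * (((rp s * wp s * wp s + pressure F (rp s)) +
    -1 * (rm s * wm s * wm s + pressure F (rm s))) * (rp s + -1 * rm s)) = 0).
  { intros s' Hs'. generalize (jump s' Hs'). unfold J, alpha_a, beta_a.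
    rewrite rho_of_riem, w_of_riem by now apply rho_a_pos, curve_D.
    assert (Him : in_image F (al (c s')) (be (c s'))) by exact (Himage _ (curve_T s' Hs')).
    rewrite (rho_of_h F _ _ Him), (w_of_h F _ _ Him).
    fold (enth al be (c s')) (vel al be (c s')). fold (rp s') (wp s') (rm s') (wm s').
    intros E. rewrite <- E. ring. }
  set (al' := b * (m (c s) * x (c s)) + A s * y (c s)).
  set (be' := b * (A s * x (c s)) + n (c s) * y (c s)).
  set (t' := b * x (c s) + y (c s)).
  assert (Dal := curve_derive al _ _ s Hs (Gal _ HT)).
  assert (Dbe := curve_derive be _ _ s Hs (Gbe _ HT)).
  assert (Dt := curve_derive t _ _ s Hs (Gt _ HT)).
  fold (c s) (A s) al' in Dal. fold (c s) (A s) be' in Dbe. fold (c s) t' in Dt.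
  assert (Dr : is_derive_on I (fun s => r (b * s, s)) s (V s * t')).
  { destruct (bdry s Hs) as [dr [dt [H1 [H2 H3]]]].
    rewrite (is_derive_on_unique 0 L _ s _ _ HL Hs H2 Dt) in H3.
    unfold V, shock_at, c. rewrite <- H3. exact H1. }
  assert (Drp : is_derive_on I rp s (rp s / e s * ((al' + be') / 2))).
  { apply (is_derive_on_comp I (enthalpy_range F) (fun s => enth al be (c s)) (rho_h F));
      [exact Hs | | |].
    - intros s' Hs'. exact (Hrange _ (curve_T s' Hs')).
    - refine (is_derive_on_ext I _ _ s _ _ Hs _ _
        (is_derive_on_mult I _ _ s _ _ Hs (is_derive_on_const I (/ 2) s)
          (is_derive_on_plus I _ _ s _ _ Dal Dbe))).
      + intros; unfold enth, c; field. + field.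
    - exact (rho_h_derive F _ (Hrange _ HT)). }
  assert (Dwp : is_derive_on I wp s ((al' - be') / 2)).
  { refine (is_derive_on_ext I _ _ s _ _ Hs _ _
      (is_derive_on_plus I _ _ s _ _
        (is_derive_on_mult I _ _ s _ _ Hs (is_derive_on_const I (/ 2) s) Dal)
        (is_derive_on_mult I _ _ s _ _ Hs (is_derive_on_const I (- / 2) s) Dbe))).
    + intros; unfold wp, vel, c; field. + field. }
  assert (Drm : is_derive_on I rm s (rtil s * t')).
  { refine (is_derive_on_ext I _ _ s _ _ Hs (fun _ _ => eq_refl) _
      (is_derive_on_curve I D (rho_a St) _ _ s _ _ _ _ Hs curve_D Dt Dr (Grho _ HD))).
    unfold rtil. ring. }
  assert (Dwm : is_derive_on I wm s (wtil s * t')).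
  { refine (is_derive_on_ext I _ _ s _ _ Hs (fun _ _ => eq_refl) _
      (is_derive_on_curve I D (w_a St) _ _ s _ _ _ _ Hs curve_D Dt Dr (Gw _ HD))).
    unfold wtil. ring. }
  assert (Dpr : forall f f', (forall s, I s -> 0 < f s) -> is_derive_on I f s f' ->
    is_derive_on I (fun s => pressure F (f s)) s (eta F (f s) * eta F (f s) * f')).
  { intros f f' Hf Df.
    apply (is_derive_on_comp I (fun s => 0 < s) f (pressure F)); auto.
    apply is_derive_on_of; [now apply Hf | apply pressure_derive; now apply Hf]. }
  assert (Dpp := Dpr rp _ (fun s Hs => rho_h_pos F _ (Hrange _ (curve_T s Hs))) Drp).
  assert (Dpm := Dpr rm _ (fun s Hs => rho_a_pos _ (curve_D s Hs)) Drm).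
  assert (DM1 := is_derive_on_mult I _ _ s _ _ Hs Drp Dwp).
  assert (DM2 := is_derive_on_mult I _ _ s _ _ Hs Drm Dwm).
  assert (Dm1 := fun f f' => is_derive_on_mult I _ f s _ f' Hs (is_derive_on_const I (-1) s)).
  assert (DM := is_derive_on_plus I _ _ s _ _ DM1 (Dm1 _ _ DM2)).
  assert (DP1 := is_derive_on_plus I _ _ s _ _ (is_derive_on_mult I _ _ s _ _ Hs DM1 Dwp) Dpp).
  assert (DP2 := is_derive_on_plus I _ _ s _ _ (is_derive_on_mult I _ _ s _ _ Hs DM2 Dwm) Dpm).
  assert (DP := is_derive_on_plus I _ _ s _ _ DP1 (Dm1 _ _ DP2)).
  assert (DR := is_derive_on_plus I _ _ s _ _ Drp (Dm1 _ _ Drm)).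
  assert (DJ := is_derive_on_plus I _ _ s _ _ (is_derive_on_mult I _ _ s _ _ Hs DM DM)
    (Dm1 _ _ (is_derive_on_mult I _ _ s _ _ Hs DP DR))).
  assert (EJ' := is_derive_on_unique 0 L _ s _ _ HL Hs DJ
    (is_derive_on_ext I _ _ s _ _ Hs (fun s Hs => eq_sym (EJ s Hs)) eq_refl
      (is_derive_on_const I 0 s))).
  assert (Hg := shock_ratio_eq s Hs).
  apply (jump_derivative_algebra b (x (c s)) (y (c s)) (m (c s)) (n (c s)) (A s) (rp s) (wp s)
    (e s) (V s) (rm s) (wm s) (eta F (rm s)) (rtil s) (wtil s) (pressure F (rp s))
    (pressure F (rm s)) al' be' t'); auto; try (apply Rgt_not_eq; assumption).
  + exact (lax s Hs).
  + specialize (EJ s Hs). lra.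
  + change (eta F (rp s)) with (e s) in EJ'. rewrite <- EJ'. ring.
- pose proof (Ck_on_curve k _ (Ck_on_rho_h_enth k Cal Cbe)) as C1.
  pose proof (Ck_on_curve k _ (Ck_on_vel a ep al be k Cal Cbe)) as C2.
  pose proof (Ck_on_ahead _ (rho_a_smooth k)) as C3.
  pose proof (Ck_on_ahead _ (w_a_smooth k)) as C4.
  pose proof Ck_on_shock_at as C5. pose proof Ck_on_shock_ratio as C6.
  pose proof (Ck_on_curve k _ (Ck_on_sound F a ep al be Hrange k Cal Cbe)) as C7.
  pose proof (Ck_on_curve k _ (Ck_on_source F a ep al be r Hrange Hr k Cal Cbe Cr)) as C8.
  pose proof (Ck_on_ahead _ Crt) as C9. pose proof (Ck_on_ahead _ Crr) as C10.
  pose proof (Ck_on_ahead _ Cwt) as C11. pose proof (Ck_on_ahead _ Cwr) as C12.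
  assert (C13 : CkR k I (fun s : R => eta F (rm s))).
  { apply (Ck_on_comp1 (E := R1) k I (fun s => 0 < s) rm (eta F)).
    - intros s Hs. now apply rho_a_pos, curve_D.
    - apply Ck_on_eta. - exact C3. }
  change (CkR k I rp) in C1.
  change (CkR k I wp) in C2.
  change (CkR k I rm) in C3.
  change (CkR k I wm) in C4.
  change (CkR k I V) in C5.
  change (CkR k I g) in C6.
  change (CkR k I e) in C7.
  change (CkR k I A) in C8.
  assert (C14 : CkR k I rtil).
  { apply (Ck_on_plus (E := R1)); [exact C9|].
    apply (Ck_on_mult (E := R1)); [exact C10 | exact C5]. }
  assert (C15 : CkR k I wtil).
  { apply (Ck_on_plus (E := R1)); [exact C11|].
    apply (Ck_on_mult (E := R1)); [exact C12 | exact C5]. }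
  assert (C16 : CkR k I Psi) by (unfold Psi; Ck1_tac).
  assert (C17 : CkR k I (fun s => rp s * (wp s + e s - V s) ^ 2)).
  { apply (Ck_on_mult (E := R1)); [exact C1|].
    apply (Ck_on_pow (E := R1)). Ck1_tac. }
  assert (C18 : CkR k I (fun s => / (rp s * (wp s + e s - V s) ^ 2))).
  { apply (Ck_on_inv (E := R1)); [|exact C17].
    intros s Hs. apply Rmult_integral_contrapositive_currified.
    - apply Rgt_not_eq, rho_h_pos, Hrange, curve_T, Hs.
    - apply pow_nonzero. exact (lax s Hs). }
  unfold Rdiv. Ck1_tac.
Qed.

End BoundaryLevel.
End Boundary.

(** * Solutions with small round-trip factors *)

Lemma T_dom_subset a ep ep' q : ep' <= ep -> T_dom a ep' q -> T_dom a ep q.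
Proof. unfold T_dom. intros H [H1 [H2 [H3 H4]]]. repeat split; lra. Qed.

(** The integral depends on [ep] only through the extension [ext], which changes nothing as long as
    the characteristic stays in the smaller triangle. *)
Lemma char_int_restrict a ep ep' d1 d2 l1 l2 g q : 0 < a < 1 -> ep' <= ep ->
  (forall s, 0 <= s <= 1 -> T_dom a ep' (char_pt d1 d2 l1 l2 s q)) ->
  char_int a ep' d1 d2 l1 l2 g q = char_int a ep d1 d2 l1 l2 g q.
Proof.
intros Ha Hep Hq. unfold char_int, pint. f_equal. apply RInt_ext.
intros s Hs. rewrite Rmin_left, Rmax_right in Hs by lra. f_equal.
assert (H := Hq s ltac:(lra)). unfold char_pt in H.
rewrite !ext_T; auto. now apply T_dom_subset with ep'.
Qed.

Lemma round_trip_restrict a ep ep' l1 l2 phi1 phi2 u : 0 < a < 1 -> ep' <= ep ->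
  0 <= u <= a * ep' ->
  round_trip a ep' l1 l2 phi1 phi2 u = round_trip a ep l1 l2 phi1 phi2 u.
Proof.
intros Ha Hep Hu. unfold round_trip, u_int, v_int.
assert (0 <= u <= ep') by nra.
rewrite (char_int_restrict a ep ep' 1 0), (char_int_restrict a ep ep' 0 1); auto.
- intros s Hs. apply v_pt_T; auto. now apply T_dom_edge.
- intros s Hs. apply u_pt_T; auto. now apply T_dom_diag.
Qed.

(** At the corner both characteristics have length zero, so the exponentials are 1 and only the
    reflections remain. *)
Lemma round_trip_0 a ep l1 l2 phi1 phi2 : round_trip a ep l1 l2 phi1 phi2 0 = phi1 0 * phi2 0.
Proof.
unfold round_trip, u_int, v_int, char_int, char_len; simpl.
replace (1 * 0 + - a * 0) with 0 by ring. replace (-1 * (a * 0) + 1 * 0) with 0 by ring.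
rewrite !Rmult_0_l, exp_0. ring.
Qed.

Section RegularSolution.
Variable F : fluid.
Variable a : R.
Hypothesis Ha : 0 < a < 1.
Variables S1 S2 : ahead.
Variables D1 D2 : R * R -> Prop.
Hypothesis smooth_rho1 : smooth_on D1 (rho_a S1).
Hypothesis smooth_w1 : smooth_on D1 (w_a S1).
Hypothesis rho1_pos : forall p, D1 p -> 0 < rho_a S1 p.
Hypothesis smooth_rho2 : smooth_on D2 (rho_a S2).
Hypothesis smooth_w2 : smooth_on D2 (w_a S2).
Hypothesis rho2_pos : forall p, D2 p -> 0 < rho_a S2 p.
Variables al be t r x y m n : R * R -> R.

(** The diagonal is the case [b = 1], the other edge [b = a]. The last three clauses keep away from
    zero what is divided by later: the density jump, the denominator of the ratio, and the ratio
    itself. *)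
Definition shock_curve (St : ahead) (D : R * R -> Prop) (b L : R) : Prop :=
  forall s, 0 <= s <= L ->
    D (t (b * s, s), r (b * s, s)) /\
    (exists dr dt,
      is_derive_on (fun s => 0 <= s <= L) (fun s => r (b * s, s)) s dr /\
      is_derive_on (fun s => 0 <= s <= L) (fun s => t (b * s, s)) s dt /\
      dr = speed_at F St al be t r (b * s, s) * dt) /\
    J F (al (b * s, s)) (be (b * s, s))
      (alpha_a F St (t (b * s, s), r (b * s, s)))
      (beta_a F St (t (b * s, s), r (b * s, s))) = 0 /\
    rho_h F (enth al be (b * s, s)) <> rho_a St (t (b * s, s), r (b * s, s)) /\
    speed_out F al be (b * s, s) - shock_at F al be t r St (b * s, s) <> 0 /\
    shock_ratio F al be t r St (b * s, s) <> 0.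

Lemma shock_curve_restrict St D b L L' : L' <= L ->
  shock_curve St D b L -> shock_curve St D b L'.
Proof.
intros HL H s Hs. destruct (H s ltac:(lra)) as [H1 [[dr [dt [H2 [H3 H4]]]] H5]].
split; [exact H1|]. split; [|exact H5].
exists dr, dt. split; [|split; [|exact H4]];
  apply is_derive_on_subset with (fun s => 0 <= s <= L); auto; intros; lra.
Qed.

Record regular_solution (ep : R) : Prop := {
  rs_image : forall q, T_dom a ep q -> in_image F (al q) (be q);
  rs_r : forall q, T_dom a ep q -> 0 < r q;
  rs_Gt : forall q, T_dom a ep q -> is_grad (T_dom a ep) t q (x q) (y q);
  rs_Gr : forall q, T_dom a ep q ->
    is_grad (T_dom a ep) r q (speed_in F al be q * x q) (speed_out F al be q * y q);
  rs_Gal : forall q, T_dom a ep q ->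
    is_grad (T_dom a ep) al q (m q * x q) (source F al be r q * y q);
  rs_Gbe : forall q, T_dom a ep q ->
    is_grad (T_dom a ep) be q (source F al be r q * x q) (n q * y q);
  rs_x : forall q, T_dom a ep q -> x q <> 0;
  rs_y : forall q, T_dom a ep q -> y q <> 0;
  rs_Cx : CkR2 1 (T_dom a ep) x;
  rs_Cy : CkR2 1 (T_dom a ep) y;
  rs_Cm : CkR2 1 (T_dom a ep) m;
  rs_Cn : CkR2 1 (T_dom a ep) n;
  rs_shock1 : shock_curve S1 D1 1 (a * ep);
  rs_shock2 : shock_curve S2 D2 a ep }.

Lemma regular_solution_restrict ep ep' : ep' <= ep ->
  regular_solution ep -> regular_solution ep'.
Proof.
intros Hep [I1 I2 I3 I4 I5 I6 I7 I8 I9 I10 I11 I12 I13 I14].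
assert (Hsub : forall q, T_dom a ep' q -> T_dom a ep q).
{ intros q. now apply T_dom_subset. }
assert (G : forall f q fu fv, T_dom a ep' q -> is_grad (T_dom a ep) f q fu fv ->
  is_grad (T_dom a ep') f q fu fv).
{ intros f q fu fv Hq. apply (fderiv_subset (E := R2)); auto. }
split; auto.
- exact (Ck_on_subset (E := R2) 1 _ _ _ Hsub I9).
- exact (Ck_on_subset (E := R2) 1 _ _ _ Hsub I10).
- exact (Ck_on_subset (E := R2) 1 _ _ _ Hsub I11).
- exact (Ck_on_subset (E := R2) 1 _ _ _ Hsub I12).
- apply shock_curve_restrict with (a * ep); auto. nra.
- apply shock_curve_restrict with ep; auto.
Qed.

Let g1 (u : R) : R := shock_ratio F al be t r S1 (u, u).
Let g2 (v : R) : R := shock_ratio F al be t r S2 (a * v, v).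
Let KK := cross_coef m n (coef_k0 F al be r) (coef_k1 F al be).

(** On the diagonal the relation is [m + g1^3 * n = psi]. On the edge it is divided by [g2^3], to
    read [n + m / g2^3 = psi / g2^3]; the factor [a] is that of the tangent [(a, 1)]. *)
Definition trip_m (ep u : R) : R :=
  round_trip a ep (lin_m y m n (coef_k1 F al be) (coef_p1 F al be r))
    (lin_n x m n (coef_k1 F al be) (coef_q1 F al be r))
    (fun u => - g1 u ^ 3) (fun v => - (a * / g2 v ^ 3)) u.
(** The relations are [x - y / g1 = 0] and [y - a * g2 * x = 0]; the double signs come from the form
    [x + c1 * y = 0] with [c1 = - / g1], and likewise for [c2]. *)
Definition trip_x (ep u : R) : R :=
  round_trip a ep (fun q => y q * KK q) (fun q => x q * KK q)
    (fun u => - - / g1 u) (fun v => - (a * - (a * g2 v))) u.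

Section Regular.
Variable ep : R.
Hypothesis Hep : 0 < ep.
Hypothesis RS : regular_solution ep.
Let T := T_dom a ep.

Lemma rs_range q : T q -> enthalpy_range F (enth al be q).
Proof. intros Hq. now apply in_image_range, (rs_image ep RS). Qed.

Lemma rs_curve1 s : 0 <= s <= a * ep -> T (1 * s, s).
Proof. intros Hs. rewrite Rmult_1_l. now apply T_dom_diag. Qed.

Lemma rs_curve2 s : 0 <= s <= ep -> T (a * s, s).
Proof. intros Hs. now apply T_dom_edge. Qed.

Lemma g1_neq u : 0 <= u <= a * ep -> g1 u <> 0.
Proof.
intros Hu. assert (H := rs_shock1 ep RS u Hu). decompose [and] H.
rewrite Rmult_1_l in *. assumption.
Qed.

Lemma g2_neq v : 0 <= v <= ep -> g2 v <> 0.
Proof. intros Hv. assert (H := rs_shock2 ep RS v Hv). decompose [and] H. assumption. Qed.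

Lemma Ck_on_boundary k :
  CkR2 k T t -> CkR2 k T r ->
  CkR2 k T al -> CkR2 k T be ->
  CkR k (fun u => 0 <= u <= a * ep) g1 /\
  CkR k (fun v => 0 <= v <= ep) g2 /\
  CkR k (fun u => 0 <= u <= a * ep)
    (fun u : R => m (u, u) + g1 u ^ 3 * n (u, u)) /\
  CkR k (fun v => 0 <= v <= ep)
    (fun v : R => m (a * v, v) + g2 v ^ 3 * n (a * v, v)).
Proof.
intros Ct Cr Cal Cbe.
assert (Haep : 0 < a * ep) by nra.
assert (H1 := rs_shock1 ep RS). assert (H2 := rs_shock2 ep RS).
split; [|split; [|split]].
- apply (Ck_on_ext (E := R1)) with
    (fun s : R => shock_ratio F al be t r S1 (1 * s, s)).
  { intros s _. now rewrite Rmult_1_l. }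
  apply (Ck_on_shock_ratio F a ep al be t r (rs_image ep RS) S1 D1 smooth_rho1 smooth_w1
    rho1_pos 1 (a * ep) rs_curve1); auto; intros s Hs; apply (H1 s Hs).
- apply (Ck_on_shock_ratio F a ep al be t r (rs_image ep RS) S2 D2 smooth_rho2 smooth_w2
    rho2_pos a ep rs_curve2); auto; intros s Hs; apply (H2 s Hs).
- apply (Ck_on_ext (E := R1)) with
    (fun s : R => m (1 * s, s) + shock_ratio F al be t r S1 (1 * s, s) ^ 3 * n (1 * s, s)).
  { intros s _. now rewrite Rmult_1_l. }
  apply (Ck_on_reflection F a ep al be t r x y m n (rs_image ep RS) (rs_r ep RS)
    (rs_Gt ep RS) (rs_Gr ep RS) (rs_Gal ep RS) (rs_Gbe ep RS) (rs_x ep RS)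
    S1 D1 smooth_rho1 smooth_w1
    rho1_pos 1 (a * ep) ltac:(lra) Haep rs_curve1); auto; intros s Hs; apply (H1 s Hs).
- apply (Ck_on_reflection F a ep al be t r x y m n (rs_image ep RS) (rs_r ep RS)
    (rs_Gt ep RS) (rs_Gr ep RS) (rs_Gal ep RS) (rs_Gbe ep RS) (rs_x ep RS)
    S2 D2 smooth_rho2 smooth_w2
    rho2_pos a ep ltac:(lra) Hep rs_curve2); auto; intros s Hs; apply (H2 s Hs).
Qed.

Lemma diag_ratio u : 0 <= u <= a * ep -> y (u, u) = g1 u * x (u, u).
Proof.
intros Hu.
assert (Haep : 0 < a * ep) by nra.
assert (H1 := rs_shock1 ep RS).
assert (E : y (1 * u, u) = 1 * shock_ratio F al be t r S1 (1 * u, u) * x (1 * u, u)).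
{ apply (shock_ratio_eq F a ep al be t r x y (rs_Gt ep RS) (rs_Gr ep RS) S1 1 (a * ep) Haep
    rs_curve1); [| |exact Hu]; intros s Hs; apply (H1 s Hs). }
rewrite !Rmult_1_l in E. exact E.
Qed.

Lemma edge_ratio v : 0 <= v <= ep -> y (a * v, v) = a * g2 v * x (a * v, v).
Proof.
intros Hv. assert (H1 := rs_shock2 ep RS).
apply (shock_ratio_eq F a ep al be t r x y (rs_Gt ep RS) (rs_Gr ep RS) S2 a ep Hep rs_curve2);
  [| |exact Hv]; intros s Hs; apply (H1 s Hs).
Qed.

Lemma trips_continuous :
  CkR 0 (fun u => 0 <= u <= a * ep) (trip_m ep) /\
  CkR 0 (fun u => 0 <= u <= a * ep) (trip_x ep).
Proof.
assert (Hle : forall f, CkR2 1 T f -> CkR2 0 T f).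
{ intros f. apply Ck_on_S. }
pose proof (Hle _ (rs_Cx ep RS)). pose proof (Hle _ (rs_Cy ep RS)).
pose proof (Hle _ (rs_Cm ep RS)). pose proof (Hle _ (rs_Cn ep RS)).
destruct (state_Ck F a ep al be t r x y m n rs_range (rs_r ep RS) (rs_Gt ep RS) (rs_Gr ep RS)
  (rs_Gal ep RS) (rs_Gbe ep RS) 0) as [Ct [Cr [Cal Cbe]]]; auto.
apply Hle in Ct, Cr, Cal, Cbe.
destruct (Ck_on_coefs F a ep al be r rs_range (rs_r ep RS) 0 Cal Cbe Cr)
  as [C0 [C1 [C2 [C3 [C4 [C5 C6]]]]]].
destruct (Ck_on_boundary 0 Ct Cr Cal Cbe) as [Cg1 [Cg2 _]].
assert (CK : CkR2 0 T KK) by (unfold KK, cross_coef; Ck_tac).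
assert (Cg2i : CkR 0 (fun v => 0 <= v <= ep) (fun v => / g2 v ^ 3)).
{ apply (Ck_on_inv (E := R1)).
  - intros v Hv. now apply pow_nonzero, g2_neq.
  - apply (Ck_on_pow (E := R1)), Cg2. }
assert (Cg1i : CkR 0 (fun u => 0 <= u <= a * ep) (fun u => / g1 u)).
{ exact (Ck_on_inv (E := R1) 0 _ g1 g1_neq Cg1). }
assert (Cl1 : CkR2 0 T (lin_m y m n (coef_k1 F al be) (coef_p1 F al be r))).
{ unfold lin_m. Ck_tac. }
assert (Cl2 : CkR2 0 T (lin_n x m n (coef_k1 F al be) (coef_q1 F al be r))).
{ unfold lin_n. Ck_tac. }
split.
- refine (Ck_on_round_trip a ep Ha Hep 0 _ _ _ _ Cl1 Cl2 _ _).
  + apply (Ck_on_opp (E := R1)), (Ck_on_pow (E := R1)), Cg1.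
  + apply (Ck_on_opp (E := R1)), (Ck_on_mult (E := R1));
      [apply (Ck_on_const (E := R1)) | exact Cg2i].
- refine (Ck_on_round_trip a ep Ha Hep 0 _ _ _ _
    (Ck_on_mult (E := R2) 0 T y KK _ CK) (Ck_on_mult (E := R2) 0 T x KK _ CK) _ _).
  + assumption.
  + assumption.
  + apply (Ck_on_opp (E := R1)), (Ck_on_opp (E := R1)), Cg1i.
  + apply (Ck_on_opp (E := R1)), (Ck_on_mult (E := R1));
      [apply (Ck_on_const (E := R1))|].
    apply (Ck_on_opp (E := R1)), (Ck_on_mult (E := R1));
      [apply (Ck_on_const (E := R1)) | exact Cg2].
Qed.

Lemma regular_solution_smooth th : 0 < th < 1 ->
  (forall u, 0 <= u <= a * ep -> Rabs (trip_m ep u) <= th /\ Rabs (trip_x ep u) <= th) ->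
  smooth_on (E := R2) T al /\ smooth_on (E := R2) T be /\
  smooth_on (E := R2) T t /\ smooth_on (E := R2) T r.
Proof.
intros Hth Htrip.
assert (SC := state_Ck F a ep al be t r x y m n rs_range (rs_r ep RS) (rs_Gt ep RS)
  (rs_Gr ep RS) (rs_Gal ep RS) (rs_Gbe ep RS)).
destruct (Ck_on_grad _ _ _ (rs_Cx ep RS)) as [xu [xv [Gx [Cxu Cxv]]]].
destruct (Ck_on_grad _ _ _ (rs_Cy ep RS)) as [yu [yv [Gy [Cyu Cyv]]]].
destruct (Ck_on_grad _ _ _ (rs_Cm ep RS)) as [mu [mv [Gm [Cmu Cmv]]]].
destruct (Ck_on_grad _ _ _ (rs_Cn ep RS)) as [nu [nv [Gn [Cnu Cnv]]]].
assert (X1 := cross_derivatives F a ep Ha Hep al be t r x y m n rs_range (rs_r ep RS)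
  (rs_Gt ep RS) (rs_Gr ep RS) (rs_Gal ep RS) (rs_Gbe ep RS) xu xv yu yv Gx Gy
  (rs_Cx ep RS) (rs_Cy ep RS) (rs_Cm ep RS) (rs_Cn ep RS)).
assert (X2 := quad_derivatives F a ep Ha Hep al be t r x y m n rs_range (rs_r ep RS)
  (rs_Gt ep RS) (rs_Gr ep RS) (rs_Gal ep RS) (rs_Gbe ep RS) xu xv yu yv mu mv nu nv Gx Gy Gm Gn
  (rs_Cx ep RS) (rs_Cy ep RS) (rs_Cm ep RS) (rs_Cn ep RS) (rs_x ep RS) (rs_y ep RS)).
assert (Hk : forall k, (1 <= k)%nat ->
  CkR2 k T x /\ CkR2 k T y /\
  CkR2 k T m /\ CkR2 k T n).
{ induction k as [|k IH]; [lia|]. intros _.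
  destruct k as [|k].
  { split; [apply RS|]. split; [apply RS|]. split; apply RS. }
  destruct (IH ltac:(lia)) as [Cx [Cy [Cm Cn]]].
  (* From here on [al], [be], [t], [r], and with them the coefficients, the ratios and the
     right-hand sides of the boundary relations, have the one derivative more that [regularity_gain]
     asks for. *)
  destruct (SC (S k) Cx Cy Cm Cn) as [Ct [Cr [Cal Cbe]]].
  destruct (Ck_on_coefs F a ep al be r rs_range (rs_r ep RS) _ Cal Cbe Cr)
    as [C0 [C1 [C2 [C3 [C4 [C5 C6]]]]]].
  destruct (Ck_on_boundary _ Ct Cr Cal Cbe) as [Cg1 [Cg2 [Cp1 Cp2]]].
  assert (Cg2i : CkR (S (S k)) (fun v => 0 <= v <= ep)
    (fun v => / g2 v ^ 3)).
  { apply (Ck_on_inv (E := R1)).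
    - intros v Hv. now apply pow_nonzero, g2_neq.
    - apply (Ck_on_pow (E := R1)), Cg2. }
  apply (regularity_gain a ep Ha Hep x y m n xu yv mu nv (coef_k0 F al be r) (coef_k1 F al be)
    (coef_p0 F al be r) (coef_p1 F al be r) (coef_2 F al be r)
    (coef_q0 F al be r) (coef_q1 F al be r) (coef_2 F al be r))
    with (b1 := fun u => g1 u ^ 3) (b2 := fun v => / g2 v ^ 3)
      (psi1 := fun u : R => m (u, u) + g1 u ^ 3 * n (u, u))
      (psi2 := fun v : R => (m (a * v, v) + g2 v ^ 3 * n (a * v, v)) * / g2 v ^ 3)
      (c1 := fun u => - / g1 u) (c2 := fun v => - (a * g2 v)) (th := th);
    try assumption; try lia.
  - intros q Hq. destruct (X1 q Hq) as [E1 E2].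
    apply (is_grad_eq _ _ _ _ _ _ _ (Gx q Hq)); [reflexivity | exact E1].
  - intros q Hq. destruct (X1 q Hq) as [E1 E2].
    apply (is_grad_eq _ _ _ _ _ _ _ (Gy q Hq)); [exact E2 | reflexivity].
  - intros q Hq. destruct (X2 q Hq) as [E1 E2].
    apply (is_grad_eq _ _ _ _ _ _ _ (Gm q Hq)); [reflexivity | exact E1].
  - intros q Hq. destruct (X2 q Hq) as [E1 E2].
    apply (is_grad_eq _ _ _ _ _ _ _ (Gn q Hq)); [exact E2 | reflexivity].
  - reflexivity.
  - intros v Hv. pose proof (g2_neq v Hv). field. assumption.
  - intros u Hu. rewrite (diag_ratio u Hu). pose proof (g1_neq u Hu). field. assumption.
  - intros v Hv. rewrite (edge_ratio v Hv). ring.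
  - intros u Hu. apply (Htrip u Hu).
  - intros u Hu. apply (Htrip u Hu).
  - apply (Ck_on_pow (E := R1)), Cg1.
  - apply (Ck_on_opp (E := R1)), (Ck_on_inv (E := R1));
      [exact g1_neq | exact Cg1].
  - apply (Ck_on_mult (E := R1)); assumption.
  - Ck1_tac. }
assert (Hs : forall k, CkR2 k T t /\ CkR2 k T r /\
  CkR2 k T al /\ CkR2 k T be).
{ intros k. destruct (Hk (S k) ltac:(lia)) as [Cx [Cy [Cm Cn]]].
  destruct (SC (S k) Cx Cy Cm Cn) as [Ct [Cr [Cal Cbe]]].
  repeat apply Ck_on_S in Ct, Cr, Cal, Cbe. auto. }
split; [|split; [|split]]; intros k; apply (Hs k).
Qed.

End Regular.

(** The relation between the ratios at the origin leaves [a^4] and [a] as round-trip factors there.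
    By continuity both stay below [(1 + a) / 2 < 1] on a smaller triangle, and nothing in this
    choice refers to the order of differentiability. *)
Lemma regular_solution_smooth_near ep : 0 < ep -> regular_solution ep -> g1 0 = a * g2 0 ->
  exists ep0, 0 < ep0 <= ep /\
    smooth_on (E := R2) (T_dom a ep0) al /\ smooth_on (E := R2) (T_dom a ep0) be /\
    smooth_on (E := R2) (T_dom a ep0) t /\ smooth_on (E := R2) (T_dom a ep0) r.
Proof.
intros Hep RS Hg.
assert (Haep : 0 < a * ep) by nra.
assert (Hg2 : g2 0 <> 0) by (apply (g2_neq ep RS); lra).
destruct (trips_continuous ep Hep RS) as [Cm Cx].
rewrite continuous_on_iff in Cm, Cx.
assert (M0 : trip_m ep 0 = a * a * a * a).
{ unfold trip_m. rewrite round_trip_0, Hg. field. exact Hg2. }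
assert (X0 : trip_x ep 0 = a).
{ unfold trip_x. rewrite round_trip_0, Hg. field. split; [exact Hg2 | lra]. }
assert (Ha4 : 0 < a * a * a * a < a).
{ assert (0 < a * a < 1) by nra. nra. }
destruct (Cm 0 ltac:(lra) ((1 - a) / 2)) as [d1 [D1p D1']]; [lra|].
destruct (Cx 0 ltac:(lra) ((1 - a) / 2)) as [d2 [D2p D2']]; [lra|].
set (d := Rmin d1 d2). assert (Hd : 0 < d) by now apply Rmin_pos.
assert (Hd1 : d <= d1) by apply Rmin_l. assert (Hd2 : d <= d2) by apply Rmin_r.
set (ep0 := Rmin ep (d / 2)).
assert (He1 : ep0 <= ep) by apply Rmin_l. assert (He2 : ep0 <= d / 2) by apply Rmin_r.
assert (He0 : 0 < ep0) by (apply Rmin_pos; lra).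
exists ep0. split; [lra|].
apply (regular_solution_smooth ep0 He0 (regular_solution_restrict ep ep0 He1 RS)
  ((1 + a) / 2)); [lra|].
intros u Hu.
assert (Hu' : 0 <= u <= a * ep) by nra.
assert (Hud : Rabs (u - 0) < d) by (rewrite Rminus_0_r, Rabs_pos_eq by lra; nra).
(* The factors formed on the smaller triangle are those of the large one, for which continuity at 0
   was established. *)
unfold trip_m, trip_x. rewrite !(round_trip_restrict a ep ep0) by assumption.
specialize (D1' u Hu' ltac:(lra)). specialize (D2' u Hu' ltac:(lra)).
rewrite M0 in D1'. rewrite X0 in D2'.
apply Rabs_def2 in D1'. apply Rabs_def2 in D2'.
split; apply Rabs_le.
- unfold trip_m in D1'. lra.
- unfold trip_x in D2'. lra.
Qed.

End RegularSolution.

(** * The neighbourhood of the interaction point *)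

Lemma positive_near_0 L f : 0 < L ->
  CkR 0 (fun s => 0 <= s <= L) f -> 0 < f 0 ->
  exists L', 0 < L' <= L /\ forall s, 0 <= s <= L' -> 0 < f s.
Proof.
intros HL Hf H0. rewrite continuous_on_iff in Hf.
destruct (Hf 0 ltac:(lra) (f 0) H0) as [d [Hd Hd']].
exists (Rmin L (d / 2)).
pose proof (Rmin_l L (d / 2)). pose proof (Rmin_r L (d / 2)).
split; [split; [apply Rmin_pos; lra | lra]|]. intros s Hs.
assert (Hs' := Hd' s ltac:(lra) ltac:(rewrite Rminus_0_r, Rabs_pos_eq; lra)).
apply Rabs_def2 in Hs'. lra.
Qed.

Lemma positive_near_origin a ep f : 0 < a < 1 -> 0 < ep ->
  CkR2 0 (T_dom a ep) f -> 0 < f (0, 0) ->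
  exists ep', 0 < ep' <= ep /\ forall q, T_dom a ep' q -> 0 < f q.
Proof.
intros Ha Hep Hf H0. rewrite continuous_on2_iff in Hf.
assert (HO : T_dom a ep (0, 0)) by (apply T_dom_diag; auto; nra).
destruct (Hf _ HO (f (0, 0)) H0) as [d [Hd Hd']].
exists (Rmin ep (d / 2)).
pose proof (Rmin_l ep (d / 2)). pose proof (Rmin_r ep (d / 2)).
assert (He : 0 < Rmin ep (d / 2)) by (apply Rmin_pos; lra).
split; [lra|]. intros q Hq.
pose proof (T_dom_fst a _ Ha q Hq). pose proof (T_dom_snd a _ Ha q Hq).
assert (Hq' : Rabs (f q - f (0, 0)) < f (0, 0)).
{ apply Hd'; [now apply T_dom_subset with (Rmin ep (d / 2)) | |]; simpl;
  rewrite Rminus_0_r, Rabs_pos_eq by lra; nra. }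
apply Rabs_def2 in Hq'. lra.
Qed.

(** The nondegeneracy clauses are open conditions, so it suffices to have them at the origin and to
    shorten the curve. *)
Lemma shock_curve_near F a ep al be t r St D b L : 0 < a < 1 -> 0 < ep -> 0 < L ->
  (forall q, T_dom a ep q -> in_image F (al q) (be q)) ->
  smooth_on D (rho_a St) -> smooth_on D (w_a St) -> (forall p, D p -> 0 < rho_a St p) ->
  CkR2 0 (T_dom a ep) al -> CkR2 0 (T_dom a ep) be ->
  CkR2 0 (T_dom a ep) t -> CkR2 0 (T_dom a ep) r ->
  (forall s, 0 <= s <= L -> T_dom a ep (b * s, s)) ->
  (forall s, 0 <= s <= L -> D (t (b * s, s), r (b * s, s)) /\
    (exists dr dt,
      is_derive_on (fun s => 0 <= s <= L) (fun s => r (b * s, s)) s dr /\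
      is_derive_on (fun s => 0 <= s <= L) (fun s => t (b * s, s)) s dt /\
      dr = speed_at F St al be t r (b * s, s) * dt) /\
    J F (al (b * s, s)) (be (b * s, s))
      (alpha_a F St (t (b * s, s), r (b * s, s)))
      (beta_a F St (t (b * s, s), r (b * s, s))) = 0) ->
  rho_h F (enth al be (0, 0)) <> rho_a St (t (0, 0), r (0, 0)) ->
  speed_in F al be (0, 0) < speed_at F St al be t r (0, 0) < speed_out F al be (0, 0) ->
  exists L', 0 < L' <= L /\ shock_curve F al be t r St D b L'.
Proof.
intros Ha Hep HL Him Hrho Hw Hpos Cal Cbe Ct Cr HT Hc Hj [Hin Hout].
assert (HO : (b * 0, 0) = (0, 0)) by now rewrite Rmult_0_r.
assert (Hrange : forall q, T_dom a ep q -> enthalpy_range F (enth al be q)).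
{ intros q Hq. now apply in_image_range, Him. }
assert (HD : forall s, 0 <= s <= L -> D (t (b * s, s), r (b * s, s))).
{ intros s Hs. now apply Hc. }
set (jmp := fun s : R => rho_h F (enth al be (b * s, s)) +
  -1 * rho_a St (t (b * s, s), r (b * s, s))).
(* The square is used because the sign of the density jump is left open. *)
assert (Cj : CkR 0 (fun s => 0 <= s <= L) (fun s => jmp s * jmp s)).
{ pose proof (Ck_on_curve a ep b L HT 0 _
    (Ck_on_rho_h_enth F a ep al be Him 0 Cal Cbe)) as C1.
  pose proof (Ck_on_ahead a ep t r D b L HT HD 0 Ct Cr _ (Hrho 0%nat)) as C2.
  unfold jmp. Ck1_tac. }
destruct (positive_near_0 L _ HL Cj) as [L1 [HL1 Hj1]].
{ unfold jmp. rewrite HO.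
  assert (N : rho_h F (enth al be (0, 0)) + -1 * rho_a St (t (0, 0), r (0, 0)) <> 0).
  { intros E. apply Hj. lra. }
  apply Rsqr_pos_lt in N. exact N. }
assert (Hj2 : forall s, 0 <= s <= L1 ->
  rho_h F (enth al be (b * s, s)) <> rho_a St (t (b * s, s), r (b * s, s))).
{ intros s Hs E. specialize (Hj1 s Hs). unfold jmp in Hj1. rewrite E in Hj1. lra. }
assert (HT1 : forall s, 0 <= s <= L1 -> T_dom a ep (b * s, s)).
{ intros s Hs. apply HT. lra. }
assert (HD1 : forall s, 0 <= s <= L1 -> D (t (b * s, s), r (b * s, s))).
{ intros s Hs. apply HD. lra. }
(* The shock speed is a quotient by the density jump; its continuity becomes available only on the
   part of the curve where the jump is known not to vanish. *)
pose proof (Ck_on_shock_at F a ep al be t r Him St D Hrho Hw Hpos b L1 HT1 HD1 Hj2 0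
  Cal Cbe Ct Cr) as CV.
pose proof (Ck_on_curve a ep b L1 HT1 0 _ (Ck_on_speed_in F a ep al be Hrange 0 Cal Cbe)) as Ci.
pose proof (Ck_on_curve a ep b L1 HT1 0 _ (Ck_on_speed_out F a ep al be Hrange 0 Cal Cbe)) as Co.
destruct (positive_near_0 L1 (fun s : R => speed_out F al be (b * s, s) -
  shock_at F al be t r St (b * s, s))) as [L2 [HL2 Hp2]]; [lra | Ck1_tac | |].
{ rewrite HO. unfold shock_at. lra. }
destruct (positive_near_0 L1 (fun s : R => shock_at F al be t r St (b * s, s) -
  speed_in F al be (b * s, s))) as [L3 [HL3 Hp3]]; [lra | Ck1_tac | |].
{ rewrite HO. unfold shock_at. lra. }
pose proof (Rmin_l L2 L3). pose proof (Rmin_r L2 L3).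
assert (Hm : 0 < Rmin L2 L3) by (apply Rmin_pos; lra).
exists (Rmin L2 L3). split; [lra|].
intros s Hs.
destruct (Hc s ltac:(lra)) as [X1 [[dr [dt [X2 [X3 X4]]]] X5]].
specialize (Hp2 s ltac:(lra)). specialize (Hp3 s ltac:(lra)).
split; [exact X1|]. split; [|split; [exact X5|split; [|split]]].
- exists dr, dt. split; [|split; [|exact X4]];
    apply is_derive_on_subset with (fun s => 0 <= s <= L); auto; intros; lra.
- apply Hj2. lra.
- lra.
- unfold shock_ratio. apply Rmult_integral_contrapositive_currified; [lra|].
  apply Rinv_neq_0_compat. lra.
Qed.

Lemma a_of_bounds e V1 V2 : - e < V1 < 0 -> 0 < V2 < e -> 0 < a_of e V1 V2 < 1.
Proof.
intros H1 H2. unfold a_of.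
assert (E1 : 0 < (e + V1) / (e - V1) < 1).
{ split; [apply Rdiv_lt_0_compat; lra|].
  apply Rmult_lt_reg_r with (e - V1); [lra|]. field_simplify; lra. }
assert (E2 : 0 < (e - V2) / (e + V2) < 1).
{ split; [apply Rdiv_lt_0_compat; lra|].
  apply Rmult_lt_reg_r with (e + V2); [lra|]. field_simplify; lra. }
nra.
Qed.

Theorem theorem3
    (F : fluid) (r0 : R) (S1 S2 : ahead) (rho0 V10 V20 : R)
    (H1 H2 : R * R * R -> R) (dal0 dbe0 epsbar : R)
    (alpha beta t r : R * R -> R)
    (hr0 : 0 < r0)
    (hS1 : left_ahead F r0 S1)
    (hS2 : right_ahead F r0 S2)
    (h0 : interaction_point F r0 S1 S2 rho0 V10 V20)
    (hH1 : is_H1 F r0 rho0 S1 H1)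
    (hH2 : is_H2 F r0 rho0 S2 H2)
    (hslopes : origin_slopes F r0 S1 S2 rho0 V10 V20 H1 H2 dal0 dbe0)
    (hepsbar : 0 < epsbar)
    (hC2 : Ck_on 2 (T_dom (a_of (eta F rho0) V10 V20) epsbar) alpha /\
           Ck_on 2 (T_dom (a_of (eta F rho0) V10 V20) epsbar) beta /\
           Ck_on 2 (T_dom (a_of (eta F rho0) V10 V20) epsbar) t /\
           Ck_on 2 (T_dom (a_of (eta F rho0) V10 V20) epsbar) r)
    (hsol : shock_solution F r0 S1 S2 rho0 V10 V20 dal0 dbe0
              (a_of (eta F rho0) V10 V20) epsbar alpha beta t r) :
  exists eps0 : R, 0 < eps0 <= epsbar /\
    forall eps : R, 0 < eps <= eps0 ->
      smooth_on (T_dom (a_of (eta F rho0) V10 V20) eps) alpha /\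
      smooth_on (T_dom (a_of (eta F rho0) V10 V20) eps) beta /\
      smooth_on (T_dom (a_of (eta F rho0) V10 V20) eps) t /\
      smooth_on (T_dom (a_of (eta F rho0) V10 V20) eps) r.
Proof.
clear hH1 hH2 hslopes.
destruct h0 as [Hrho0 [[RH1 _] [[RH2 _] [[Hd1 Hd1'] [Hd1'' [[Hd2 Hd2'] Hd2'']]]]]].
set (e0 := eta F rho0) in *. set (a := a_of e0 V10 V20) in *.
assert (Ha : 0 < a < 1) by (apply a_of_bounds; lra).
destruct hS1 as [_ [_ [_ [Hsr1 [Hsw1 Hp1]]]]]. destruct hS2 as [_ [_ [_ [Hsr2 [Hsw2 Hp2]]]]].
assert (Hpos1 := fun p Hp => proj1 (Hp1 p Hp)). assert (Hpos2 := fun p Hp => proj1 (Hp2 p Hp)).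
destruct hC2 as [C2al [C2be [C2t C2r]]].
set (T := T_dom a epsbar) in *.
destruct hsol as [Hrange Hpde Hb1 Hb2 Hj1 Hj2 [Ot [Or [Oal Obe]]] [ru0 [alv0 [beu0 [Or' _]]]]
  [OV1 OV2] _ _].
destruct (Ck_on_grad _ _ _ C2t) as [tu [tv [Gt [Ctu Ctv]]]].
destruct (Ck_on_grad _ _ _ C2al) as [alu [alv [Gal [Calu Calv]]]].
destruct (Ck_on_grad _ _ _ C2be) as [beu [bev [Gbe [Cbeu Cbev]]]].
assert (Him : forall q, T q -> in_image F (alpha q) (beta q)) by (intros q Hq; now apply Hrange).
assert (Hci : forall q, T q -> c_in F (alpha q) (beta q) = speed_in F alpha beta q).
{ intros q Hq. unfold c_in. rewrite (rho_of_h F _ _ (Him q Hq)), (w_of_h F _ _ (Him q Hq)).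
  reflexivity. }
assert (Hco : forall q, T q -> c_out F (alpha q) (beta q) = speed_out F alpha beta q).
{ intros q Hq. unfold c_out. rewrite (rho_of_h F _ _ (Him q Hq)), (w_of_h F _ _ (Him q Hq)).
  reflexivity. }
assert (HA : forall q, T q -> A_coef F (alpha q) (beta q) (r q) = source F alpha beta r q).
{ intros q Hq. unfold A_coef. rewrite (rho_of_h F _ _ (Him q Hq)), (w_of_h F _ _ (Him q Hq)).
  reflexivity. }
(* The partial derivatives in the equations are given pointwise; uniqueness of gradients on the
   triangle identifies them with the C^1 functions obtained from the C^2 hypothesis. *)
assert (Hp : forall q, T q ->
  is_grad T r q (speed_in F alpha beta q * tu q) (speed_out F alpha beta q * tv q) /\
  alv q = source F alpha beta r q * tv q /\ beu q = source F alpha beta r q * tu q).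
{ intros q Hq.
  destruct (Hpde q Hq) as [pru [prv [ptu [ptv [palu [palv [pbeu [pbev
    [P1 [P2 [P3 [P4 [P5 [P6 [P7 P8]]]]]]]]]]]]]]].
  destruct (is_grad_unique a epsbar Ha hepsbar t q _ _ _ _ Hq P2 (Gt q Hq)) as [-> ->].
  destruct (is_grad_unique a epsbar Ha hepsbar alpha q _ _ _ _ Hq P3 (Gal q Hq)) as [_ ->].
  destruct (is_grad_unique a epsbar Ha hepsbar beta q _ _ _ _ Hq P4 (Gbe q Hq)) as [-> _].
  rewrite Hci in P5 by exact Hq. rewrite Hco in P6 by exact Hq.
  rewrite HA in P7, P8 by exact Hq. rewrite P5, P6 in P1. auto. }
assert (HO : T (0, 0)) by (apply T_dom_diag; auto; nra).
assert (Oe : enth alpha beta (0, 0) = enthalpy_int F rho0).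
{ unfold enth. rewrite Oal, Obe. unfold beta0, riem_beta. field. }
assert (Os : sound F alpha beta (0, 0) = e0).
{ unfold sound, eta_h. rewrite Oe, rho_h_eq by exact Hrho0. reflexivity. }
assert (Ov : vel alpha beta (0, 0) = 0) by (unfold vel; rewrite Oal, Obe; field).
(* The normalization [r_v = 1] at the origin, where the outgoing speed is [e0]. *)
assert (Otv : tv (0, 0) = / e0).
{ destruct (is_grad_unique a epsbar Ha hepsbar r (0, 0) _ _ _ _ HO (proj1 (Hp _ HO)) Or')
    as [_ E].
  unfold speed_out in E. rewrite Os, Ov in E.
  apply Rmult_eq_reg_l with e0; [|lra]. rewrite Rinv_r by lra. lra. }
assert (Hlow : forall k f, CkR2 (S k) T f -> CkR2 0 T f).
{ intros k f. apply Ck_on_le. lia. }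
assert (Cal := Hlow _ _ C2al). assert (Cbe := Hlow _ _ C2be).
assert (Ct := Hlow _ _ C2t). assert (Cr := Hlow _ _ C2r).
assert (Haep : 0 < a * epsbar) by nra.
assert (HD1 : D_left S1 (0, r0)).
{ destruct (Hb1 0 ltac:(lra)) as [HD _]. now rewrite Ot, Or in HD. }
assert (HD2 : D_right S2 (0, r0)).
{ destruct (Hb2 0 ltac:(lra)) as [HD _]. now rewrite Rmult_0_r, Ot, Or in HD. }
destruct (shock_curve_near F a epsbar alpha beta t r S1 (D_left S1) 1 (a * epsbar))
  as [L1 [HL1 SC1]]; auto.
{ intros s Hs. rewrite Rmult_1_l. now apply T_dom_diag. }
{ intros s Hs. rewrite Rmult_1_l. destruct (Hb1 s Hs) as [X1 [dr [dt [X2 [X3 X4]]]]].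
  split; [exact X1|]. split; [|exact (Hj1 s Hs)].
  exists dr, dt. split; [|split; [|exact X4]].
  - apply (is_derive_on_ext _ (fun s => r (s, s)) _ s dr dr Hs); auto.
    intros y _. now rewrite Rmult_1_l.
  - apply (is_derive_on_ext _ (fun s => t (s, s)) _ s dt dt Hs); auto.
    intros y _. now rewrite Rmult_1_l. }
(* With equal densities the mass balance forces the velocity ahead to vanish, so the incoming speed
   ahead would be [- e0], and the determinism condition would read [- e0 < V10 < - e0]. *)
{ rewrite Oe, rho_h_eq, Ot, Or by exact Hrho0. intros E.
  rewrite <- E in *. fold e0 in Hd1, Hd1'.
  assert (rho0 * w_a S1 (0, r0) = 0) by lra.
  apply Rmult_integral in H. destruct H; lra. }
{ unfold speed_in, speed_out. rewrite Os, Ov, OV1. lra. }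
destruct (shock_curve_near F a epsbar alpha beta t r S2 (D_right S2) a epsbar)
  as [L2 [HL2 SC2]]; auto.
{ intros s Hs. now apply T_dom_edge. }
{ intros s Hs. destruct (Hb2 s Hs) as [X1 X2]. split; [exact X1|]. split; [exact X2|].
  exact (Hj2 s Hs). }
{ rewrite Oe, rho_h_eq, Ot, Or by exact Hrho0. intros E.
  rewrite <- E in *. fold e0 in Hd2, Hd2'.
  assert (rho0 * w_a S2 (0, r0) = 0) by lra.
  apply Rmult_integral in H. destruct H; lra. }
{ unfold speed_in, speed_out. rewrite Os, Ov, OV2. lra. }
assert (Og1 : shock_ratio F alpha beta t r S1 (0, 0) = (e0 + V10) / (e0 - V10)).
{ unfold shock_ratio, shock_at, speed_in, speed_out. rewrite OV1, Os, Ov. f_equal; ring. }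
assert (Og2 : shock_ratio F alpha beta t r S2 (0, 0) = (e0 + V20) / (e0 - V20)).
{ unfold shock_ratio, shock_at, speed_in, speed_out. rewrite OV2, Os, Ov. f_equal; ring. }
(* At the origin the shock condition on the diagonal gives [tv = g * tu] with [g] and [tv]
   positive. *)
assert (Otu : 0 < tu (0, 0)).
{ assert (E : tv (1 * 0, 0) = 1 * shock_ratio F alpha beta t r S1 (1 * 0, 0) * tu (1 * 0, 0)).
  { apply (shock_ratio_eq F a epsbar alpha beta t r tu tv Gt (fun q Hq => proj1 (Hp q Hq)) S1 1 L1).
    - lra.
    - intros s Hs. rewrite Rmult_1_l. apply T_dom_diag; auto. lra.
    - intros s Hs. apply (SC1 s Hs).
    - intros s Hs. apply (SC1 s Hs).
    - lra. }
  rewrite !Rmult_1_l, Og1, Otv in E.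
  apply Rmult_lt_reg_l with ((e0 + V10) / (e0 - V10)); [apply Rdiv_lt_0_compat; lra|].
  rewrite Rmult_0_r, <- E. apply Rinv_0_lt_compat. lra. }
destruct (positive_near_origin a epsbar tu Ha hepsbar (Hlow _ _ Ctu) Otu) as [ex [Hex Px]].
destruct (positive_near_origin a epsbar tv Ha hepsbar (Hlow _ _ Ctv)) as [ey [Hey Py]].
{ rewrite Otv. apply Rinv_0_lt_compat. lra. }
(* [L1] bounds the parameter of the diagonal, which runs up to [a * ep]; hence [L1 / a]. *)
set (ep := Rmin (Rmin ex ey) (Rmin (L1 / a) L2)).
assert (Hep : 0 < ep).
{ repeat apply Rmin_pos; try lra. apply Rdiv_lt_0_compat; lra. }
assert (Hepx : ep <= Rmin ex ey) by apply Rmin_l.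
assert (HepL : ep <= Rmin (L1 / a) L2) by apply Rmin_r.
pose proof (Rmin_l ex ey). pose proof (Rmin_r ex ey).
pose proof (Rmin_l (L1 / a) L2). pose proof (Rmin_r (L1 / a) L2).
assert (HepL1 : a * ep <= L1).
{ apply Rle_trans with (a * (L1 / a)); [apply Rmult_le_compat_l; lra|]. right. field. lra. }
assert (Hsub : forall q, T_dom a ep q -> T q).
{ intros q. apply T_dom_subset. lra. }
assert (Qx : forall q, T_dom a ep q -> tu q <> 0).
{ intros q Hq. apply Rgt_not_eq, Px. apply T_dom_subset with ep; [lra | exact Hq]. }
assert (Qy : forall q, T_dom a ep q -> tv q <> 0).
{ intros q Hq. apply Rgt_not_eq, Py. apply T_dom_subset with ep; [lra | exact Hq]. }
assert (Gs : forall f q fu fv, T_dom a ep q -> is_grad T f q fu fv ->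
  is_grad (T_dom a ep) f q fu fv).
{ intros f q fu fv Hq. apply (fderiv_subset (E := R2)); auto. }
assert (Cs : forall f, CkR2 1 T f -> CkR2 1 (T_dom a ep) f).
{ intros f. exact (Ck_on_subset (E := R2) 1 _ _ _ Hsub). }
assert (RS : regular_solution F a S1 S2 (D_left S1) (D_right S2) alpha beta t r tu tv
  (fun q => alu q / tu q) (fun q => bev q / tv q) ep).
{ split.
  - intros q Hq. now apply Him, Hsub.
  - intros q Hq. now apply Hrange, Hsub.
  - intros q Hq. apply Gs; auto.
  - intros q Hq. apply Gs; [exact Hq|]. now apply Hp, Hsub.
  - intros q Hq. apply Gs; [exact Hq|].
    apply (is_grad_eq _ _ _ _ _ _ _ (Gal q (Hsub q Hq))).
    + field. now apply Qx.
    + now apply Hp, Hsub.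
  - intros q Hq. apply Gs; [exact Hq|].
    apply (is_grad_eq _ _ _ _ _ _ _ (Gbe q (Hsub q Hq))).
    + now apply Hp, Hsub.
    + field. now apply Qy.
  - exact Qx.
  - exact Qy.
  - now apply Cs.
  - now apply Cs.
  - apply (Ck_on_div (E := R2)); auto.
  - apply (Ck_on_div (E := R2)); auto.
  - now apply shock_curve_restrict with L1.
  - apply shock_curve_restrict with L2; [lra | exact SC2]. }
destruct (regular_solution_smooth_near F a Ha S1 S2 (D_left S1) (D_right S2) Hsr1 Hsw1 Hpos1
  Hsr2 Hsw2 Hpos2 alpha beta t r tu tv (fun q => alu q / tu q) (fun q => bev q / tv q)
  ep Hep RS) as [ep0 [Hep0 [Sal [Sbe [St Sr]]]]].
(* The constant [a] is by definition the quotient of the two ratios at the origin. *)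
{ rewrite Rmult_0_r, Og1, Og2. unfold a, a_of. field. repeat split; lra. }
exists ep0. split; [lra|]. intros eps Heps.
assert (Hfin : forall f, smooth_on (E := R2) (T_dom a ep0) f ->
  smooth_on (E := R2) (T_dom a eps) f).
{ intros f Hf k. refine (Ck_on_subset (E := R2) k _ _ _ _ (Hf k)).
  intros q. apply T_dom_subset. lra. }
split; [|split; [|split]]; auto.
Qed.
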